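(* Let $K$ be a number field of degree $n$ whose unit group $\mathcal O_K^*$ has rank $r\geq 1$, let $N$ be a positive integer, let $\mathfrak a$ be a nonzero ideal of $\mathcal O_K$, let $B\ge1$ be a real number, and fix a system of fundamental units $\boldsymbol\epsilon=\{\epsilon_1,\ldots,\epsilon_r\}$ in $K$. For every point $P\in\Omega(\mathfrak a,B)$ there exist $x_0,\ldots,x_N\in\mathfrak a$ such that the following hold: (1) $P=[x_0,\ldots,x_N]$; (2) $\mathfrak a$ is the ideal generated by $x_0,\ldots,x_N$; (3) $|N_{K/\mathbb Q}(x_i)|\le B\cdot\mathrm N(\mathfrak a)$ for all $i$; (4) $\Phi(x_i)\in\mathcal P(\mathfrak a,B)$ for all $i$.
   Context: $\mathrm N(\mathfrak a)$ denotes the norm of the ideal $\mathfrak a$. For each place $v$ of $K$, let $|\cdot|_v$ be the absolute value extending one of the standard absolute values of $\mathbb Q$, $n_v=[K_v:\mathbb Q_v]$ the local degree, and $\|x\|_v=|x|_v^{n_v}$. Write $v|\infty$ for archimedean places; for such $v$, $\sigma_v:K\to K_v\in\{\mathbb R,\mathbb C\}$ is the corresponding embedding. Height: for $P=[x_0,\ldots,x_N]\in\mathbb P^N(K)$, $H_K(P)=\prod_v\max_i\|x_i\|_v$ over all places $v$ of $K$. The class $\mathrm{Cl}(P)$ is the ideal class of the fractional ideal generated by $x_0,\ldots,x_N$ (independent of the choice of homogeneous coordinates), and $\mathrm{Cl}(\mathfrak a)$ is the ideal class of $\mathfrak a$. Define $\Omega(\mathfrak a,B)=\{P\in\mathbb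 P^N(K):\mathrm{Cl}(P)=\mathrm{Cl}(\mathfrak a)\text{ and }H_K(P)\le B\}$. Units: $\Lambda:K^*\to\prod_{v|\infty}\mathbb R$, $\Lambda(x)=(\log\|x\|_v)_v$. A system of fundamental units is a collection $\boldsymbol\epsilon=\{\epsilon_1,\ldots,\epsilon_r\}\subset\mathcal O_K^*$ such that the $\Lambda(\epsilon_j)$ form a basis of the lattice $\Lambda(\mathcal O_K^* )$. Put $F(\boldsymbol\epsilon)=\{t_1\Lambda(\epsilon_1)+\cdots+t_r\Lambda(\epsilon_r):|t_j|\le1/2\text{ for all }j\}$ and $D_v=\max_{\eta\in F(\boldsymbol\epsilon)}\eta_v$ for $v|\infty$. $\Phi:K\to\prod_{v|\infty}K_v$ is the Minkowski embedding $x\mapsto(\sigma_v(x))_v$, and $\mathcal P(\mathfrak a,B)$ is the set of all $(s_v)\in\prod_{v|\infty}K_v$ such that $|s_v|\le(B\cdot\mathrm N(\mathfrak a))^{1/n}\exp(D_v/n_v)$ for all $v|\infty$. *)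

(* Defs.v *)
(* MathComp / MathComp-Analysis.  A number field is a K : fieldExtType rat, of
   degree \dim {:K}; the real numbers are an arbitrary R : realType. *)
From HB Require Import structures.
From mathcomp Require Import all_boot all_order all_algebra all_field.
From mathcomp Require Import finmap.
From mathcomp Require Import boolp classical_sets functions cardinality fsbigop.
From mathcomp Require Import reals sequences exp complex.

Set Implicit Arguments.
Unset Strict Implicit.
Unset Printing Implicit Defensive.

Import Order.TTheory GRing.Theory Num.Theory.
Local Open Scope classical_set_scope.
Local Open Scope ring_scope.

Section Integers.
Variable K : fieldExtType rat.

Definition ring_of_integers : set K := [set x | integralOver (intr : int -> K) x].
Local Notation OK := ring_of_integers.

Definition int_unit (u : K) := [/\ u != 0, OK u & OK u^-1].

Definition is_ideal (a : set K) :=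
  [/\ a `<=` OK, a 0,
      forall x y, a x -> a y -> a (x + y)
    & forall c x, OK c -> a x -> a (c * x)].

Definition nonzero_ideal (a : set K) := is_ideal a /\ exists2 x, a x & x != 0.

Definition span_ideal m (x : 'rV[K]_m) : set K :=
  [set z | exists2 c : 'I_m -> K, (forall i, OK (c i))
                                & z = \sum_(i < m) c i * x 0 i].

(* The class of a fractional ideal a: its orbit { c a | c in K^* }, i.e. its
   coset modulo principal fractional ideals. *)
Definition ideal_class (a : set K) : set (set K) :=
  [set b | exists2 c : K, c != 0 & b = [set c * x | x in a]].

(* N(a) = #(O_K / a), the elements of O_K / a being the cosets x + a. *)
Definition ideal_norm (a : set K) : nat :=
  #|` fset_set [set [set x + y | y in a] | x in OK] |.

Definition field_norm (x : K) : rat :=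
  \det (passmx.mxof (vbasis {:K}) (vbasis {:K}) (amull x)).

End Integers.

Section ProjectiveSpace.
Variables (K : fieldExtType rat) (N : nat).

Definition hcoords := {x : 'rV[K]_N.+1 | x != 0}.

Definition proportional (x y : hcoords) : bool :=
  `[< exists2 c : K, c != 0 & val y = c *: val x >].

Lemma proportional_equiv : equiv_class_of proportional.
Proof.
split=> [x|x y|y x z].
- by apply/asboolP; exists 1; rewrite ?oner_neq0 ?scale1r.
- by apply/asboolP/asboolP => -[c c0 e]; exists c^-1; rewrite ?invr_eq0// e
    scalerA mulVf// scale1r.
- move=> /asboolP[c c0 ey] /asboolP[d d0 ez]; apply/asboolP.
  by exists (d * c); rewrite ?mulf_neq0// ez ey scalerA.
Qed.

Canonical proportional_rel := EquivRelPack proportional_equiv.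

Definition proj_space := {eq_quot proportional_rel}%qT.

(* The point [x_0, ..., x_N]. *)
Definition proj_point (x : hcoords) : proj_space := (\pi_({eq_quot proportional_rel}) x)%qT.

(* Some homogeneous coordinates of P. *)
Definition coords (P : proj_space) : 'rV[K]_N.+1 :=
  val (repr (P : {eq_quot proportional_rel})%qT).

End ProjectiveSpace.

Section Places.
Variables (R : realType) (K : fieldExtType rat).

Definition absolute_value (v : K -> R) :=
  [/\ forall x, 0 <= v x,
      forall x, v x = 0 <-> x = 0,
      forall x y, v (x * y) = v x * v y
    & forall x y, v (x + y) <= v x + v y].

Definition padic_abs (p : nat) (q : rat) : R :=
  if q == 0 then 0
  else p%:R ^+ logn p `|denq q|%N / p%:R ^+ logn p `|numq q|%N.

Definition archimedean (v : K -> R) :=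
  forall q : rat, v (q%:A) = `| ratr q |.

Definition extends_padic (v : K -> R) :=
  exists2 p, prime p & forall q : rat, v (q%:A) = padic_abs p q.

Definition places : set (K -> R) :=
  [set v | absolute_value v /\ (archimedean v \/ extends_padic v)].

Definition cauchy_for (v : K -> R) (s : nat -> K) :=
  forall e : R, 0 < e -> exists m, forall i j,
    (m <= i)%N -> (m <= j)%N -> v (s i - s j) < e.

Definition null_for (v : K -> R) (s : nat -> K) :=
  forall e : R, 0 < e -> exists m, forall i, (m <= i)%N -> v (s i) < e.

(* The completion K_v is the ring of v-Cauchy sequences of K modulo the null
   sequences, and Q_v consists of the classes of sequences of rationals.  The
   sequences b_j represent a basis of K_v over Q_v when they span (second
   clause) and are linearly independent (third clause) modulo null
   sequences. *)
Definition completion_basis (v : K -> R) d (b : 'I_d -> nat -> K) :=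
  let Qv_seq (q : 'I_d -> nat -> rat) :=
    forall j, cauchy_for v (fun k => (q j k)%:A) in
  let comb (q : 'I_d -> nat -> rat) k := \sum_(j < d) (q j k)%:A * b j k in
  [/\ forall j, cauchy_for v (b j),
      forall s, cauchy_for v s ->
        exists2 q, Qv_seq q & null_for v (fun k => s k - comb q k)
    & forall q, Qv_seq q -> null_for v (comb q) ->
        forall j, null_for v (fun k => (q j k)%:A)].

(* n_v = [K_v : Q_v] *)
Definition local_degree (v : K -> R) : nat :=
  xget 0%N [set d | exists b : 'I_d -> nat -> K, completion_basis v b].

(* || x ||_v *)
Definition nabs (v : K -> R) (x : K) : R := v x ^+ local_degree v.

(* The factors are 1 for almost all v. *)
Definition coords_height m (x : 'rV[K]_m) : R :=
  \big[*%R/1]_(v \in places) \big[Num.max/0]_(i < m) nabs v (x 0 i).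

Definition height N (P : proj_space K N) : R := coords_height (coords P).

Definition Omega N (a : set K) (B : R) : set (proj_space K N) :=
  [set P | ideal_class (span_ideal (coords P)) = ideal_class a /\ height P <= B].

Definition inf_place := {v : K -> R | absolute_value v /\ archimedean v}.

Definition Lambda (x : K) : inf_place -> R := fun v => ln (nabs (sval v) x).

(* The Lambda(eps_j) form a Z-basis of Lambda(O_K^* ). *)
Definition fundamental_units r (eps : 'I_r -> K) :=
  [/\ forall j, int_unit (eps j),
      forall u, int_unit u -> exists m : 'I_r -> int, forall v,
        Lambda u v = \sum_(j < r) (m j)%:~R * Lambda (eps j) v
    & forall m : 'I_r -> int,
        (forall v, \sum_(j < r) (m j)%:~R * Lambda (eps j) v = 0) ->
        forall j, m j = 0].

Definition fund_domain r (eps : 'I_r -> K) : set (inf_place -> R) :=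
  [set eta | exists2 t : 'I_r -> R, (forall j, `|t j| <= 1 / 2%:R)
                & eta = fun v => \sum_(j < r) t j * Lambda (eps j) v].

(* D_v; the supremum is a maximum, fund_domain eps being the linear image of a
   compact cube. *)
Definition Dmax r (eps : 'I_r -> K) (v : inf_place) : R :=
  sup [set eta v | eta in fund_domain eps].

(* K_v, for v archimedean, as a subset of the complex numbers: the real line or
   everything. *)
Definition Kv (v : inf_place) : set R[i] :=
  [set z | local_degree (sval v) = 1%N -> complex.Im z = 0].

(* sigma_v : K -> K_v, a field embedding with |sigma_v(x)| = |x|_v.  It is
   unique if real and otherwise unique up to complex conjugation. *)
Definition sigma (v : inf_place) : K -> R[i] :=
  xget (fun=> 0)
    [set f : K -> R[i] | exists2 s : {rmorphism K -> R[i]},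
      f = s & forall x, Normc.normc (s x) = sval v x].

Definition Minkowski (x : K) : inf_place -> R[i] := fun v => sigma v x.

Definition Pbox r (eps : 'I_r -> K) (a : set K) (B : R) :
    set (inf_place -> R[i]) :=
  [set s | forall v, Kv v (s v) /\
     Normc.normc (s v) <= (B * (ideal_norm a)%:R) `^ (\dim {:K})%:R^-1
                  * expR (Dmax eps v / (local_degree (sval v))%:R)].

End Places.

Arguments Minkowski R {K} x v.

Section UnitRank.
Variable K : fieldExtType rat.

Definition mult_independent s (u : 'I_s -> K) :=
  forall m : 'I_s -> int, \prod_(j < s) u j ^ m j = 1 -> forall j, m j = 0.

(* The rank of the abelian group O_K^* is r: r is the largest size of a
   Z-linearly independent family. *)
Definition unit_rank (r : nat) :=
  (exists2 u : 'I_r -> K, forall j, int_unit (u j) & mult_independent u) /\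
  (forall s (u : 'I_s -> K), (forall j, int_unit (u j)) ->
     mult_independent u -> (s <= r)%N).

End UnitRank.

(* Main.v *)
Require Import Defs.
From HB Require Import structures.
From mathcomp Require Import all_boot all_order all_algebra all_field.
From mathcomp Require Import finmap.
From mathcomp Require Import boolp classical_sets cardinality fsbigop.
From mathcomp Require Import reals sequences exp complex.
From mathcomp Require Import zify ring lra.

Set Implicit Arguments.
Unset Strict Implicit.
Unset Printing Implicit Defensive.

Import Order.TTheory GRing.Theory Num.Theory.
Local Open Scope classical_set_scope.
Local Open Scope ring_scope.

(** Let x be homogeneous coordinates of P. As x generates an ideal in the class of
    a, some multiple y = c x generates a itself (ideal_class_span). By the product
    formula y may replace x in the height. At a finite place v the largest absolute
    value of the y_i is that of a local generator of a, and the normalised values of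
    these local generators have the product 1 / N(a) (ideal_norm_prod). So if A_j is
    the largest absolute value of the y_i under the j-th of the n complex embeddings
    of K, the height of P is (prod_j A_j) / N(a) (height_ideal), and therefore
    prod_j A_j <= B N(a).

    The generators y of a may still be multiplied by a unit. Minus their mean, the
    ln A_j are the coordinates of a vector of sum 0, invariant under complex
    conjugation, and such vectors are spanned by the logarithms of the fundamental
    units (units_span). Multiplying y by a suitable unit u brings the coefficients
    of this vector into [-1/2, 1/2] (balancing_unit): then ln A_j exceeds its mean,
    which is at most ln (B N(a)) / n, by at most D_v / n_v, where v is the place of
    the j-th embedding; this places the coordinates in the box. The product of the
    A_j is not changed by u and bounds the norms of the coordinates.

    The spanning property is the part of Dirichlet's unit theorem that says that the
    rank is maximal. By the box principle any prescribed vector of logarithms of sum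
    0 is attained, up to a constant, by an integral element of bounded norm
    (small_element); quotients of such elements in the same class modulo an integer
    are units (unit_near), so the logarithms of units come close to every vector of
    the hyperplane.

    The height is a product over all absolute values of K that extend those of Q,
    with exponents defined by completions, so the places have to be classified. The
    finite ones correspond to the maximal ideals of the ring of integers
    (fin_place_inj, fin_place_exists), and the normalised absolute value of a
    uniformizer is the inverse of the size of the residue field (nabs_uniformizer).
    The archimedean ones come from the embeddings (arch_place_emb), and n_v counts
    those that induce v (local_degree_emb). The index N(a) is computed one place at
    a time, through a chain of ideals each of which has in the preceding one the
    index of a residue field (level_ideal_card); for a principal ideal it is the
    norm of a generator (ideal_norm_principal), whence the product formula. *)

(** * Embeddings of a number field in the complex numbers *)

Section RMorphismPack.
Variables (A B : nzRingType) (g : A -> B).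
Hypotheses (gB : zmod_morphism g) (gM : monoid_morphism g).

HB.instance Definition _ := GRing.isZmodMorphism.Build A B g gB.
HB.instance Definition _ := GRing.isMonoidMorphism.Build A B g gM.

(** Existence form, for a map that is constructed inside a proof. *)
Lemma rmorphism_of : exists s : {rmorphism A -> B}, s =1 g.
Proof. by exists g. Qed.

End RMorphismPack.

(** The extension is separable because Q has characteristic 0. *)
Lemma primitive_element (K : fieldExtType rat) :
  exists theta : K, <<1; theta>>%VS = fullv.
Proof.
exists (separable_generator 1%AS {:K}%AS).
rewrite -eq_adjoin_separable_generator ?sub1v //.
apply/separableP => y _; apply: pcharf0_separable => p.
by rewrite pchar_lalg pchar_num.
Qed.

Section Embeddings.
Variables (R : realType) (K : fieldExtType rat).
Let C : numClosedFieldType := R[i].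
Notation n := (\dim {:K}).

(** An embedding is determined by the image of a primitive element, which is any
    root of its minimal polynomial; the n roots in C are distinct. The primitive
    element is recorded because the distinct values that the embeddings take at it
    are the nodes of a Vandermonde determinant. *)
Lemma embeddings_exist : exists e : K * ('I_n -> {rmorphism K -> C}),
  injective (fun j => e.2 j e.1) /\
  forall s : {rmorphism K -> C}, exists j, s =1 e.2 j.
Proof.
have [th genth] := primitive_element K.
pose evK (q : {poly rat}) := (map_poly (GRing.in_alg K) q).[th].
pose evC (q : {poly rat}) (z : C) := (map_poly ratr q).[z].
have [f fE] : exists f, minPoly 1 th = map_poly (GRing.in_alg K) f.
  exact/polyOver1P/minPolyOver.
have evKP x : exists q, x = evK q.
  by apply/Fadjoin1_polyP; rewrite genth memvf.
have dvdf q : evK q = 0 -> f %| q.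
  move=> q0; rewrite -(dvdp_map (GRing.in_alg K)) -fE minPoly_dvdp //.
    by apply/polyOver1P; exists q.
  by rewrite /root -/(evK q) q0.
have evf0 : evK f = 0 by rewrite /evK -fE minPolyxx.
have szf : size f = n.+1.
  rewrite -(size_map_poly (GRing.in_alg K)) -fE size_minPoly.
  by rewrite -genth dim_Fadjoin dimv1 muln1.
have [rs rsE] := closed_field_poly_normal (map_poly (ratr : rat -> C) f).
have f_neq0 : f != 0 by rewrite -size_poly_eq0 szf.
have lcf : lead_coef (map_poly (ratr : rat -> C) f) != 0.
  by rewrite lead_coef_eq0 map_poly_eq0.
have urs : uniq rs.
  have : separable_poly f.
    rewrite -(separable_map (GRing.in_alg K)) -fE.
    apply: pcharf0_separable => p; by rewrite pchar_lalg pchar_num.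
  rewrite -(separable_map (ratr : {rmorphism rat -> C})) rsE.
  by rewrite (eqp_separable (eqp_scale _ lcf)) separable_prod_XsubC.
have szrs : size rs = n.
  have := size_map_poly (ratr : {rmorphism rat -> C}) f.
  by rewrite szf rsE size_scale // size_prod_XsubC => -[].
have rootP z : (z \in rs) = (evC f z == 0).
  by rewrite -root_prod_XsubC -(rootZ _ _ lcf) -rsE.
pose pol x := sval (cid (evKP x)).
have polE x : x = evK (pol x) by rewrite /pol; case: cid.
have polC z q x : evC f z = 0 -> x = evK q -> evC q z = evC (pol x) z.
  move=> fz xq; have /dvdpP[h hE] : f %| q - pol x.
    by apply: dvdf; rewrite /evK rmorphB hornerD hornerN -/(evK _) -/(evK _)
      -xq -polE subrr.
  apply/eqP; rewrite -subr_eq0 -hornerN -hornerD -rmorphB /= hE.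
  by rewrite rmorphM hornerM -/(evC f z) fz mulr0.
have ex_s z : evC f z = 0 -> exists s : {rmorphism K -> C},
    forall x, s x = evC (pol x) z.
  move=> fz; apply: (@rmorphism_of K C (fun x => evC (pol x) z)).
    move=> x y; rewrite -(polC z (pol x - pol y)) //.
      by rewrite /evC rmorphB hornerD hornerN.
    by rewrite /evK rmorphB hornerD hornerN -/(evK _) -/(evK _) -!polE.
  split=> [|x y].
    by rewrite -(polC z 1) /evC /evK // rmorph1 hornerC.
  rewrite -(polC z (pol x * pol y)) //.
    by rewrite /evC rmorphM hornerM.
  by rewrite /evK rmorphM hornerM -/(evK _) -/(evK _) -!polE.
have sth (s : {rmorphism K -> C}) q : s (evK q) = evC q (s th).
  rewrite /evK -horner_map /= -map_poly_comp /evC; congr (_.[_]).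
  by apply: eq_map_poly => a; rewrite -(fmorph_eq_rat (s \o GRing.in_alg K)).
have rsj (j : 'I_n) : evC f rs`_j = 0.
  by apply/eqP; rewrite -rootP mem_nth // szrs.
pose sg j := sval (cid (ex_s _ (rsj j))).
have sgE j x : sg j x = evC (pol x) rs`_j by rewrite /sg; case: cid.
have sgth j : sg j th = rs`_j.
  rewrite sgE -(polC _ 'X) // ?/evC ?/evK ?map_polyX ?hornerX //.
exists (th, sg); split=> /= [i j|s].
  rewrite !sgth => /eqP; rewrite nth_uniq ?szrs // => /eqP ij.
  exact: val_inj.
have : s th \in rs by rewrite rootP -sth evf0 rmorph0.
move=> /(nthP 0)[j]; rewrite szrs => jn jE; exists (Ordinal jn) => x.
by rewrite sgE {1}(polE x) sth -jE.
Qed.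

Definition primitive : K := (sval (cid embeddings_exist)).1.

Definition emb : 'I_n -> {rmorphism K -> C} := (sval (cid embeddings_exist)).2.

Lemma emb_primitive_inj : injective (fun j => emb j primitive).
Proof. by have [] := svalP (cid embeddings_exist). Qed.

Lemma emb_surj (s : {rmorphism K -> C}) : exists j, s =1 emb j.
Proof. by have [_ /(_ s)] := svalP (cid embeddings_exist). Qed.

End Embeddings.

(** * Bases, norms and integrality *)

(** Integrality over Z does not depend on the field of characteristic 0 that contains
    q, and among the algebraic numbers a rational algebraic integer is an integer. *)
Lemma int_of_integral (q : rat) (C : numClosedFieldType) :
  integralOver (intr : int -> C) (ratr q) -> exists m : int, q = m%:~R.
Proof.
case=> p monp rtp.
have pE (F : numFieldType) :
    map_poly (intr : int -> F) p = map_poly ratr (map_poly (intr : int -> rat) p).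
  by rewrite -map_poly_comp; apply: eq_map_poly => m /=; rewrite ratr_int.
have rtq : root (map_poly intr p) q.
  by rewrite -(fmorph_root (ratr : {rmorphism rat -> C})) /= -pE.
have : (ratr q : algC) \in Aint.
  apply: (root_monic_Aint (p := map_poly intr p)).
  - by rewrite pE (fmorph_root (ratr : {rmorphism rat -> algC})).
  - by rewrite monic_map.
  - by apply/polyOverP => i; rewrite coef_map intr_int.
move/(Cint_rat_Aint (Crat_rat q)) => /intrP[m mE]; exists m.
apply: (fmorph_inj (ratr : {rmorphism rat -> algC})).
exact: (etrans mE (esym (ratr_int algC m))).
Qed.

Section Bases.
Variables (R : realType) (K : fieldExtType rat).
Notation n := (\dim {:K}).
Local Notation C := (R[i]).
Local Notation OK := (@ring_of_integers K).

Lemma embZ j q (x : K) : emb R j (q *: x) = ratr q * emb R j x.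
Proof.
by rewrite -mulr_algl rmorphM -(fmorph_eq_rat (emb R j \o GRing.in_alg K)).
Qed.

Lemma emb_rat j q : emb R j (q%:A : K) = ratr q.
Proof. by rewrite embZ rmorph1 mulr1. Qed.

(** The square of the determinant of this matrix is the discriminant of the
    family w, which is nonzero exactly when w is a Q-basis of K. *)
Definition emb_mx (w : 'I_n -> K) : 'M[C]_n := \matrix_(i, j) emb R j (w i).

Definition is_qbasis (w : 'I_n -> K) := \det (emb_mx w) != 0.

Lemma emb_mx_comb (w u : 'I_n -> K) (A : 'M[rat]_n) :
  (forall i, w i = \sum_j A i j *: u j) -> emb_mx w = map_mx ratr A *m emb_mx u.
Proof.
move=> wE; apply/matrixP => i k; rewrite !mxE wE rmorph_sum.
by apply: eq_bigr => j _; rewrite !mxE embZ.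
Qed.

(** The embeddings diagonalise the multiplication by x. *)
Lemma emb_mx_mul (w u : 'I_n -> K) x : (forall i, w i = x * u i) ->
  emb_mx w = emb_mx u *m diag_mx (\row_j emb R j x).
Proof.
move=> wE; rewrite mul_mx_diag; apply/matrixP => i j.
by rewrite !mxE wE rmorphM mulrC.
Qed.

(** A Vandermonde determinant with distinct nodes. *)
Lemma powers_qbasis : is_qbasis (fun i => primitive R K ^+ i).
Proof.
rewrite /is_qbasis; have -> : emb_mx (fun i => primitive R K ^+ i) =
          Vandermonde n (\row_j emb R j (primitive R K)).
  by apply/matrixP => i j; rewrite !mxE rmorphXn.
rewrite det_Vandermonde; apply/prodf_neq0 => i _.
apply/prodf_neq0 => j ij; rewrite !mxE subr_eq0.
by apply: contraTneq ij => /emb_primitive_inj ->; rewrite ltnn.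
Qed.

(** The powers of a primitive element are combinations of w, so det (emb_mx w) is
    a factor of their nonzero determinant. *)
Lemma spanning_qbasis (w : 'I_n -> K) :
  (forall x, exists q : 'I_n -> rat, x = \sum_j q j *: w j) -> is_qbasis w.
Proof.
move=> spw; have /choice[q qE] := spw.
pose A := \matrix_(i, j) q (primitive R K ^+ (i : 'I_n)) j.
have := powers_qbasis; rewrite /is_qbasis (@emb_mx_comb _ w A).
  by rewrite det_mulmx mulf_eq0 negb_or => /andP[].
by move=> i; rewrite [LHS]qE; apply: eq_bigr => j _; rewrite mxE.
Qed.

Lemma vbasis_coord (x : K) :
  x = \sum_j coord (vbasis {:K}) j x *: (vbasis {:K})`_j.
Proof. by apply: coord_vbasis; rewrite memvf. Qed.

Lemma vbasis_qbasis : is_qbasis (fun i => (vbasis {:K})`_i).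
Proof. by apply: spanning_qbasis => x; exists (fun j => coord (vbasis {:K}) j x);
  exact: vbasis_coord. Qed.

Lemma qbasis_span (w : 'I_n -> K) : is_qbasis w ->
  forall x, exists q : 'I_n -> rat, x = \sum_j q j *: w j.
Proof.
move=> wb x; pose A := \matrix_(i, j) coord (vbasis {:K}) j (w i) : 'M[rat]_n.
have wE : emb_mx w = map_mx ratr A *m emb_mx (fun i => (vbasis {:K})`_i).
  apply: emb_mx_comb => i; rewrite [LHS]vbasis_coord.
  by apply: eq_bigr => j _; rewrite mxE.
have Au : A \in unitmx.
  move: wb; rewrite /is_qbasis wE det_mulmx mulf_eq0 negb_or => /andP[+ _].
  by rewrite (det_map_mx (ratr : {rmorphism rat -> C})) fmorph_eq0 unitmxE unitfE.
pose q := (\row_j coord (vbasis {:K}) j x) *m invmx A.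
have qA : q *m A = \row_j coord (vbasis {:K}) j x by rewrite mulmxKV.
exists (fun j => q 0 j); rewrite [LHS]vbasis_coord.
transitivity (\sum_j (q *m A) 0 j *: (vbasis {:K})`_j).
  by apply: eq_bigr => j _; rewrite qA mxE.
under eq_bigr do rewrite mxE scaler_suml.
rewrite exchange_big /=; apply: eq_bigr => i _.
rewrite [in RHS](vbasis_coord (w i)) scaler_sumr; apply: eq_bigr => j _.
by rewrite scalerA [A i j]mxE.
Qed.

Lemma qbasis_free (w : 'I_n -> K) (q : 'I_n -> rat) : is_qbasis w ->
  \sum_j q j *: w j = 0 -> forall j, q j = 0.
Proof.
move=> wb q0 j.
have : map_mx ratr (\row_j q j) *m emb_mx w = 0.
  apply/rowP => k; rewrite !mxE -[RHS](rmorph0 (emb R k)) -q0 rmorph_sum.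
  by apply: eq_bigr => i _; rewrite !mxE embZ.
move/(congr1 (mulmxr (invmx (emb_mx w)))); rewrite /= mul0mx mulmxK; last first.
  by rewrite unitmxE unitfE.
by move/rowP/(_ j); rewrite !mxE => /eqP; rewrite fmorph_eq0 => /eqP.
Qed.

(** The matrix of embeddings of the family x * w i is a product in two ways, by A on
    the left and by the diagonal matrix of the conjugates of x on the right. *)
Lemma det_mulmx_emb (w : 'I_n -> K) x (A : 'M[rat]_n) : is_qbasis w ->
  (forall i, x * w i = \sum_j A i j *: w j) -> ratr (\det A) = \prod_j emb R j x.
Proof.
move=> wb xE; have := emb_mx_comb xE.
rewrite (@emb_mx_mul _ w x) // => /(congr1 determinant).
rewrite !det_mulmx mulrC => /(mulIf wb); rewrite -det_map_mx => <-.
by rewrite det_diag; apply: eq_bigr => j _; rewrite !mxE.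
Qed.

Lemma field_normE (x : K) : ratr (field_norm x) = \prod_j emb R j x.
Proof.
apply: (det_mulmx_emb vbasis_qbasis) => i.
have := passmx.mul_mxof (vbasis {:K}) (vbasis {:K}) (amull x) (delta_mx 0 i).
rewrite -rowE passmx.vecof_delta lfunE /= => rE.
rewrite [LHS]vbasis_coord; apply: eq_bigr => j _; congr (_ *: _).
by move/rowP/(_ j): rE; rewrite !mxE => ->.
Qed.

Lemma field_normM : {morph @field_norm K : x y / x * y}.
Proof.
move=> x y; apply: (fmorph_inj (ratr : {rmorphism rat -> C})).
rewrite rmorphM /= !field_normE -big_split; apply: eq_bigr => j _.
by rewrite rmorphM.
Qed.

Lemma field_norm_eq0 (x : K) : (field_norm x == 0) = (x == 0).
Proof.
rewrite -(fmorph_eq0 (ratr : {rmorphism rat -> C})) /= field_normE.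
apply/prodf_eq0/eqP => [[j _]|->]; first by rewrite fmorph_eq0 => /eqP.
have n_gt0 : (0 < n)%N by rewrite adim_gt0.
by exists (Ordinal n_gt0); rewrite // rmorph0.
Qed.

End Bases.

Section Integers.
Variable K : fieldExtType rat.
Notation n := (\dim {:K}).
Local Notation OK := (@ring_of_integers K).

Lemma intK_eq0 (m : int) : (m%:~R == 0 :> K) = (m == 0).
Proof.
by rewrite -(rmorph_int (GRing.in_alg K)) (fmorph_eq0 (GRing.in_alg K)) intr_eq0.
Qed.

Lemma natK_eq0 (m : nat) : (m%:R == 0 :> K) = (m == 0%N).
Proof. exact: (intK_eq0 m). Qed.

Lemma OK_add x y : OK x -> OK y -> OK (x + y).
Proof. exact: integral_add. Qed.

Lemma OK_sub x y : OK x -> OK y -> OK (x - y).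
Proof. exact: integral_sub. Qed.

Lemma OK_mul x y : OK x -> OK y -> OK (x * y).
Proof. exact: integral_mul. Qed.

Lemma OK0 : OK 0. Proof. exact: (integral0 (intr : {rmorphism int -> K})). Qed.

Lemma OK1 : OK 1. Proof. exact: (integral1 (intr : {rmorphism int -> K})). Qed.

Lemma OK_int m : OK m%:~R.
Proof. exact: (integral_id (intr : {rmorphism int -> K})). Qed.

Lemma OK_nat m : OK m%:R. Proof. exact: (OK_int m). Qed.

Lemma OK_exp x k : OK x -> OK (x ^+ k).
Proof.
move=> xO; elim: k => [|k IH]; first by rewrite expr0; exact: OK1.
by rewrite exprS; exact: OK_mul.
Qed.

Lemma OK_sum (I : Type) (r : seq I) (P : pred I) (F : I -> K) :
  (forall i, P i -> OK (F i)) -> OK (\sum_(i <- r | P i) F i).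
Proof. by move=> FO; elim/big_ind: _ => //; [exact: OK0|exact: OK_add]. Qed.

Lemma OK_prod (I : Type) (r : seq I) (P : pred I) (F : I -> K) :
  (forall i, P i -> OK (F i)) -> OK (\prod_(i <- r | P i) F i).
Proof. by move=> FO; elim/big_ind: _ => //; [exact: OK1|exact: OK_mul]. Qed.

Lemma emb_integral (R : realType) j (x : K) : OK x ->
  integralOver (intr : int -> R[i]) (emb R j x).
Proof.
move=> [p monp rtp]; exists p => //.
suff -> : map_poly (intr : int -> R[i]) p = map_poly (emb R j) (map_poly intr p).
  by rewrite fmorph_root.
by rewrite -map_poly_comp; apply: eq_map_poly => m /=; rewrite rmorph_int.
Qed.

(** Clearing the denominators of a polynomial of which x is a root leaves a
    polynomial with leading coefficient d, and then d x is integral. *)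
Lemma integral_multiple (x : K) : exists2 d : int, d != 0 & OK (d%:~R * x).
Proof.
have : algebraicOver (GRing.in_alg K) x.
  have /polyOver1P[p pE] := minPolyOver 1 x.
  exists p; last by rewrite -pE root_minPoly.
  by have := monic_neq0 (monic_minPoly 1 x); rewrite pE map_poly_eq0.
case=> p p0 rtp.
have [pz [a a0 pE]] := rat_poly_scale p.
have pz0 : pz != 0.
  by apply: contraNneq p0 => pz0; rewrite pE pz0 rmorph0 scaler0.
have rtz : root (map_poly (intr : int -> K) pz) x.
  have a1 : GRing.in_alg K a%:~R^-1 != 0.
    by rewrite (fmorph_eq0 (GRing.in_alg K)) invr_eq0 intr_eq0.
  move: rtp; rewrite pE map_polyZ (rootZ _ _ a1).
  rewrite -map_poly_comp; suff /eq_map_poly-> : GRing.in_alg K \o intr =1 intr by [].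
  by move=> m; exact: (rmorph_int (GRing.in_alg K)).
set d := lead_coef pz; exists d; rewrite ?lead_coef_eq0 //.
pose m := (size pz).-1.
have szp : size pz = m.+1 by rewrite prednK // size_poly_gt0.
have m_gt0 : (0 < m)%N.
  rewrite /m -subn1 subn_gt0 ltnNge; apply/negP => sz1.
  have := size1_polyC sz1 => pzC; move: rtz; rewrite pzC map_polyC /= rootC intK_eq0.
  by move=> /eqP c0; move: pz0; rewrite pzC c0 polyC0 eqxx.
(* the polynomial d^(m-1) * pz (X / d), monic and with integral coefficients *)
pose q := \poly_(i < m.+1) (if i == m then 1 else d ^+ (m - i.+1) * pz`_i).
have qm : q`_m = 1 by rewrite coef_poly ltnSn eqxx.
exists q.
  apply/monicP; rewrite lead_coefE.
  suff -> : size q = m.+1 by [].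
  apply/eqP; rewrite eqn_leq size_poly /= ltnNge; apply/negP => /leq_sizeP/(_ m (leqnn _)).
  by rewrite qm.
move: rtz; rewrite /root => /eqP rtz; apply/eqP.
transitivity ((d ^+ m.-1)%:~R * (map_poly intr pz).[x]); last first.
  by rewrite rtz mulr0.
rewrite (@horner_coef_wide _ m.+1); last by rewrite (leq_trans (size_poly _ _)) ?size_poly.
rewrite (@horner_coef_wide _ m.+1); last by rewrite -szp size_poly.
rewrite mulr_sumr; apply: eq_bigr => i _; rewrite !coef_map /= coef_poly ltn_ord.
rewrite exprMn; case: eqP => [im|/eqP im].
  rewrite im mul1r mulrA; congr (_ * _).
  have -> : pz`_m = d by rewrite /d lead_coefE.
  by rewrite -[(d ^+ _)%:~R]/(intr _) rmorphXn -exprSr prednK.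
have im' : (i < m)%N by rewrite ltn_neqAle im -ltnS ltn_ord.
rewrite !mulrA; congr (_ * _).
rewrite rmorphM /= mulrAC; congr (_ * _).
by rewrite !rmorphXn -exprD; congr (_ ^+ _); lia.
Qed.

End Integers.

(** * Integral bases *)

Section IntegralBases.
Variables (R : realType) (K : fieldExtType rat).
Notation n := (\dim {:K}).
Local Notation C := (R[i]).
Local Notation OK := (@ring_of_integers K).

(** The sum is rational, being the trace of the matrix of the multiplication by x in
    a basis, and integral, being a sum of integral elements. *)
Lemma trace_int (x : K) : OK x -> exists m : int, \sum_j emb R j x = m%:~R.
Proof.
move=> xO; pose b i := (vbasis {:K})`_i : K.
have /choice[q qE] := fun i : 'I_n => qbasis_span (vbasis_qbasis R K) (x * b i).
pose A := \matrix_(i, j) q i j : 'M[rat]_n.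
have bE : emb_mx R (fun i => x * b i) = map_mx ratr A *m emb_mx R b.
  by apply: emb_mx_comb => i; rewrite qE; apply: eq_bigr => j _; rewrite mxE.
have trE : \sum_j emb R j x = ratr (\tr A).
  rewrite (@emb_mx_mul _ _ _ b x) // in bE.
  have bu : emb_mx R b \in unitmx by rewrite unitmxE unitfE; exact: vbasis_qbasis.
  have -> : \sum_j emb R j x = \tr (diag_mx (\row_j emb R j x)).
    by rewrite mxtrace_diag; apply: eq_bigr => j _; rewrite mxE.
  rewrite -(mulKmx bu (diag_mx _)) bE mxtrace_mulC -mulmxA mulmxV // mulmx1.
  by rewrite /mxtrace rmorph_sum; apply: eq_bigr => j _; rewrite mxE.
have : integralOver (intr : int -> C) (ratr (\tr A)).
  rewrite -trE; elim/big_ind: _ => [|y z|j _].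
  - exact: (integral0 (intr : {rmorphism int -> C})).
  - exact: integral_add.
  - exact: emb_integral.
by case/int_of_integral => m mE; exists m; rewrite trE mE rmorph_int.
Qed.

Definition disc (w : 'I_n -> K) : C := \det (emb_mx R w) ^+ 2.

(** The discriminant is the determinant of the matrix of the traces of the products
    w i * w j. *)
Lemma disc_int (w : 'I_n -> K) : (forall i, OK (w i)) ->
  exists m : int, disc w = m%:~R.
Proof.
move=> wO.
have /choice[m mE] (ij : 'I_n * 'I_n) :
    exists m : int, \sum_k emb R k (w ij.1 * w ij.2) = m%:~R.
  by apply: trace_int; exact: OK_mul.
exists (\det (\matrix_(i, j) m (i, j))).
rewrite -[RHS]/(intr _) -(det_map_mx (intr : {rmorphism int -> C})).
rewrite /disc expr2 -[X in _ * X]det_tr -det_mulmx; congr (\det _).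
apply/matrixP => i j; rewrite !mxE [RHS](esym (mE (i, j))); apply: eq_bigr => k _.
by rewrite !mxE rmorphM.
Qed.

(** Applied to the exchange of one vector of a basis for a combination, which
    multiplies determinants by the coefficient of the vector that leaves. *)
Lemma det_replace_row (F : comNzRingType) m (i0 : 'I_m) (a : 'I_m -> F) :
  \det (\matrix_(i, j) (if i == i0 then a j else (i == j)%:R)) = a i0.
Proof.
set M := \matrix_(i, j) _.
have cofE j : cofactor M i0 j = (j == i0)%:R.
  have := mul_mx_adj (1%:M : 'M[F]_m); rewrite mul1mx det1.
  move/matrixP/(_ j i0); rewrite !mxE => <-; congr (_ * \det _).
  by apply/matrixP => i k; rewrite !mxE eq_sym (negPf (neq_lift _ _)).
rewrite (expand_det_row _ i0) (bigD1 i0) //= big1 ?addr0 => [|j ji0].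
  by rewrite cofE mxE !eqxx mulr1.
by rewrite cofE (negPf ji0) mulr0.
Qed.

Definition zspan (w : 'I_n -> K) : set K :=
  [set x | exists z : 'I_n -> int, x = \sum_i (z i)%:~R * w i].

Definition subgroup (M : set K) := M 0 /\ forall x y, M x -> M y -> M (x - y).

Lemma subgroupN M x : subgroup M -> M x -> M (- x).
Proof. by move=> [M0 MB] Mx; rewrite -sub0r; exact: MB. Qed.

Lemma subgroupD M x y : subgroup M -> M x -> M y -> M (x + y).
Proof. by move=> sM Mx My; rewrite -[y]opprK; apply: sM.2 => //; exact: subgroupN. Qed.

Lemma subgroup_sum M (I : Type) (r : seq I) (P : pred I) (F : I -> K) :
  subgroup M -> (forall i, P i -> M (F i)) -> M (\sum_(i <- r | P i) F i).
Proof.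
by move=> sM FM; elim/big_ind: _ => //; [exact: sM.1|move=> x y; exact: subgroupD].
Qed.

Lemma subgroup_nat M x (m : nat) : subgroup M -> M x -> M (m%:R * x).
Proof.
move=> sM Mx; elim: m => [|m IH]; first by rewrite mul0r; exact: sM.1.
by rewrite -addn1 natrD mulrDl mul1r; exact: subgroupD.
Qed.

Lemma subgroup_int M x (m : int) : subgroup M -> M x -> M (m%:~R * x).
Proof.
move=> sM Mx; case: m => m; first exact: subgroup_nat.
by rewrite NegzE mulrNz mulNr; apply: subgroupN => //; exact: subgroup_nat.
Qed.

(** Among the Q-bases of K in M, one of least |disc| generates M: otherwise a
    combination with a coordinate outside Z, reduced to lie in ]0, 1[, could
    replace a basis vector and multiply the discriminant by its square. *)
Lemma zbasis_exists (M : set K) (w0 : 'I_n -> K) : M `<=` OK -> subgroup M ->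
  is_qbasis R w0 -> (forall i, M (w0 i)) ->
  exists w, [/\ is_qbasis R w, forall i, M (w i) & M `<=` zspan w].
Proof.
move=> MO sM w0b w0M.
pose Q (k : nat) := `[< exists w, [/\ is_qbasis R w, forall i, M (w i) &
  exists2 m : int, disc w = m%:~R & `|m|%N = k] >].
have exQ : exists k, Q k.
  have [m mE] := disc_int (fun i => MO _ (w0M i)).
  by exists `|m|%N; apply/asboolP; exists w0; split => //; exists m.
case: (ex_minnP exQ) => k /asboolP[w [wb wM [m wm mk]]] mink.
exists w; split => // x Mx; have [q qE] := qbasis_span wb x.
have [qint|/existsNP[i0 qi0]] := pselect (forall i, q i \is a Num.int).
  have /choice[z zE] := fun i => intrP (qint i).
  exists z; rewrite qE; apply: eq_bigr => i _.
  by rewrite zE scaler_int mulrzl.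
pose f := q i0 - (Num.floor (q i0))%:~R.
have f_gt0 : 0 < f.
  rewrite subr_gt0 lt_neqAle floor_le andbT; apply: contra_notN qi0 => /eqP <-.
  exact: intr_int.
have f_lt1 : f < 1.
  by rewrite ltrBlDr addrC -[X in _ + X]/(1%:~R) -intrD floorD1_gt.
pose w' i := if i == i0 then x - (Num.floor (q i0))%:~R * w i0 else w i.
have w'M i : M (w' i).
  rewrite /w'; case: ifP => // _; apply: sM.2 => //; exact: subgroup_int.
pose a j := if j == i0 then f else q j.
pose A := \matrix_(i, j) (if i == i0 then a j else (i == j)%:R) : 'M[rat]_n.
have w'E : emb_mx R w' = map_mx ratr A *m emb_mx R w.
  apply: emb_mx_comb => i; rewrite /w'; case: ifP => i_i0.
    rewrite qE (bigD1 i0) // [in RHS](bigD1 i0) //= !mxE i_i0 /a eqxx.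
    rewrite scalerBl scaler_int mulrzl addrAC; congr (_ + _).
    by apply: eq_bigr => j ji0; rewrite [A i j]mxE i_i0 /a (negPf ji0).
  rewrite (bigD1 i) //= big1 ?addr0 => [|j ji].
    by rewrite mxE i_i0 eqxx scale1r.
  by rewrite mxE i_i0 eq_sym (negPf ji) scale0r.
have detw' : \det (emb_mx R w') = ratr f * \det (emb_mx R w).
  rewrite w'E det_mulmx (det_map_mx (ratr : {rmorphism rat -> C})) /=.
  by rewrite det_replace_row /a eqxx.
have [m' m'E] := disc_int (fun i => MO _ (w'M i)).
have m'm : m'%:~R = f ^+ 2 * m%:~R.
  apply: (fmorph_inj (ratr : {rmorphism rat -> C})).
  rewrite /= rmorphM /= rmorphXn /= !ratr_int -m'E -wm /disc detw'.
  by rewrite exprMn.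
have m_neq0 : m != 0.
  by rewrite -(intr_eq0 C) -wm /disc expf_neq0.
have : (k <= `|m'|)%N.
  apply: mink; apply/asboolP; exists w'; split => //; last by exists m'.
  by rewrite /is_qbasis detw' mulf_neq0 // fmorph_eq0 gt_eqF.
rewrite -mk leqNgt => /negP[].
rewrite -(ltr_nat rat) !natr_absz !intr_norm m'm normrM.
rewrite ger0_norm ?exprn_ge0 ?ltW // gtr_pMl ?normr_gt0 ?intr_eq0 //.
by rewrite exprn_ilt1 // ltW.
Qed.

Lemma zspan_free (w : 'I_n -> K) (z : 'I_n -> int) : is_qbasis R w ->
  \sum_i (z i)%:~R * w i = 0 -> forall i, z i = 0.
Proof.
move=> wb z0 i; have := @qbasis_free R K w (fun i => (z i)%:~R) wb.
have -> : \sum_j (z j)%:~R *: w j = 0.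
  by rewrite -[RHS]z0; apply: eq_bigr => j _; rewrite scaler_int mulrzl.
by move=> /(_ erefl i)/eqP; rewrite intr_eq0 => /eqP.
Qed.

Lemma subgroup_OK : subgroup OK.
Proof. by split; [exact: OK0|exact: OK_sub]. Qed.

Lemma OK_zbasis : exists w, [/\ is_qbasis R w, forall i, OK (w i) & OK `<=` zspan w].
Proof.
pose b i := (vbasis {:K})`_i : K.
have /choice[d dE] (i : 'I_n) : exists d : int, d != 0 /\ OK (d%:~R * b i).
  by have [d] := integral_multiple (b i); exists d.
apply: (@zbasis_exists _ (fun i => (d i)%:~R * b i)) => //.
- exact: subgroup_OK.
- have bE : emb_mx R (fun i => (d i)%:~R * b i) =
            diag_mx (\row_j (d j)%:~R) *m emb_mx R b.
    by rewrite mul_diag_mx; apply/matrixP => i j; rewrite !mxE rmorphM rmorph_int.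
  rewrite /is_qbasis bE det_mulmx mulf_neq0 //; last exact: vbasis_qbasis.
  rewrite det_diag; apply/prodf_neq0 => i _.
  by rewrite mxE intr_eq0 (dE i).1.
- by move=> i; case: (dE i).
Qed.

Lemma ideal_subgroup (a : set K) : is_ideal a -> subgroup a.
Proof.
case=> aO a0 aD aM; split => // x y ax ay; apply: aD => //.
by rewrite -mulN1r; apply: aM => //; rewrite -[-1]/((-1)%:~R); exact: OK_int.
Qed.

(** a contains the multiple x * O of O, hence a Q-basis of K. *)
Lemma ideal_zbasis (a : set K) : nonzero_ideal a ->
  exists w, [/\ is_qbasis R w, forall i, a (w i) & a `<=` zspan w].
Proof.
move=> [ai [x ax x0]]; have [w [wb wO _]] := OK_zbasis.
have [aO _ _ aM] := ai.
apply: (@zbasis_exists a (fun i => x * w i)) => //.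
- exact: ideal_subgroup.
- rewrite /is_qbasis (@emb_mx_mul _ _ _ w x) // det_mulmx mulf_neq0 //.
  by rewrite det_diag; apply/prodf_neq0 => i _; rewrite mxE fmorph_eq0.
- by move=> i; rewrite mulrC; exact: aM.
Qed.

(** Multiplication by such a g has an integral matrix in a Z-basis of a, so g
    is an eigenvalue of that matrix, a root of its characteristic polynomial. *)
Lemma stable_ideal_integral (a : set K) (g : K) : nonzero_ideal a ->
  (forall x, a x -> a (g * x)) -> OK g.
Proof.
move=> an ga; have [w [wb wa spa]] := ideal_zbasis an.
have /choice[z zE] (i : 'I_n) : exists z : 'I_n -> int,
    g * w i = \sum_j (z j)%:~R * w j by apply: spa; exact: ga.
pose A : 'M[int]_n := \matrix_(i, j) z j i.
exists (char_poly A); first exact: char_poly_monic.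
rewrite map_char_poly -eigenvalue_root_char; apply/eigenvalueP.
exists (\row_i w i).
  apply/rowP => i; rewrite !mxE zE; apply: eq_bigr => j _.
  by rewrite !mxE mulrC.
apply/eqP => /rowP w0.
have n_gt0 : (0 < n)%N by rewrite adim_gt0.
have := @qbasis_free R K w (fun _ => 1) wb; rewrite big1 => [/(_ erefl (Ordinal n_gt0))|j _].
  by move/eqP; rewrite oner_eq0.
by have := w0 j; rewrite !mxE => ->; rewrite scaler0.
Qed.

Lemma mul_matrix (w : 'I_n -> K) (x : K) : is_qbasis R w ->
  (forall i, OK (w i)) -> OK `<=` zspan w -> OK x ->
  exists2 A : 'M[int]_n, forall i, x * w i = \sum_j (A i j)%:~R * w j
                       & field_norm x = (\det A)%:~R.
Proof.
move=> wb wO spO xO.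
have /choice[z zE] (i : 'I_n) : exists z : 'I_n -> int,
    x * w i = \sum_j (z j)%:~R * w j by apply: spO; exact: OK_mul.
exists (\matrix_(i, j) z i j).
  by move=> i; rewrite zE; apply: eq_bigr => j _; rewrite mxE.
apply: (fmorph_inj (ratr : {rmorphism rat -> C})); rewrite /= field_normE.
rewrite -[X in ratr X]/(intr _) -(det_map_mx (intr : {rmorphism int -> rat})).
rewrite (@det_mulmx_emb _ _ w x) // => i.
by rewrite zE; apply: eq_bigr => j _; rewrite !mxE scaler_int mulrzl.
Qed.

(** x divides its norm in the ring of integers: the adjugate of the matrix of
    multiplication by x provides the cofactor. *)
Lemma dvd_norm (x : K) : OK x ->
  exists m : int, field_norm x = m%:~R /\ exists2 y, OK y & m%:~R = x * y.
Proof.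
move=> xO; have [w [wb wO spO]] := OK_zbasis.
have [A xE NE] := mul_matrix wb wO spO xO.
exists (\det A); split => //.
have adjE i : (\det A)%:~R * w i = x * \sum_k ((\adj A) i k)%:~R * w k.
  rewrite mulr_sumr.
  under eq_bigr => k _ do rewrite mulrCA xE mulr_sumr.
  rewrite exchange_big /= (bigD1 i) //= [X in _ + X]big1 ?addr0 => [|j ji].
    have /matrixP/(_ i i) := mul_adj_mx A; rewrite !mxE eqxx mulr1n => <-.
    rewrite rmorph_sum /= mulr_suml; apply: eq_bigr => k _.
    by rewrite rmorphM mulrA.
  have /matrixP/(_ i j) := mul_adj_mx A; rewrite !mxE eq_sym (negPf ji) => aij.
  transitivity ((\sum_k (\adj A) i k * A k j)%:~R * w j); last by rewrite aij mul0r.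
  rewrite rmorph_sum /= mulr_suml; apply: eq_bigr => k _.
  by rewrite rmorphM mulrA.
have [z zE] := spO _ (OK1 K).
exists (\sum_i (z i)%:~R * \sum_k ((\adj A) i k)%:~R * w k).
  apply: OK_sum => i _; apply: OK_mul; first exact: OK_int.
  by apply: OK_sum => k _; apply: OK_mul => //; exact: OK_int.
rewrite -[LHS]mulr1 [X in _ * X = _]zE !mulr_sumr; apply: eq_bigr => i _.
by rewrite mulrCA adjE mulrCA.
Qed.

End IntegralBases.

(** * Finite quotients and maximal ideals *)

Section Transversals.
Variables (K : fieldExtType rat).
Local Notation OK := (@ring_of_integers K).

(** Representatives of the quotient of A by B: counting is done with explicit
    transversals, of which T is the finite index type. *)
Definition transversal (A B : set K) (T : finType) (f : T -> K) :=
  [/\ forall t, A (f t), forall x, A x -> exists t, B (x - f t)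
    & forall t u, B (f t - f u) -> t = u].

Lemma transversal_trans (A B C : set K) (T U : finType) (f : T -> K) (g : U -> K) :
  subgroup A -> subgroup B -> B `<=` A -> C `<=` B ->
  transversal A B f -> transversal B C g ->
  transversal A C (fun tu : T * U => f tu.1 + g tu.2).
Proof.
move=> sA sB BA CB [Af covf injf] [Bg covg injg]; split=> [[t u]|x Ax|[t u] [t' u'] /= Cd].
- by apply: subgroupD => //; exact/BA.
- have [t Bt] := covf x Ax; have [u Cu] := covg _ Bt.
  by exists (t, u); rewrite opprD addrA.
- have tt' : t = t'.
    apply: injf; have -> : f t - f t' = (f t + g u - (f t' + g u')) - (g u - g u').
      by rewrite opprD opprB addrACA addrA addrC !addrA; ring.
    by apply: sB.2; [exact: CB|exact: sB.2].
  congr (_, _) => //; apply: injg; move: Cd; rewrite tt'.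
  by congr C; ring.
Qed.

Lemma transversal_leq (A B : set K) (T U : finType) (f : T -> K) (g : U -> K) :
  subgroup B -> (forall t, A (f t)) -> (forall t u, B (f t - f u) -> t = u) ->
  (forall x, A x -> exists u, B (x - g u)) -> (#|T| <= #|U|)%N.
Proof.
move=> sB Af injf covg; have /choice[h hP] := fun t => covg _ (Af t).
rewrite -(card_in_imset (f := h) (D := predT)); first exact: max_card.
move=> t u _ _ htu; apply: injf.
have -> : f t - f u = (f t - g (h t)) - (f u - g (h u)) by rewrite htu; ring.
exact: sB.2.
Qed.

Lemma transversal_card (A B : set K) (T U : finType) (f : T -> K) (g : U -> K) :
  subgroup B -> transversal A B f -> transversal A B g -> #|T| = #|U|.
Proof.
move=> sB [Af covf injf] [Ag covg injg]; apply/eqP; rewrite eqn_leq.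
by rewrite (transversal_leq sB Af injf covg) (transversal_leq sB Ag injg covf).
Qed.

Lemma transversal_exists (A B : set K) (U : finType) (g : U -> K) :
  subgroup B -> (forall u, A (g u)) ->
  (forall x, A x -> exists u, B (x - g u)) ->
  exists k (f : 'I_k -> K), transversal A B f.
Proof.
move=> sB Ag covg.
(* rep u depends only on the class of u *)
pose rep u := odflt u [pick v | `[< B (g u - g v) >]].
have repP u : B (g u - g (rep u)).
  rewrite /rep; case: pickP => [v /asboolP//|]; rewrite /= subrr => _; exact: sB.1.
have rep_eq u v : B (g u - g v) -> rep u = rep v.
  move=> Buv; rewrite /rep.
  have e w : `[< B (g u - g w) >] = `[< B (g v - g w) >].
    apply/asboolP/asboolP => Bw.
      have -> : g v - g w = (g u - g w) - (g u - g v) by ring.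
      exact: sB.2.
    have -> : g u - g w = (g v - g w) + (g u - g v) by ring.
    exact: subgroupD.
  rewrite (eq_pick e); case: pickP => // /(_ v).
  by rewrite subrr => /asboolP []; exact: sB.1.
pose D := [set u | rep u == u]%SET.
exists #|D|, (fun i => g (enum_val i)); split=> [i|x Ax|i j Bij]; first exact: Ag.
- have [u Bu] := covg x Ax.
  have Du : rep u \in D.
    by rewrite inE eq_sym; apply/eqP/rep_eq.
  exists (enum_rank_in Du (rep u)); rewrite enum_rankK_in //.
  have -> : x - g (rep u) = (x - g u) + (g u - g (rep u)) by ring.
  exact: subgroupD.
- apply: enum_val_inj.
  have := enum_valP i; have := enum_valP j; rewrite !inE => /eqP <- /eqP <-.
  exact: rep_eq.
Qed.

Lemma ideal_norm_transversal (a : set K) (T : finType) (f : T -> K) :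
  subgroup a -> transversal OK a f -> ideal_norm a = #|T|.
Proof.
move=> sa [Of covf injf].
pose coset x : set K := [set x + y | y in a].
have cosetP x y : a (x - y) -> coset x = coset y.
  move=> axy; apply/seteqP; split=> _ [z az <-].
    by exists (x - y + z); [exact: subgroupD|ring].
  by exists (z - (x - y)); [exact: sa.2|ring].
have -> : ideal_norm a = #|` [fset coset (f t) | t : T]%fset |.
  rewrite /ideal_norm -[in RHS](set_fsetK [fset _ | _ : T]%fset).
  congr #|` fset_set _|; apply/seteqP; split=> [_ [x Ox <-]|_ /= /imfsetP[t _ ->]].
    have [t at_] := covf x Ox; apply/imfsetP; exists t => //=.
    exact: cosetP.
  by exists (f t).
rewrite card_imfset /=; first by rewrite -cardE.
move=> t u tu; apply: injf.
have : coset (f t) (f t) by exists 0; rewrite ?addr0 //; exact: sa.1.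
by rewrite tu => -[y ay <-]; rewrite addrAC subrr add0r.
Qed.

End Transversals.

Section Ideals.
Variables (R : realType) (K : fieldExtType rat).
Notation n := (\dim {:K}).
Local Notation OK := (@ring_of_integers K).

Definition principal (x : K) : set K := [set x * y | y in OK].

Lemma principal_ideal x : OK x -> is_ideal (principal x).
Proof.
move=> xO; split=> [_ [y yO <-]||_ _ [y yO <-] [z zO <-]|c _ cO [y yO <-]].
- exact: OK_mul.
- by exists 0; rewrite ?mulr0 //; exact: OK0.
- by exists (y + z); rewrite ?mulrDr //; exact: OK_add.
- by exists (c * y); [exact: OK_mul|rewrite mulrCA].
Qed.

Lemma mem_principal x : principal x x.
Proof. by exists 1; rewrite ?mulr1 //; exact: OK1. Qed.

Lemma principal_sub (a : set K) x : is_ideal a -> a x -> principal x `<=` a.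
Proof. by move=> [_ _ _ aM] ax _ [y yO <-]; rewrite mulrC; exact: aM. Qed.

Lemma nonzero_principal x : OK x -> x != 0 -> nonzero_ideal (principal x).
Proof.
by move=> xO x0; split; [exact: principal_ideal|exists x => //; exact: mem_principal].
Qed.

(** The norm of a nonzero element of a is a multiple of that element. *)
Lemma ideal_nat (a : set K) : nonzero_ideal a -> exists2 m, (0 < m)%N & a m%:R.
Proof.
move=> [ai [x ax x0]]; have [aO _ _ _] := ai.
have [m [Nm [y yO mE]]] := dvd_norm R (aO _ ax).
exists `|m|%N.
  rewrite lt0n absz_eq0 -(intr_eq0 rat) -Nm.
  by rewrite (field_norm_eq0 R).
have am : a m%:~R by rewrite mE; apply: principal_sub ax _ _ => //; exists y.
case: (intP m) am => // k; rewrite ?abszN //= => am.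
rewrite -[_%:R]opprK; apply: subgroupN; first exact: ideal_subgroup.
by move: am; rewrite mulrNz.
Qed.

(** If a contains the integer m > 0, the combinations of a Z-basis with coefficients
    below m represent all classes modulo a. *)
Lemma ideal_transversal (a : set K) : nonzero_ideal a ->
  exists k (f : 'I_k -> K), transversal OK a f.
Proof.
move=> an; have [m m0 am] := ideal_nat an; have [ai _] := an.
have [w [_ wO spO]] := OK_zbasis R K.
case: m m0 am => // m _ am.
apply: (@transversal_exists _ _ _ {ffun 'I_n -> 'I_m.+1}
  (fun z => \sum_i (z i)%:R * w i)); first exact: ideal_subgroup.
  move=> z; apply: OK_sum => i _; apply: OK_mul => //; exact: OK_nat.
move=> x /spO[c ->].
exists [ffun i => inord `|(c i %% m.+1)%Z|%N].
rewrite -sumrB; apply: subgroup_sum; first exact: ideal_subgroup.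
move=> i _; rewrite ffunE inordK; last first.
  by rewrite -ltz_nat gez0_abs ?modz_ge0 // ltz_pmod.
rewrite -mulrBl -[X in _ - X]/((_%:Z)%:~R) gez0_abs ?modz_ge0 //.
rewrite {1}(divz_eq (c i) m.+1) intrD addrK intrM [_ * (m.+1)%:~R]mulrC -mulrA.
have [_ _ _ aM] := ai; rewrite mulrC; apply: aM => //.
by apply: OK_mul => //; exact: OK_int.
Qed.

Lemma ideal_norm_gt0 (a : set K) : nonzero_ideal a -> (0 < ideal_norm a)%N.
Proof.
move=> an; have [k [f ft]] := ideal_transversal an.
rewrite (ideal_norm_transversal (ideal_subgroup an.1) ft).
by have [_ cov _] := ft; have [t _] := cov 0 (OK0 K); apply/card_gt0P; exists t.
Qed.

(** The ideals containing a fixed nonzero integer correspond to subsets of a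
    finite quotient, so any family of them has a maximal element. *)
Lemma ideal_maximal_element (x : K) (Q : set K -> Prop) : OK x -> x != 0 ->
  (exists J, Q J) -> (forall J, Q J -> is_ideal J /\ J x) ->
  exists2 J, Q J & forall J', Q J' -> J `<=` J' -> J' `<=` J.
Proof.
move=> xO x0 [J0 QJ0] QP.
have [k [f [fO covf injf]]] := ideal_transversal (nonzero_principal xO x0).
pose mu (J : set K) := #|[set t | `[< J (f t) >]]%SET|.
pose P m := `[< exists2 J, Q J & mu J = m >].
have exP : exists m, P m by exists (mu J0); apply/asboolP; exists J0.
have ubP m : P m -> (m <= k)%N.
  by move=> /asboolP[J _ <-]; rewrite -[X in (_ <= X)%N]card_ord max_card.
case: (ex_maxnP exP ubP) => m /asboolP[J QJ muJ] maxm.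
exists J => // J' QJ' JJ' y J'y.
have [Ji Jx] := QP _ QJ; have [J'i J'x] := QP _ QJ'.
have [J'O _ _ _] := J'i.
have [t xt] := covf y (J'O _ J'y).
have Jt : J (y - f t) by apply: principal_sub xt.
have : t \in [set t | `[< J' (f t) >]]%SET.
  rewrite inE; apply/asboolP; have -> : f t = y - (y - f t) by ring.
  by apply: (ideal_subgroup J'i).2 => //; exact: JJ'.
suff <- : [set t | `[< J (f t) >]]%SET = [set t | `[< J' (f t) >]]%SET.
  rewrite inE => /asboolP Jft; have -> : y = (y - f t) + f t by ring.
  exact: subgroupD (ideal_subgroup Ji) _ _.
apply/eqP; rewrite eqEcard; apply/andP; split.
  apply/fintype.subsetP => u; rewrite !inE; exact: JJ'.
by rewrite -/(mu J) -/(mu J') muJ; apply: maxm; apply/asboolP; exists J'.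
Qed.

(** Maximality of p is stated as the invertibility of the nonzero residues. *)
Definition max_ideal (p : set K) :=
  [/\ nonzero_ideal p, ~ p 1
    & forall x, OK x -> ~ p x -> exists2 y, OK y & p (1 - x * y)].

Lemma max_idealM p x y : max_ideal p -> OK x -> OK y -> p (x * y) -> p x \/ p y.
Proof.
move=> [[pi _] p1 pinv] xO yO pxy; have [px|/(pinv _ xO)[x' x'O pxx']] := pselect (p x).
  by left.
right; have [_ _ pD pM] := pi.
have -> : y = y * (1 - x * x') + x' * (x * y) by ring.
by apply: pD; apply: pM.
Qed.

Lemma max_ideal_prod p (I : Type) (r : seq I) (P : pred I) (F : I -> K) :
  max_ideal p -> (forall i, P i -> OK (F i)) -> (forall i, P i -> ~ p (F i)) ->
  ~ p (\prod_(i <- r | P i) F i).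
Proof.
move=> pm FO pF.
suff [] : OK (\prod_(i <- r | P i) F i) /\ ~ p (\prod_(i <- r | P i) F i) by [].
elim/big_ind: _ => [|x y [xO px] [yO py]|i Pi].
- by split; [exact: OK1|case: pm].
- by split; [exact: OK_mul|move=> /(max_idealM pm xO yO)[]].
- by split; [exact: FO|exact: pF].
Qed.

Lemma max_idealX p x k : max_ideal p -> OK x -> ~ p x -> ~ p (x ^+ k).
Proof.
by move=> pm xO px; rewrite -[k]card_ord -prodr_const; apply: max_ideal_prod.
Qed.

(** An ideal that is maximal among those that contain a and not 1. If an x outside p
    had no inverse modulo p, the ideal generated by p and x would be larger. *)
Lemma max_ideal_exists (a : set K) : nonzero_ideal a -> ~ a 1 ->
  exists2 p, max_ideal p & a `<=` p.
Proof.
move=> [ai [x ax x0]] a1; have [aO _ _ _] := ai.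
have [|//|p [pi ap p1] pmax] := @ideal_maximal_element x
  (fun J => [/\ is_ideal J, a `<=` J & ~ J 1]) (aO _ ax) x0.
- by exists a; split.
- by move=> J [Ji aJ _]; split => //; exact: aJ.
have [pO p0 pD pM] := pi.
exists p => //; split => // [|y yO py]; first by split => //; exists x => //; exact: ap.
pose J : set K := [set u + y * v | u in p & v in OK].
apply: contrapT => noinv; apply: py.
have pJ : p `<=` J.
  by move=> u pu; exists u => //; exists 0; rewrite ?mulr0 ?addr0 //; exact: OK0.
apply: (pmax J) => //; last first.
  by exists 0 => //; exists 1; rewrite ?mulr1 ?add0r //; exact: OK1.
split; last first.
- move=> [u pu [v vO uv]]; apply: noinv; exists v => //.
  by rewrite -uv addrK.
- exact: subset_trans pJ.
split.
- move=> _ [u pu [v vO <-]]; apply: OK_add; [exact: pO|exact: OK_mul].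
- exact: pJ.
- move=> _ _ [u pu [v vO <-]] [u' pu' [v' v'O <-]].
  exists (u + u'); first exact: pD.
  by exists (v + v'); [exact: OK_add|ring].
- move=> c _ cO [u pu [v vO <-]]; exists (c * u); first exact: pM.
  by exists (c * v); [exact: OK_mul|ring].
Qed.

Lemma powers_pigeonhole (a : set K) (x : K) : nonzero_ideal a -> OK x ->
  exists i j, (i < j)%N /\ a (x ^+ i - x ^+ j).
Proof.
move=> an xO; have [k [f [fO covf injf]]] := ideal_transversal an.
have sa : subgroup a by apply: ideal_subgroup; case: an.
have /choice[h hP] := fun i => covf _ (OK_exp i xO).
have : ~ injective (fun i : 'I_k.+1 => h i).
  by move=> /leq_card; rewrite !card_ord ltnn.
move=> /existsNP[i /existsNP[j /not_implyP[hij ij]]].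
wlog ltij : i j hij ij / (i < j)%N.
  move=> H; have [ltij|ltji|/val_inj//] := ltngtP i j; first exact: (H i j).
  by apply: (H j i) => //; exact: nesym.
exists i, j; split => //.
have -> : x ^+ i - x ^+ j = (x ^+ i - f (h i)) - (x ^+ j - f (h j)).
  by rewrite hij; move: (x ^+ i) (x ^+ j) => y z; ring.
by apply: sa.2; exact: hP.
Qed.

(** The powers of x repeat modulo p: x ^+ i * (1 - x ^+ (j - i)) is in p for some
    i < j, and x ^+ i is not, so x ^+ (j - i.+1) is an inverse of x modulo p. *)
Lemma prime_is_max (p : set K) : nonzero_ideal p -> ~ p 1 ->
  (forall x y, OK x -> OK y -> p (x * y) -> p x \/ p y) -> max_ideal p.
Proof.
move=> pn p1 pprime; split => // x xO px.
have [i [j [ij pij]]] := powers_pigeonhole pn xO.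
exists (x ^+ (j - i.+1)); first exact: OK_exp.
have xi : ~ p (x ^+ i).
  elim: i {ij pij} => [|i IH]; first by rewrite expr0.
  by rewrite exprS => /pprime[]//; exact: OK_exp.
have : p (x ^+ i * (1 - x * x ^+ (j - i.+1))).
  by rewrite mulrBr mulr1 -exprS -exprD subnSK // subnKC // ltnW.
case/pprime => //; first exact: OK_exp.
by apply: OK_sub; [exact: OK1|apply: OK_mul => //; exact: OK_exp].
Qed.

(** In O/(x), localised at p, some nonzero element b is killed by p: one whose
    annihilator is maximal among those contained in p. An s in p outside
    Ann b would satisfy Ann (s b) = Ann b, so no power of s would kill b, while
    the powers of s repeat modulo x. Then g = b/x is such that g p lies in O,
    and p is not stable under g as g is not integral. *)
Lemma uniformizer_exists (p : set K) : max_ideal p ->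
  exists g u, [/\ ~ OK g, forall y, p y -> OK (g * y), p u & ~ p (g * u)].
Proof.
move=> pm; have [[pi [x px x0]] p1 _] := pm; have [pO p0 pD pM] := pi.
have xO := pO _ px.
pose Ann b : set K := [set s | OK s /\ principal x (s * b)].
have sx := ideal_subgroup (principal_ideal xO).
have Ann_ideal b : OK b -> is_ideal (Ann b).
  move=> bO; split=> [s []//||s t [sO xs] [tO xt]|c s cO [sO xs]].
  - by split; rewrite ?mul0r; [exact: OK0|exact: sx.1].
  - by split; [exact: OK_add|rewrite mulrDl; exact: subgroupD].
  - split; [exact: OK_mul|rewrite -mulrA].
    by have [_ _ _] := principal_ideal xO; apply.
have Annx b : OK b -> Ann b x by move=> bO; split => //; exists b.
have [|J [b [bO bp ->]]|_ [b [bO bp ->]] bmax] := @ideal_maximal_element x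
  (fun J => exists b, [/\ OK b, Ann b `<=` p & J = Ann b]) xO x0.
- exists (Ann 1), 1; split => //; first exact: OK1.
  move=> s [_ [y yO]]; rewrite mulr1 => <-; rewrite mulrC; exact: pM.
- by split; [exact: Ann_ideal|exact: Annx].
have AnnE s : p s -> Ann b s.
  move=> ps; apply: contrapT => Abs; have sO := pO _ ps.
  have Asub t c : OK c -> Ann t `<=` Ann (c * t).
    move=> cO r [rO xr]; split => //; rewrite mulrCA.
    by have [_ _ _] := principal_ideal xO; apply.
  have Asb : Ann (s * b) `<=` Ann b.
    apply: (bmax); last exact: Asub.
    exists (s * b); split => //; first exact: OK_mul.
    move=> t [tO xt]; apply: contrapT => pt; apply: Abs.
    apply: (bmax (Ann (t * b))); last first.
    - by split => //; move: xt; rewrite !mulrA (mulrC s).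
    - exact: Asub.
    exists (t * b); split => //; first exact: OK_mul.
    move=> r [rO xr]; have : p (r * t).
      by apply: bp; split; [exact: OK_mul|rewrite -mulrA].
    by case/(max_idealM pm rO tO).
  have Apow k : Ann (s ^+ k * b) `<=` Ann b.
    elim: k => [|k IH]; first by rewrite expr0 mul1r.
    move=> t [tO xt]; apply: Asb; split => //.
    have [] : Ann b (t * s); last by rewrite -mulrA.
    apply: IH; split; first exact: OK_mul.
    by move: xt; rewrite exprS !mulrA.
  have [i [j [ij xij]]] := powers_pigeonhole (nonzero_principal xO x0) sO.
  have : Ann (s ^+ i * b) (1 - s ^+ (j - i)).
    split; first by apply: OK_sub; [exact: OK1|exact: OK_exp].
    have -> : (1 - s ^+ (j - i)) * (s ^+ i * b) = b * (s ^+ i - s ^+ j).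
      rewrite -[in RHS](subnKC (ltnW ij)) exprD.
      by move: (s ^+ i) (s ^+ (j - i)) => y z; ring.
    by have [_ _ _] := principal_ideal xO; apply.
  move=> /Apow/bp p1s; apply: p1.
  rewrite -(subrK (s ^+ (j - i)) 1); apply: pD => //.
  have -> : (j - i)%N = (j - i).-1.+1 by rewrite prednK // subn_gt0.
  by rewrite exprSr; apply: pM => //; exact: OK_exp.
have gp y : p y -> OK (b / x * y).
  move=> /AnnE[yO [z zO zE]]; rewrite mulrAC mulrC -(mulrC y) -zE.
  by rewrite mulrA mulVf // mul1r.
have gO : ~ OK (b / x).
  move=> gO; apply: p1; apply: bp; split; first exact: OK1.
  by rewrite mul1r; exists (b / x) => //; rewrite mulrC divfK.
have : ~ forall y, p y -> p (b / x * y).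
  move=> st; apply: gO; apply: (@stable_ideal_integral R K p) => //.
  by case: pm.
move=> /existsNP[u /not_implyP[pu pgu]].
by exists (b / x), u.
Qed.

End Ideals.

(** * Absolute values *)

(** The factor i + 1 leaves room for the binomial theorem; a geometric sequence
    of ratio greater than 1 outgrows it. *)
Lemma le_of_powers (R : realType) (C a b : R) : 0 <= a -> 0 <= b ->
  (forall i : nat, a ^+ i <= C * i.+1%:R * b ^+ i) -> a <= b.
Proof.
move=> a0 b0 H; rewrite leNgt; apply/negP => ba.
have a_gt0 : 0 < a by exact: le_lt_trans ba.
have [b_gt0|] := ltP 0 b; last first.
  move=> bN; have b_eq0 : b = 0 by apply/eqP; rewrite eq_le bN b0.
  by have := H 1%N; rewrite b_eq0 !expr1 mulr0 leNgt a_gt0.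
have [h hE h_gt0] : exists2 h, 1 + h = a / b & 0 < h.
  exists (a / b - 1); first by rewrite addrC subrK.
  by rewrite subr_gt0 ltr_pdivlMr // mul1r.
have Hr i : (1 + h) ^+ i <= C * i.+1%:R.
  by rewrite hE expr_div_n ler_pdivrMr ?exprn_gt0.
have C_gt0 : 0 < C.
  by have := Hr 0%N; rewrite expr0 mulr1; exact: lt_le_trans.
have bern i : 1 + i%:R * h <= (1 + h) ^+ i.
  elim: i => [|i IH]; first by rewrite mul0r addr0 expr0.
  rewrite exprS -addn1 natrD; have : 0 <= i%:R * h ^+ 2 by rewrite mulr_ge0 ?sqr_ge0.
  by move: IH h_gt0; move: ((1 + h) ^+ i) => E; nra.
pose N := (Num.truncn (3 * C / h ^+ 2)).+1.
have N_gt : 3 * C / h ^+ 2 < N%:R by exact: truncnS_gt.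
have N1 : 1 <= N%:R :> R by rewrite ler1n.
have := Hr (N * 2)%N; rewrite exprM.
have sq : (N%:R * h) ^+ 2 <= ((1 + h) ^+ N) ^+ 2.
  apply: lerXn2r; rewrite ?nnegrE.
  - by rewrite mulr_ge0 // ltW.
  - by rewrite exprn_ge0 // addr_ge0 // ltW.
  - by apply: (le_trans _ (bern N)); rewrite lerDr.
move/(le_trans sq); rewrite leNgt => /negP; apply.
rewrite ltr_pdivrMr ?exprn_gt0 // in N_gt.
rewrite -addn1 natrD natrM.
have : 3 * C * N%:R < N%:R * h ^+ 2 * N%:R by rewrite ltr_pM2r // (lt_le_trans ltr01).
by clear sq; move: N1 C_gt0; move: (N%:R : R) => M; nra.
Qed.

Section AbsoluteValue.
Variables (R : realType) (K : fieldExtType rat) (v : K -> R).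
Hypothesis vabs : absolute_value v.

Lemma abs_ge0 x : 0 <= v x. Proof. by case: vabs. Qed.

Lemma abs_eq0 x : (v x == 0) = (x == 0).
Proof. by have [_ v0 _ _] := vabs; apply/eqP/eqP => /v0. Qed.

Lemma abs0 : v 0 = 0. Proof. by apply/eqP; rewrite abs_eq0. Qed.

Lemma abs_gt0 x : (0 < v x) = (x != 0).
Proof. by rewrite lt_neqAle abs_ge0 andbT eq_sym abs_eq0. Qed.

Lemma absM x y : v (x * y) = v x * v y. Proof. by case: vabs. Qed.

Lemma le_absD x y : v (x + y) <= v x + v y. Proof. by case: vabs. Qed.

Lemma abs1 : v 1 = 1.
Proof.
apply: (@mulIf _ (v 1)); first by rewrite abs_eq0 oner_eq0.
by rewrite -absM mulr1 mul1r.
Qed.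

Lemma absX x i : v (x ^+ i) = v x ^+ i.
Proof. by elim: i => [|i IH]; rewrite ?expr0 ?abs1 // !exprS absM IH. Qed.

Lemma absN x : v (- x) = v x.
Proof.
rewrite -mulN1r absM; suff -> : v (-1) = 1 by rewrite mul1r.
apply/eqP; rewrite -(@eqrXn2 _ 2) ?abs_ge0 // -absX expr1n sqrrN expr1n.
by rewrite abs1.
Qed.

Lemma absV x : v x^-1 = (v x)^-1.
Proof.
have [->|x0] := eqVneq x 0; first by rewrite invr0 abs0 invr0.
apply: (@mulIf _ (v x)); first by rewrite abs_eq0.
by rewrite -absM !mulVf ?abs1 // abs_eq0.
Qed.

Lemma absXz x (k : int) : v (x ^ k) = v x ^ k.
Proof. by case: k => k; rewrite ?NegzE -?exprnN ?absV absX. Qed.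

Lemma le_abs_sum (I : Type) (r : seq I) (P : pred I) (F : I -> K) :
  v (\sum_(i <- r | P i) F i) <= \sum_(i <- r | P i) v (F i).
Proof.
elim/big_ind2: _ => [|x a y b xa yb|//]; first by rewrite abs0.
exact: le_trans (le_absD _ _) (lerD xa yb).
Qed.

Lemma abs_prod (I : Type) (r : seq I) (P : pred I) (F : I -> K) :
  v (\prod_(i <- r | P i) F i) = \prod_(i <- r | P i) v (F i).
Proof. by elim/big_ind2: _ => [|x a y b <- <-|//]; rewrite ?abs1 ?absM. Qed.

End AbsoluteValue.

(** * The finite places *)

Section FinitePlace.
Variables (R : realType) (K : fieldExtType rat) (v : K -> R).
Local Notation OK := (@ring_of_integers K).
Hypotheses (vabs : absolute_value v) (vp : extends_padic v).

Lemma padic_abs_int_le1 p (z : int) : prime p -> padic_abs R p z%:~R <= 1.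
Proof.
move=> pp; rewrite /padic_abs intr_eq0; case: eqP => // _.
rewrite denq_int numq_int logn1 expr0 div1r invf_le1 ?exprn_ege1 //.
- by rewrite ler1n prime_gt0.
- by rewrite exprn_gt0 // ltr0n prime_gt0.
Qed.

Lemma fin_int_le1 (z : int) : v z%:~R <= 1.
Proof.
have [p pp vE] := vp.
have := vE z%:~R; rewrite -[_%:A]/(GRing.in_alg K _) rmorph_int => ->.
exact: padic_abs_int_le1.
Qed.

Lemma fin_nat_le1 (m : nat) : v m%:R <= 1. Proof. exact: (fin_int_le1 m). Qed.

(** In the binomial expansion of (x + y) ^+ i each of the i + 1 terms has absolute
    value at most Num.max (v x) (v y) ^+ i. *)
Lemma ultrametric x y : v (x + y) <= Num.max (v x) (v y).
Proof.
have m0 : 0 <= Num.max (v x) (v y) by rewrite le_max abs_ge0.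
apply: (@le_of_powers _ 1) => // [|i]; first exact: abs_ge0.
rewrite -absX // exprDn (le_trans (le_abs_sum vabs _ _ _)) // mul1r.
rewrite mulr_natl -[in X in _ <= X](card_ord i.+1) -sumr_const.
apply: ler_sum => j _; rewrite -mulr_natl absM // absM // !absX //.
have le1 : v ('C(i, j)%:R) <= 1 by exact: fin_nat_le1.
have le2 : v x ^+ (i - j) * v y ^+ j <= Num.max (v x) (v y) ^+ i.
  have ji : (j <= i)%N by rewrite -ltnS.
  rewrite -[in X in _ <= X](subnK ji) exprD.
  apply: ler_pM; rewrite ?exprn_ge0 ?abs_ge0 //.
    by apply: lerXn2r; rewrite ?nnegrE ?abs_ge0 // le_max lexx.
  by apply: lerXn2r; rewrite ?nnegrE ?abs_ge0 // le_max lexx orbT.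
rewrite -[X in _ <= X]mul1r; apply: ler_pM => //; first exact: abs_ge0.
by rewrite mulr_ge0 // exprn_ge0 // abs_ge0.
Qed.

Lemma ultrametric_le x y r : v x <= r -> v y <= r -> v (x + y) <= r.
Proof. by move=> xr yr; apply: le_trans (ultrametric x y) _; rewrite ge_max xr. Qed.

Lemma ultrametric_leB x y r : v x <= r -> v y <= r -> v (x - y) <= r.
Proof. by move=> xr yr; apply: ultrametric_le => //; rewrite absN. Qed.

Lemma ultrametric_ltB x y r : v x < r -> v y < r -> v (x - y) < r.
Proof.
move=> xr yr; apply: le_lt_trans (ultrametric x (- y)) _.
by rewrite gt_max xr absN.
Qed.

Lemma ultrametric_lt x y r : v x < r -> v y < r -> v (x + y) < r.
Proof.
by move=> xr yr; apply: le_lt_trans (ultrametric x y) _; rewrite gt_max xr.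
Qed.

Lemma ultrametric_sum (I : Type) (s : seq I) (P : pred I) (F : I -> K) r :
  0 <= r -> (forall i, P i -> v (F i) <= r) -> v (\sum_(i <- s | P i) F i) <= r.
Proof.
move=> r0 Fr; elim/big_ind: _ => [|x y|//]; first by rewrite abs0.
exact: ultrametric_le.
Qed.

(** The powers of an integral x are integral combinations of a Z-basis, so
    they are bounded. *)
Lemma fin_OK_le1 x : OK x -> v x <= 1.
Proof.
move=> xO; have [w [_ wO spO]] := OK_zbasis R K.
apply: (@le_of_powers _ (\sum_i v (w i))) => [||i]; rewrite ?abs_ge0 //.
rewrite expr1n mulr1 -absX //; have [z ->] := spO _ (OK_exp i xO).
apply: le_trans (le_abs_sum vabs _ _ _) _.
apply: (@le_trans _ _ (\sum_i v (w i))); last first.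
  by rewrite ler_peMr ?ler1n ?sumr_ge0 // => j _; exact: abs_ge0.
apply: ler_sum => j _; rewrite absM // ler_piMl ?abs_ge0 //.
exact: fin_int_le1.
Qed.

Definition place_ideal : set K := [set x | OK x /\ v x < 1].

Lemma fin_prime : exists2 p, prime p & v p%:R = p%:R^-1.
Proof.
have [p pp vE] := vp; exists p => //.
have := vE p%:R; rewrite -[_%:A]/(GRing.in_alg K _) rmorph_nat => ->.
rewrite /padic_abs -[p%:R]/(p%:~R) intr_eq0 denq_int numq_int absz_nat logn1.
by rewrite logn_prime // eqxx expr0 expr1 div1r -[_ == 0]/(p == 0%N) gtn_eqF ?prime_gt0.
Qed.

Lemma place_ideal_nat : exists2 p, prime p & place_ideal p%:R.
Proof.
have [p pp vE] := fin_prime; exists p => //; split; first exact: OK_nat.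
by rewrite vE invf_lt1 ?ltr1n ?ltr0n ?prime_gt0 ?prime_gt1.
Qed.

(** The ideal is prime, as a product of elements of absolute value 1 has absolute
    value 1. *)
Lemma place_ideal_max : max_ideal place_ideal.
Proof.
apply: (prime_is_max R); last first.
- move=> x y xO yO [_]; rewrite absM // => xy.
  have [x1|x1] := ltP (v x) 1; first by left.
  have [y1|y1] := ltP (v y) 1; first by right.
  by move: xy; rewrite ltNge mulr_ege1.
- by case; rewrite abs1 ?ltxx.
split; last first.
  have [p pp pI] := place_ideal_nat; exists p%:R => //.
  by rewrite natK_eq0 gtn_eqF ?prime_gt0.
split=> [x []//||x y [xO x1] [yO y1]|c x cO [xO x1]].
- by split; [exact: OK0|rewrite abs0].
- by split; [exact: OK_add|exact: ultrametric_lt].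
- split; [exact: OK_mul|rewrite absM //].
  by rewrite (le_lt_trans _ x1) // ler_piMl ?abs_ge0 ?fin_OK_le1.
Qed.

Lemma notin_place_ideal x : OK x -> ~ place_ideal x <-> v x = 1.
Proof.
move=> xO; split=> [xI|x1 [_]]; last by rewrite x1 ltxx.
apply/eqP; rewrite eq_le fin_OK_le1 //= leNgt; apply/negP => x1.
by apply: xI.
Qed.

End FinitePlace.

Section LocalStructure.
Variables (R : realType) (K : fieldExtType rat) (p : set K).
Local Notation OK := (@ring_of_integers K).
Hypothesis pm : max_ideal p.

(** The inverse of a local parameter at p, and an element of p that it maps to
    a unit at p. *)
Definition is_param (g u : K) :=
  [/\ ~ OK g, forall y, p y -> OK (g * y), p u & ~ p (g * u)].

Variables (g u : K).
Hypothesis gu : is_param g u.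

Let pO x : p x -> OK x. Proof. by have [[[sub _ _ _] _] _ _] := pm; exact: sub. Qed.

Let pM c x : OK c -> p x -> p (c * x).
Proof. by have [[[_ _ _ H] _] _ _] := pm; exact: H. Qed.

Lemma param_neq0 : g != 0.
Proof. by have [gO _ _ _] := gu; apply: contra_notN gO => /eqP->; exact: OK0. Qed.

Let gu_OK : OK (g * u). Proof. by have [_ H pu _] := gu; exact: H. Qed.

(** Multiplication by g removes a factor of p, until an integral element outside p is
    reached. This ends: the z all of whose products by powers of g are integral form
    an ideal stable under g, which is zero because g is not integral. *)
Lemma local_decomp_OK x : OK x -> x != 0 ->
  exists k : nat, exists2 s, OK s /\ ~ p s & x = g ^- k * s.
Proof.
move=> xO x0; have [gO gp _ _] := gu.
have exk : exists k, `[< ~ OK (g ^+ k * x) >].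
  apply: contrapT => /forallNP noex; apply: gO.
  pose J : set K := [set z | forall k, OK (g ^+ k * z)].
  apply: (@stable_ideal_integral R K J); last first.
    by move=> z Jz k; rewrite mulrA -exprSr; exact: Jz.
  split; last first.
    by exists x => // k; apply: contrapT => NO; apply: (noex k); apply/asboolP.
  split=> [z /(_ 0%N)||y z Jy Jz k|c z cO Jz k].
  - by rewrite expr0 mul1r.
  - by move=> k; rewrite mulr0; exact: OK0.
  - by rewrite mulrDr; exact: OK_add.
  - by rewrite mulrCA; exact: OK_mul.
case: (ex_minnP exk) => -[|k] /asboolP NO mink; first by rewrite expr0 mul1r in NO.
exists k, (g ^+ k * x); last by rewrite mulrA mulVf ?mul1r ?expf_neq0 ?param_neq0.
split; first by apply: contrapT => NOk; have := mink k (asboolT NOk); rewrite ltnn.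
by move=> /gp; rewrite mulrA -exprS.
Qed.

Lemma local_decomp x : x != 0 -> exists k : int, exists s t,
  [/\ OK s, OK t, ~ p s, ~ p t & x = g ^ k * (s / t)].
Proof.
move=> x0; have [d d0 dxO] := integral_multiple x.
have d0' : d%:~R != 0 :> K by rewrite intK_eq0.
have [k [s [sO ps] sE]] := local_decomp_OK dxO (mulf_neq0 d0' x0).
have [l [t [tO pt] tE]] := local_decomp_OK (OK_int K d) d0'.
exists (l%:Z - k%:Z), s, t; split => //.
have t0 : t != 0 by apply: contra_notN pt => /eqP ->; have [[[_ ]]] := pm.
apply: (mulfI d0'); rewrite sE expfzDr ?param_neq0 //.
rewrite -exprnN tE -exprnP.
have gk : g ^+ k != 0 by rewrite expf_neq0 ?param_neq0.
have gl : g ^+ l != 0 by rewrite expf_neq0 ?param_neq0.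
by move: (g ^+ k) (g ^+ l) gk gl => G H G0 H0; field; rewrite t0 G0 H0.
Qed.

(** If k were positive, (g * u) ^+ k, which is outside p, would be equal up to units
    at p to u ^+ k, which is in p. *)
Lemma local_unit_nat (k : nat) s t : OK s -> OK t -> ~ p s -> ~ p t ->
  g ^+ k = s / t -> k = 0%N.
Proof.
move=> sO tO ps pt; have [_ _ pu pgu] := gu.
case: k => // k gE; exfalso.
have t0 : t != 0 by apply: contra_notN pt => /eqP ->; have [[[_ ]]] := pm.
have : ~ p ((g * u) ^+ k.+1) by exact: max_idealX.
have e : (g * u) ^+ k.+1 * t = u ^+ k * s * u.
  by rewrite exprMn gE mulrAC divfK // [u ^+ k.+1]exprSr mulrA (mulrC s).
move=> pn; have : p ((g * u) ^+ k.+1 * t).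
  by rewrite e; apply: pM => //; apply: OK_mul => //; apply: OK_exp; exact: pO.
by case/(max_idealM pm (OK_exp _ gu_OK) tO).
Qed.

Lemma local_unit (k : int) s t : OK s -> OK t -> ~ p s -> ~ p t ->
  g ^ k = s / t -> k = 0.
Proof.
move=> sO tO ps pt; case: k => k gE; first by rewrite (@local_unit_nat k s t).
have : g ^+ k.+1 = t / s by rewrite -[LHS]invrK exprnN -NegzE gE invf_div.
by move/(local_unit_nat tO sO pt ps).
Qed.

(** The valuation at p; the exponent is opposite to that of g, because g is the inverse
    of a local parameter. *)
Definition local_ord (x : K) : int :=
  xget 0 [set k | exists s t, [/\ OK s, OK t, ~ p s, ~ p t & x = g ^ (- k) * (s / t)]].

Lemma local_ordE x k s t : OK s -> OK t -> ~ p s -> ~ p t ->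
  x = g ^ (- k) * (s / t) -> local_ord x = k.
Proof.
move=> sO tO ps pt xE; rewrite /local_ord; case: xgetP => [l lE [s' [t' []]]|/(_ k)[]].
  move=> s'O t'O ps' pt' xE'.
  have : g ^ (l - k) = (s' * t) / (t' * s).
    have g0 := param_neq0.
    have s0 : s != 0 by apply: contra_notN ps => /eqP ->; have [[[_ ]]] := pm.
    have t0 : t != 0 by apply: contra_notN pt => /eqP ->; have [[[_ ]]] := pm.
    have t'0 : t' != 0 by apply: contra_notN pt' => /eqP ->; have [[[_ ]]] := pm.
    have E : g ^ (- k) * (s / t) = g ^ (- l) * (s' / t') by rewrite -xE -xE'.
    rewrite expfzDr //; apply: (mulIf (x := g ^ (- l) * (s / t))).
      by rewrite !mulf_neq0 ?expfz_neq0 ?invr_eq0.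
    rewrite mulrACA -expfzDr // addrN expr0z mul1r E.
    by move: (g ^ (- l)) => G; field; rewrite s0 t0 t'0.
  move/local_unit => lk; apply/eqP; rewrite -subr_eq0; apply/eqP; apply: lk.
  - exact: OK_mul.
  - exact: OK_mul.
  - by move=> /(max_idealM pm s'O tO)[].
  - by move=> /(max_idealM pm t'O sO)[].
by exists s, t.
Qed.

End LocalStructure.

(** * Finite places and maximal ideals *)

Section FinitePlaceStructure.
Variables (R : realType) (K : fieldExtType rat).
Local Notation OK := (@ring_of_integers K).

Definition fin_place (v : K -> R) := absolute_value v /\ extends_padic v.

Lemma fin_place_param (v : K -> R) (g u : K) : fin_place v ->
  is_param (place_ideal v) g u -> 1 < v g /\
  forall x, x != 0 -> exists k : int, exists s t,
    [/\ OK s, OK t, v s = 1, v t = 1 & x = g ^ k * (s / t)].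
Proof.
move=> [va vp] gu; have pm := place_ideal_max va vp; split.
  have [_ _ [uO u1]] := gu; rewrite notin_place_ideal //; last first.
    by have [_ + pu _] := gu; apply.
  rewrite absM // => gu1; rewrite ltNge; apply/negP => g1.
  have : v g * v u < 1 by rewrite (le_lt_trans _ u1) // ler_piMl ?abs_ge0.
  by rewrite gu1 ltxx.
move=> x x0; have [k [s [t [sO tO ps pt xE]]]] := local_decomp R pm gu x0.
by exists k, s, t; split => //; apply/(notin_place_ideal va vp).
Qed.

(** The powers of the inverse w of g take all nonzero values of v; the last clause
    says that the valuation ring is the localisation of O at the ideal of v. *)
Lemma fin_place_structure (v : K -> R) : fin_place v ->
  exists w : K, [/\ 0 < v w, v w < 1,
    forall x, x != 0 -> exists k : int, v x = v w ^ k &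
    forall x, v x <= 1 -> exists s t, [/\ OK s, OK t, v t = 1 & x = s / t]].
Proof.
move=> vfin; have [va vp] := vfin; have pm := place_ideal_max va vp.
have [g [u gu]] := uniformizer_exists R pm; have [vg dec] := fin_place_param vfin gu.
have vg0 : 0 < v g by exact: lt_trans ltr01 vg.
have g0 : g != 0 by rewrite -(abs_gt0 va).
exists g^-1; rewrite absV //; split; rewrite ?invr_gt0 ?invf_lt1 //.
  move=> x /dec[k [s [t [_ _ vs vt ->]]]]; exists (- k).
  by rewrite absM // absM // absV // vs vt invr1 !mulr1 absXz // exprz_inv opprK.
move=> x; have [->|x0] := eqVneq x 0.
  by exists 0, 1; split; rewrite ?mul0r ?abs1 //; [exact: OK0|exact: OK1].
have [k [s [t [sO tO vs vt ->]]]] := dec x x0.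
rewrite absM // absM // absV // vs vt invr1 !mulr1 absXz //.
case: k => k; last first.
  move=> _; have [_ gpO pu pgu] := gu; have [uO _] := pu.
  exists (u ^+ k.+1 * s), ((g * u) ^+ k.+1 * t); split.
  - by apply: OK_mul => //; exact: OK_exp.
  - by apply: OK_mul => //; apply: OK_exp; exact: gpO.
  - rewrite absM // vt mulr1 absX //; move/(notin_place_ideal va vp): pgu => -> //.
      by rewrite expr1n.
    exact: gpO.
  - have u0 : u != 0.
      by apply: contra_notN pgu => /eqP ->; rewrite mulr0; have [[[_ ]]] := pm.
    have t0 : t != 0 by rewrite -(abs_gt0 va) vt.
    rewrite NegzE -exprnN exprMn.
    have : g ^+ k.+1 != 0 by rewrite expf_neq0.
    have : u ^+ k.+1 != 0 by rewrite expf_neq0.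
    move: (g ^+ k.+1) (u ^+ k.+1) => G U U0 G0.
    by field; rewrite U0 G0 t0.
rewrite -exprnP => vgk; have -> : k = 0%N.
  case: k vgk => // k; rewrite leNgt => /negP[].
  by rewrite exprn_egt1.
by exists s, t; split; rewrite ?expr0z ?mul1r.
Qed.

(** By Bezout, 1 would otherwise be a difference of two elements of absolute value
    less than 1. *)
Lemma fin_prime_uniq (v : K -> R) p q : fin_place v -> prime p -> prime q ->
  v p%:R < 1 -> v q%:R < 1 -> p = q.
Proof.
move=> [va vp] pp pq p1 q1; apply/eqP; apply: contraTT p1 => pq'.
have : coprime p q by rewrite prime_coprime // dvdn_prime2.
case/(coprimeP _ (prime_gt0 pp)) => -[a b] /= abE.
have E : (a * p = b * q + 1)%N by lia.
rewrite -leNgt leNgt; apply/negP => p1; have : v 1 < 1; last by rewrite abs1 ?ltxx.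
have -> : 1 = a%:R * p%:R - b%:R * q%:R :> K.
  by rewrite -!natrM E natrD addrAC subrr add0r.
apply: ultrametric_ltB => //; rewrite absM //.
  by rewrite (le_lt_trans _ p1) // ler_piMl ?abs_ge0 ?fin_nat_le1.
by rewrite (le_lt_trans _ q1) // ler_piMl ?abs_ge0 ?fin_nat_le1.
Qed.

(** Both places take the value 1 on the units at p, so they are determined by
    their value at a parameter, hence by their common value at a prime number. *)
Lemma fin_place_inj (v w : K -> R) : fin_place v -> fin_place w ->
  place_ideal v = place_ideal w -> v = w.
Proof.
move=> vf wf vw; have [va vp] := vf; have [wa wp] := wf.
have pm := place_ideal_max va vp.
have [g [u gu]] := uniformizer_exists R pm.
have gu' : is_param (place_ideal w) g u by rewrite -vw.
have [vg dec] := fin_place_param vf gu; have [wg _] := fin_place_param wf gu'.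
have unit_w s : OK s -> v s = 1 -> w s = 1.
  move=> sO vs; apply/(notin_place_ideal wa wp) => //; rewrite -vw.
  exact/(notin_place_ideal va vp).
have vE x k s t : OK s -> OK t -> v s = 1 -> v t = 1 -> x = g ^ k * (s / t) ->
    v x = v g ^ k /\ w x = w g ^ k.
  move=> sO tO vs vt ->; rewrite !absM // !absV // !absXz //.
  by rewrite vs vt (unit_w s) // (unit_w t) // invr1 !mulr1.
have [p pp vpE] := fin_prime vp; have [q pq wqE] := fin_prime wp.
have inv_lt1 l : prime l -> (l%:R^-1 : R) < 1.
  by move=> pl; rewrite invf_lt1 ?ltr1n ?ltr0n ?prime_gt0 ?prime_gt1.
have pqE : p = q.
  apply: (fin_prime_uniq wf) => //; last by rewrite wqE inv_lt1.
  have : place_ideal v p%:R by split; [exact: OK_nat|rewrite vpE inv_lt1].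
  by rewrite vw => -[].
have p0 : p%:R != 0 :> K by rewrite natK_eq0 gtn_eqF ?prime_gt0.
have [k [s [t [sO tO vs vt pE]]]] := dec _ p0.
have [vk wk] := vE _ _ _ _ sO tO vs vt pE.
have vg0 : 0 < v g by exact: lt_trans ltr01 vg.
have wg0 : 0 < w g by exact: lt_trans ltr01 wg.
have vwg : v g = w g.
  have vwk : v g ^ k = w g ^ k by rewrite -vk -wk vpE pqE -wqE -pqE.
  have k_neq0 : k != 0.
    apply/eqP => k0; move: vk; rewrite k0 expr0z vpE => e.
    by have := inv_lt1 _ pp; rewrite e ltxx.
  case: k k_neq0 vwk {vk wk pE} => k; rewrite ?NegzE -?exprnP -?exprnN => k0.
    by move/eqP; rewrite eqrXn2 ?ltW // ?lt0n // => /eqP.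
  by move/invr_inj/eqP; rewrite eqrXn2 ?ltW // => /eqP.
apply/funext => x; have [->|x0] := eqVneq x 0; first by rewrite !abs0.
have [k' [s' [t' [s'O t'O vs' vt' xE]]]] := dec _ x0.
by have [-> ->] := vE _ _ _ _ s'O t'O vs' vt' xE; rewrite vwg.
Qed.

(** The least positive integer of p is prime. *)
Lemma max_ideal_prime (p : set K) : max_ideal p -> exists2 l, prime l & p l%:R.
Proof.
move=> pm; have [pn p1 _] := pm; have [m m0 pm'] := ideal_nat R pn.
have exm : exists m, (0 < m)%N && `[< p m%:R >].
  by exists m; rewrite m0; apply/asboolP.
case: (ex_minnP exm) => l /andP[l0 /asboolP pl] minl; exists l => //.
apply: contrapT => /negP nl.
have l1 : (1 < l)%N.
  rewrite ltn_neqAle l0 andbT; apply: contra_notN p1 => /eqP l1.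
  by move: pl; rewrite -l1.
have [q pq ql] := pdivP l1.
have ql' : (q < l)%N.
  rewrite ltn_neqAle (dvdn_leq _ ql) ?andbT //.
  by apply: contra nl => /eqP <-.
have q0 := prime_gt0 pq.
have : p (q%:R * (l %/ q)%:R) by rewrite -natrM mulnC divnK.
case/(max_idealM pm (OK_nat _ _) (OK_nat _ _)) => pm2.
  by have := minl q; rewrite q0 leqNgt ql' /=; move=> /(_ (asboolT pm2)).
have := minl (l %/ q)%N; rewrite divn_gt0 // (dvdn_leq _ ql) //= leqNgt.
by rewrite ltn_Pdiv ?prime_gt1 //= => /(_ (asboolT pm2)).
Qed.

(** The absolute value c ^ ord x, where the base c < 1 is chosen such that the prime
    number l of p has absolute value 1 / l. *)
Lemma fin_place_exists (p : set K) : max_ideal p ->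
  exists2 v, fin_place v & place_ideal v = p.
Proof.
move=> pm; have [pn p1 _] := pm; have [pi _] := pn; have [pO p0 pD pM] := pi.
have [g [u gu]] := uniformizer_exists R pm; have [_ gpO pu pgu] := gu.
pose ord := local_ord p g.
have ordE := local_ordE pm gu.
have neq0 s : ~ p s -> s != 0 by apply: contra_notN => /eqP ->.
have g0 := param_neq0 gu.
have dec x : x != 0 -> exists s t, [/\ OK s, OK t, ~ p s, ~ p t
    & x = g ^ (- ord x) * (s / t)].
  move=> x0; have [k [s [t [sO tO ps pt xE]]]] := local_decomp R pm gu x0.
  exists s, t; split => //; rewrite /ord (ordE x (- k) s t) ?opprK //.
have ord_unit s t : OK s -> OK t -> ~ p s -> ~ p t -> ord (s / t) = 0.
  by move=> sO tO ps pt; apply: (ordE _ _ s t) => //; rewrite oppr0 expr0z mul1r.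
have ordM x y : x != 0 -> y != 0 -> ord (x * y) = ord x + ord y.
  move=> /dec[s [t [sO tO ps pt xE]]] /dec[s' [t' [s'O t'O ps' pt' yE]]].
  apply: (ordE _ _ (s * s') (t * t')); [exact: OK_mul|exact: OK_mul| | |].
  - by move=> /(max_idealM pm sO s'O)[].
  - by move=> /(max_idealM pm tO t'O)[].
  - by rewrite [in LHS]xE [in LHS]yE mulrACA -expfzDr // -opprD mulf_div.
have ord_OK x : OK x -> x != 0 -> 0 <= ord x /\ (p x -> 0 < ord x).
  move=> xO x0; have [k [s [sO ps] xE]] := local_decomp_OK R gu xO x0.
  have -> : ord x = k.
    by apply: (ordE _ _ s 1); rewrite ?divr1 -?exprnN //; exact: OK1.
  split => // px; rewrite ltz_nat lt0n; apply/eqP => k0; apply: ps.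
  by move: px; rewrite xE k0 expr0 invr1 mul1r.
have [l pl lp] := max_ideal_prime pm.
have l0 : l%:R != 0 :> K by rewrite natK_eq0 gtn_eqF ?prime_gt0.
have [_ /(_ lp)] := ord_OK _ (OK_nat K l) l0.
case eE : (ord l%:R) => [e|//]; rewrite ltz_nat => e_gt0.
have lR : 0 < l%:R :> R by rewrite ltr0n prime_gt0.
have lR1 : 1 < l%:R :> R by rewrite ltr1n prime_gt1.
pose c : R := (l%:R `^ e%:R^-1)^-1.
have cpow : c ^+ e = l%:R^-1.
  rewrite /c exprVn -powR_mulrn ?powR_ge0 // -powRrM mulVf ?powRr1 ?ltW //.
  by rewrite pnatr_eq0 -lt0n.
have c_gt0 : 0 < c by rewrite invr_gt0 powR_gt0.
have c_lt1 : c < 1.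
  rewrite ltNge; apply/negP => c1; have : 1 <= c ^+ e by rewrite exprn_ege1.
  by rewrite cpow leNgt invf_lt1 // lR1.
have cz_le (i j : int) : i <= j -> c ^ j <= c ^ i.
  move=> ij; rewrite -(subrK i j) expfzDr ?gt_eqF //.
  apply: ler_piMl; first by rewrite exprz_ge0 // ltW.
  case: (j - i) (subr_ge0 i j) => k; rewrite ?ij // => _.
  by rewrite -exprnP exprn_ile1 // ltW.
pose v x : R := if x == 0 then 0 else c ^ ord x.
have v0 : v 0 = 0 by rewrite /v eqxx.
have vM x y : v (x * y) = v x * v y.
  rewrite /v mulf_eq0; have [//|x0] := eqVneq x 0; first by rewrite mul0r.
  have [//|y0] := eqVneq y 0; first by rewrite mulr0.
  by rewrite ordM // expfzDr // gt_eqF.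
have v_ge0 x : 0 <= v x.
  by rewrite /v; case: ifP => // _; rewrite exprz_ge0 // ltW.
have vOK x : OK x -> v x <= 1.
  move=> xO; rewrite /v; case: eqVneq => [_|x0]; first exact: ler01.
  by have := cz_le _ _ (ord_OK _ xO x0).1; rewrite expr0z.
have v_unit x : OK x -> ~ p x -> v x = 1.
  move=> xO px; rewrite /v (negPf (neq0 _ px)) -[x]divr1 ord_unit //.
  exact: OK1.
(* a denominator outside p is obtained by replacing 1 / g ^+ k with
   u ^+ k / (g * u) ^+ k *)
have v_loc y : v y <= 1 -> exists S T, [/\ OK S, OK T, ~ p T & y = S / T].
  have [->|y0] := eqVneq y 0.
    by exists 0, 1; split; rewrite ?mul0r //; [exact: OK0|exact: OK1].
  have [s [t [sO tO ps pt yE]]] := dec y y0.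
  rewrite /v (negPf y0) => ly.
  have : 0 <= ord y.
    rewrite leNgt; apply/negP => oy; have : c ^ (-1) <= c ^ ord y.
      by apply: cz_le; lia.
    by move/le_trans => /(_ _ ly); rewrite exprN1 leNgt invf_gt1 ?c_lt1.
  case oE : (ord y) => [k|//] _.
  exists (u ^+ k * s), ((g * u) ^+ k * t).
  have guk : ~ p ((g * u) ^+ k) by apply: max_idealX => //; exact: gpO.
  split.
  - by apply: OK_mul => //; apply: OK_exp; exact: pO.
  - by apply: OK_mul => //; apply: OK_exp; exact: gpO.
  - by move=> /(max_idealM pm (OK_exp _ (gpO _ pu)) tO)[].
  - rewrite [LHS]yE oE -exprnN exprMn.
    have t0 := neq0 _ pt; have := neq0 _ guk; rewrite exprMn mulf_eq0 negb_or.
    move: (g ^+ k) (u ^+ k) => G U /andP[G0 U0].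
    by field; rewrite U0 G0 t0.
have v1 : v 1 = 1 by apply: v_unit => //; exact: OK1.
have v_1D y : v y <= 1 -> v (1 + y) <= 1.
  move=> /v_loc[S [T [SO TO pT ->]]].
  have T0 := neq0 _ pT.
  have -> : 1 + S / T = (T + S) * T^-1 by field.
  have vT : v T^-1 = 1.
    by have := v1; rewrite -{1}(mulfV T0) vM (v_unit T) // mul1r.
  by rewrite vM vT mulr1; apply: vOK; exact: OK_add.
have veq0 x : v x = 0 <-> x = 0.
  split=> [|->//]; rewrite /v; case: eqVneq => // x0 /eqP.
  by rewrite expfz_eq0 (gt_eqF c_gt0) andbF.
have va : absolute_value v.
  split => // x y.
  wlog xy : x y / v y <= v x.
    move=> H; have [/H//|/ltW/H] := leP (v y) (v x).
    by rewrite addrC [X in _ <= X]addrC.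
  have [x0|x0] := eqVneq x 0.
    by rewrite x0 v0 !add0r.
  apply: (@le_trans _ _ (v x)); last by rewrite lerDl.
  have -> : x + y = x * (1 + x^-1 * y) by rewrite mulrDr mulr1 mulVKf.
  have vx0 : 0 < v x.
    by rewrite lt_neqAle v_ge0 andbT eq_sym; apply/eqP => /veq0/eqP; rewrite (negPf x0).
  rewrite vM ler_piMr //; apply: v_1D.
  rewrite vM; have -> : v x^-1 = (v x)^-1.
    apply: (@mulfI _ (v x)); rewrite ?gt_eqF //.
    by rewrite -vM !mulfV ?v1 // gt_eqF.
  by rewrite mulrC ler_pdivrMr // mul1r.
have vl : v l%:R = l%:R^-1 by rewrite /v (negPf l0) eE -exprnP cpow.
have pcop m : coprime l m -> ~ p m%:R.
  case/(coprimeP _ (prime_gt0 pl)) => -[a b] /= abE pm'; apply: p1.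
  have E : (a * l = b * m + 1)%N by lia.
  have -> : 1 = a%:R * l%:R - b%:R * m%:R :> K.
    by rewrite -!natrM E natrD addrAC subrr add0r.
  by apply: (ideal_subgroup pi).2; apply: pM => //; exact: OK_nat.
have vnat m : (0 < m)%N -> v m%:R = l%:R ^- logn l m.
  move=> m0; have [m' lm' mE] := pfactor_coprime pl m0.
  rewrite [in LHS]mE natrM vM natrX absX // vl exprVn (v_unit m'%:R) ?mul1r //.
    exact: OK_nat.
  exact: pcop.
have vint (z : int) : z != 0 -> v z%:~R = l%:R ^- logn l `|z|%N.
  move=> z0; rewrite -vnat ?absz_gt0 //.
  case: z z0 => z z0 //; by rewrite NegzE mulrNz absN // abszN.
exists v; last first.
  apply/seteqP; split=> [x [xO x1]|x px].
    by apply: contrapT => npx; move: x1; rewrite v_unit // ltxx.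
  split; first exact: pO.
  rewrite /v; case: eqVneq => // x0.
  have [_ /(_ px) ox] := ord_OK _ (pO _ px) x0.
  have : c ^ ord x <= c ^ 1 by apply: cz_le; lia.
  by move/le_lt_trans; apply; rewrite expr1z.
split => //; exists l => // q; rewrite /padic_abs; case: eqVneq => [->|q0].
  by rewrite scale0r v0.
have -> : q%:A = (numq q)%:~R / (denq q)%:~R :> K.
  rewrite -[in LHS](divq_num_den q) -[_%:A]/(GRing.in_alg K _).
  by rewrite fmorph_div !rmorph_int.
rewrite vM absV // !vint ?numq_eq0 ?denq_eq0 //.
by rewrite invrK mulrC.
Qed.

End FinitePlaceStructure.

(** * Local degrees *)

Section CauchySequences.
Variables (R : realType) (K : fieldExtType rat) (v : K -> R).
Hypothesis va : absolute_value v.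
Implicit Types s t : nat -> K.

Lemma null_cauchy s : null_for v s -> cauchy_for v s.
Proof.
move=> ns e e0; have e20 : 0 < e / 2 by rewrite divr_gt0.
have [m mP] := ns _ e20; exists m => i j mi mj.
apply: le_lt_trans (le_absD va _ _) _; rewrite absN // (splitr e).
by apply: ltrD; exact: mP.
Qed.

Lemma null0 : null_for v (fun=> 0).
Proof. by move=> e e0; exists 0%N => i _; rewrite abs0. Qed.

Lemma cauchy_const x : cauchy_for v (fun=> x).
Proof. by move=> e e0; exists 0%N => i j _ _; rewrite subrr abs0. Qed.

Lemma nullD s t : null_for v s -> null_for v t -> null_for v (fun k => s k + t k).
Proof.
move=> ns nt e e0; have e20 : 0 < e / 2 by rewrite divr_gt0.
have [m mP] := ns _ e20; have [m' mP'] := nt _ e20.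
exists (maxn m m') => i; rewrite geq_max => /andP[mi mi'].
apply: le_lt_trans (le_absD va _ _) _; rewrite (splitr e).
by apply: ltrD; [exact: mP|exact: mP'].
Qed.

Lemma cauchyD s t : cauchy_for v s -> cauchy_for v t ->
  cauchy_for v (fun k => s k + t k).
Proof.
move=> cs ct e e0; have e20 : 0 < e / 2 by rewrite divr_gt0.
have [m mP] := cs _ e20; have [m' mP'] := ct _ e20.
exists (maxn m m') => i j; rewrite !geq_max => /andP[mi mi'] /andP[mj mj'].
rewrite opprD addrACA; apply: le_lt_trans (le_absD va _ _) _; rewrite (splitr e).
by apply: ltrD; [exact: mP|exact: mP'].
Qed.

Lemma cauchyN s : cauchy_for v s -> cauchy_for v (fun k => - s k).
Proof.
move=> cs e e0; have [m mP] := cs _ e0; exists m => i j mi mj.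
by rewrite -opprD absN //; exact: mP.
Qed.

Lemma cauchy_bounded s : cauchy_for v s ->
  exists m, exists2 B, 0 < B & forall i, (m <= i)%N -> v (s i) <= B.
Proof.
move=> cs; have [m mP] := cs _ ltr01; exists m, (v (s m) + 1).
  by rewrite ltr_wpDl // abs_ge0.
move=> i mi; have -> : s i = s m + (s i - s m) by rewrite addrC subrK.
apply: le_trans (le_absD va _ _) _; rewrite lerD2l ltW //; exact: mP.
Qed.

Lemma nullM s t : cauchy_for v s -> null_for v t -> null_for v (fun k => s k * t k).
Proof.
move=> /cauchy_bounded[m [B B0 mP]] nt e e0.
have [m' mP'] := nt _ (divr_gt0 e0 B0).
exists (maxn m m') => i; rewrite geq_max => /andP[mi mi'].
rewrite absM //; apply: le_lt_trans (_ : B * v (t i) < e).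
  by apply: ler_wpM2r; rewrite ?abs_ge0 ?mP.
by rewrite mulrC -ltr_pdivlMr //; exact: mP'.
Qed.

Lemma cauchyM s t : cauchy_for v s -> cauchy_for v t ->
  cauchy_for v (fun k => s k * t k).
Proof.
move=> cs ct e e0.
have [m [B B0 mP]] := cauchy_bounded cs; have [m' [B' B'0 mP']] := cauchy_bounded ct.
have eB : 0 < e / 2 / (B + B') by rewrite !divr_gt0 // addr_gt0.
have [l lP] := cs _ eB; have [l' lP'] := ct _ eB.
exists (maxn (maxn m m') (maxn l l')) => i j; rewrite !geq_max.
move=> /andP[/andP[mi mi'] /andP[li li']] /andP[/andP[mj mj'] /andP[lj lj']].
have -> : s i * t i - s j * t j = s i * (t i - t j) + (s i - s j) * t j by ring.
apply: le_lt_trans (le_absD va _ _) _; rewrite !absM //.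
apply: (@le_lt_trans _ _ ((B + B') * (e / 2 / (B + B')))); last first.
  by rewrite mulrC divfK ?gt_eqF ?addr_gt0 // ltr_pdivrMr // ltr_pMr // ltr1n.
rewrite mulrDl; apply: lerD.
  by apply: ler_pM; rewrite ?abs_ge0 ?mP // ltW //; exact: lP'.
rewrite mulrC; apply: ler_pM; rewrite ?abs_ge0 ?mP' // ltW //; exact: lP.
Qed.

Lemma null_sum (I : Type) (r : seq I) (P : pred I) (F : I -> nat -> K) :
  (forall i, P i -> null_for v (F i)) ->
  null_for v (fun k => \sum_(i <- r | P i) F i k).
Proof.
move=> FP; elim: r => [|i r IH].
  by apply: (eq_ind _ (null_for v) null0); apply/funext => k; rewrite big_nil.
have [Pi|nPi] := boolP (P i).
  apply: (eq_ind _ (null_for v) (nullD (FP _ Pi) IH)).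
  by apply/funext => k; rewrite big_cons Pi.
by apply: (eq_ind _ (null_for v) IH); apply/funext => k; rewrite big_cons (negPf nPi).
Qed.

Lemma cauchy_sum (I : Type) (r : seq I) (P : pred I) (F : I -> nat -> K) :
  (forall i, P i -> cauchy_for v (F i)) ->
  cauchy_for v (fun k => \sum_(i <- r | P i) F i k).
Proof.
move=> FP; elim: r => [|i r IH].
  apply: (eq_ind _ (cauchy_for v) (null_cauchy null0)).
  by apply/funext => k; rewrite big_nil.
have [Pi|nPi] := boolP (P i).
  apply: (eq_ind _ (cauchy_for v) (cauchyD (FP _ Pi) IH)).
  by apply/funext => k; rewrite big_cons Pi.
by apply: (eq_ind _ (cauchy_for v) IH); apply/funext => k; rewrite big_cons (negPf nPi).
Qed.

(** A Cauchy sequence that is not null stays away from 0 from some index on, so its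
    inverses are Cauchy too; the first terms, for which s k may be 0, do not affect
    the limits. *)
Lemma cauchy_inverse s : cauchy_for v s -> ~ null_for v s ->
  cauchy_for v (fun k => (s k)^-1) /\ null_for v (fun k => 1 - (s k)^-1 * s k).
Proof.
move=> cs /existsNP[e /not_implyP[e0 /forallNP ne]].
have e20 : 0 < e / 2 by rewrite divr_gt0.
have [m mP] := cs _ e20.
have lo i : (m <= i)%N -> e / 2 <= v (s i).
  move=> mi; have /existsNP[j /not_implyP[mj /negP]] := ne m.
  rewrite -leNgt => ej; rewrite leNgt; apply/negP => sie.
  move: ej; rewrite leNgt => /negP; apply.
  have -> : s j = s i + (s j - s i) by rewrite addrC subrK.
  apply: le_lt_trans (le_absD va _ _) _; rewrite (splitr e).
  by apply: ltrD => //; exact: mP.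
have s0 i : (m <= i)%N -> s i != 0.
  by move=> mi; rewrite -(abs_gt0 va) (lt_le_trans e20) // lo.
split; last first.
  by move=> d d0; exists m => i mi; rewrite mulVf ?s0 // subrr abs0.
move=> d d0; have dE : 0 < d * (e / 2) ^+ 2 by rewrite mulr_gt0 // exprn_gt0.
have [m' mP'] := cs _ dE.
exists (maxn m m') => i j; rewrite !geq_max => /andP[mi mi'] /andP[mj mj'].
have -> : (s i)^-1 - (s j)^-1 = (s j - s i) / (s i * s j).
  by field; rewrite !s0.
rewrite absM // absV // absM // ltr_pdivrMr; last first.
  by rewrite mulr_gt0 // (lt_le_trans e20) // lo.
apply: lt_le_trans (mP' _ _ mj' mi') _; rewrite ler_pM2l // expr2.
by apply: ler_pM; rewrite ?lo // ltW.
Qed.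

End CauchySequences.

Section LocalDegree.
Variables (R : realType) (K : fieldExtType rat) (v : K -> R).
Hypothesis va : absolute_value v.

Let qcauchy (q : nat -> rat) := cauchy_for v (fun k => (q k)%:A).
Let qnull (q : nat -> rat) := null_for v (fun k => (q k)%:A).

Let algD (x y : rat) : (x + y)%:A = x%:A + y%:A :> K.
Proof. exact: scalerDl. Qed.
Let algM (x y : rat) : (x * y)%:A = x%:A * y%:A :> K.
Proof. exact: (rmorphM (GRing.in_alg K)). Qed.
Let algN (x : rat) : (- x)%:A = - x%:A :> K.
Proof. exact: (rmorphN (GRing.in_alg K)). Qed.
Let alg_sum (I : finType) (P : pred I) (F : I -> rat) :
  (\sum_(i | P i) F i)%:A = \sum_(i | P i) (F i)%:A :> K.
Proof. exact: (rmorph_sum (GRing.in_alg K)). Qed.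

(** Gaussian elimination over the field of rational Cauchy sequences modulo
    null sequences: more than d rows of length d are linearly dependent. *)
Lemma cauchy_rows_dependent (I : finType) d (P : {set I})
  (Q : I -> nat -> nat -> rat) : (d < #|P|)%N -> (forall i j, qcauchy (Q i j)) ->
  exists c : I -> nat -> rat, [/\ forall i, qcauchy (c i),
    exists2 i, i \in P & ~ qnull (c i) &
    forall j, (j < d)%N -> qnull (fun k => \sum_(i in P) c i k * Q i j k)].
Proof.
elim: d P Q => [|d IH] P Q dP cQ.
  exists (fun _ _ => 1); split => // [i|].
    exact: cauchy_const.
  move: dP => /card_gt0P[i iP]; exists i => // /(_ 1 ltr01)[m /(_ m (leqnn m))].
  by rewrite scale1r abs1 // ltxx.
have [allnull|] := pselect (forall i, i \in P -> qnull (Q i d)).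
  have [c [cc cP cQ0]] := IH P Q (ltnW dP) cQ; exists c; split => // j.
  rewrite ltnS leq_eqVlt => /orP[/eqP -> {j}|]; last exact: cQ0.
  apply: (eq_ind _ (null_for v) (null_sum va (index_enum I)
    (fun i iP => nullM va (cc i) (allnull i iP)))).
  by apply/funext => k; rewrite alg_sum; apply: eq_bigr => i _; rewrite algM.
move=> /existsNP[i0 /not_implyP[i0P nQ]].
have [ct nt] := cauchy_inverse va (cQ i0 d) nQ.
pose t k := (Q i0 d k)^-1.
have tE k : (t k)%:A = ((Q i0 d k)%:A)^-1 :> K.
  exact: (fmorphV (GRing.in_alg K)).
have tc : qcauchy t.
  by apply: (eq_ind _ (cauchy_for v) ct); apply/funext => k; rewrite tE.
pose Q' i j k := Q i j k - Q i d k * t k * Q i0 j k.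
have cQ' i j : qcauchy (Q' i j).
  apply: (eq_ind _ (cauchy_for v) (cauchyD va (cQ i j)
    (cauchyN va (cauchyM va (cauchyM va (cQ i d) tc) (cQ i0 j))))).
  by apply/funext => k; rewrite /Q' algD algN !algM.
have dP' : (d < #|P :\ i0|)%N by rewrite (cardsD1 i0) i0P in dP.
have [c [cc [i1 i1P nc1] cQ0]] := IH _ Q' dP' cQ'.
pose c' i k := if i == i0 then - \sum_(l in P :\ i0) c l k * Q l d k * t k else c i k.
have sumE j k : \sum_(i in P) c' i k * Q i j k = \sum_(i in P :\ i0) c i k * Q' i j k.
  rewrite (big_setD1 i0) //= /c' eqxx mulNr mulr_suml -sumrN -big_split /=.
  apply: eq_bigr => i; rewrite !inE => /andP[/negPf -> _] /=; rewrite /Q'.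
  move: (c i k) (Q i j k) (Q i d k) (Q i0 j k) (t k) => *; ring.
exists c'; split.
- move=> i; rewrite /qcauchy /c'; case: eqP => _; last exact: cc.
  apply: (eq_ind _ (cauchy_for v) (cauchyN va (cauchy_sum va (index_enum I)
    (fun l (_ : l \in P :\ i0) => cauchyM va (cauchyM va (cc l) (cQ l d)) tc)))).
  apply/funext => k; rewrite algN alg_sum; congr (- _).
  by apply: eq_bigr => l _; rewrite !algM.
- exists i1; first by move: i1P; rewrite !inE => /andP[].
  by move: i1P; rewrite /c' !inE => /andP[/negPf -> _].
- move=> j; rewrite ltnS leq_eqVlt => jd; rewrite /qnull.
  under eq_fun do rewrite sumE.
  case/orP: jd => [/eqP -> {j}|]; last exact: cQ0.
  have nt' : null_for v (fun k => 1 - (t k)%:A * (Q i0 d k)%:A).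
    by apply: (eq_ind _ (null_for v) nt); apply/funext => k; rewrite tE.
  apply: (eq_ind _ (null_for v) (null_sum va (index_enum I)
    (fun l (_ : l \in P :\ i0) => nullM va (cauchyM va (cc l) (cQ l d)) nt'))).
  apply/funext => k; rewrite alg_sum; apply: eq_bigr => l _.
  rewrite /Q' !(algM, algD, algN).
  move: (c l k)%:A (Q l d k)%:A (Q i0 d k)%:A (t k)%:A => *; ring.
Qed.

(** A dependence relation between the rows of coordinates of b' in b, modulo null
    sequences, is one between the elements of b'. *)
Lemma completion_basis_leq d d' (b : 'I_d -> nat -> K) (b' : 'I_d' -> nat -> K) :
  completion_basis v b -> completion_basis v b' -> (d' <= d)%N.
Proof.
move=> [bc bspan _] [b'c _ b'free]; rewrite leqNgt; apply/negP => dd'.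
have /choice[q qP] (i : 'I_d') : exists q : 'I_d -> nat -> rat,
    (forall j, qcauchy (q j)) /\
    null_for v (fun k => b' i k - \sum_(j < d) (q j k)%:A * b j k).
  by have [q] := bspan _ (b'c i); exists q.
pose Q (i : 'I_d') (j : nat) : nat -> rat :=
  if insub j is Some j' then q i j' else fun=> 0.
have QE i (j : 'I_d) : Q i j = q i j by rewrite /Q valK.
have cQ i j : qcauchy (Q i j).
  rewrite /Q; case: insubP => [j' _ _|_]; first by case: (qP i).
  exact: cauchy_const.
have dT : (d < #|[set: 'I_d']%SET|)%N by rewrite cardsT card_ord.
have [c [cc [i1 _ nc] cQ0]] := cauchy_rows_dependent dT cQ.
apply: nc; apply: (b'free c) => //.
have n1 : null_for v (fun k => \sum_(i < d') (c i k)%:A *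
    (b' i k - \sum_(j < d) (q i j k)%:A * b j k)).
  exact: (null_sum va (index_enum _)
    (fun i (_ : true) => nullM va (cc i) (qP i).2)).
have n2 : null_for v (fun k => \sum_(j < d) b j k *
    (\sum_(i in [set: 'I_d']%SET) c i k * Q i j k)%:A).
  exact: (null_sum va (index_enum _)
    (fun j (_ : true) => nullM va (bc j) (cQ0 j (ltn_ord j)))).
apply: (eq_ind _ (null_for v) (nullD va n1 n2)); apply/funext => k.
under [X in _ + X]eq_bigr => j _.
  rewrite alg_sum mulr_sumr.
  under eq_bigr do rewrite QE algM.
  over.
rewrite exchange_big /= [X in _ + X](eq_bigl xpredT); last by move=> i; rewrite inE.
rewrite -big_split /=; apply: eq_bigr => i _.
rewrite mulrBr -addrA mulr_sumr [X in _ + X](_ : _ = 0) ?addr0 // addrC.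
by apply/eqP; rewrite subr_eq0; apply/eqP/eq_bigr => j _; rewrite mulrC mulrA.
Qed.

(** The approximations of a Cauchy sequence by combinations of b have Cauchy
    coefficients, because the coefficients are controlled by the combination;
    so b represents a basis of the completion. *)
Lemma local_degree_eq d (b : 'I_d -> K) (C : R) : 0 < C ->
  (forall (q : 'I_d -> rat) j, v (q j)%:A <= C * v (\sum_i (q i)%:A * b i)) ->
  (forall x e, 0 < e -> exists q : 'I_d -> rat, v (x - \sum_i (q i)%:A * b i) < e) ->
  local_degree v = d.
Proof.
move=> C0 bnd dense.
have basis : completion_basis v (fun j _ => b j).
  split=> [j|s cs|q cq nq j]; first exact: cauchy_const.
    have /choice[q qP] (k : nat) : exists q : 'I_d -> rat,
        v (s k - \sum_i (q i)%:A * b i) < k.+1%:R^-1.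
      by apply: dense; rewrite invr_gt0 ltr0n.
    have nq : null_for v (fun k => s k - \sum_(j < d) (q k j)%:A * b j).
      move=> e e0; exists (Num.truncn e^-1) => i ie.
      apply: lt_le_trans (qP i) _; rewrite -[e]invrK lef_pV2 ?posrE ?invr_gt0 ?ltr0n //.
      by apply: ltW (lt_le_trans (truncnS_gt _) _); rewrite ler_nat ltnS.
    exists (fun j k => q k j) => // j e e0.
    have eC : 0 < e / C by rewrite divr_gt0.
    have cc : cauchy_for v (fun k => s k - (s k - \sum_(j < d) (q k j)%:A * b j)).
      by apply: cauchyD => //; apply: cauchyN => //; exact: null_cauchy.
    have [m mP] := cc _ eC; exists m => k l mk ml.
    rewrite -algN -algD; apply: le_lt_trans (bnd (fun i => q k i - q l i) j) _.
    rewrite mulrC -ltr_pdivlMr //; have := mP k l mk ml.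
    rewrite !subKr; congr (v _ < _); rewrite -sumrB; apply: eq_bigr => i _.
    by rewrite algD algN mulrBl.
  move=> e e0; have eC : 0 < e / C by rewrite divr_gt0.
  have [m mP] := nq _ eC; exists m => i mi.
  apply: le_lt_trans (bnd (q^~ i) j) _; rewrite mulrC -ltr_pdivlMr //.
  exact: mP.
rewrite /local_degree; case: xgetP => [d' _ [b' b'P]|/(_ d)[]].
  apply/eqP; rewrite eqn_leq (completion_basis_leq basis b'P).
  by rewrite (completion_basis_leq b'P basis).
by exists (fun j _ => b j).
Qed.

End LocalDegree.

(** * Normalised absolute values at the finite places *)

Section FiniteLocalDegree.
Variables (R : realType) (K : fieldExtType rat) (v : K -> R).
Local Notation OK := (@ring_of_integers K).
Hypothesis vf : fin_place v.

Let va : absolute_value v. Proof. by case: vf. Qed.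
Let vp : extends_padic v. Proof. by case: vf. Qed.

(** The last clause describes the valuation ring as the localisation of O at the ideal
    of v; it transfers approximation statements from O to the valuation ring. *)
Definition is_uniformizer (w : K) :=
  [/\ 0 < v w, v w < 1,
    forall x, x != 0 -> exists k : int, v x = v w ^ k &
    forall x, v x <= 1 -> exists s t, [/\ OK s, OK t, v t = 1 & x = s / t]].

Definition vball (r : R) : set K := [set x | v x <= r].

Lemma vball_subgroup r : 0 <= r -> subgroup (vball r).
Proof.
move=> r0; split=> [|x y]; first by rewrite /vball /= abs0.
exact: ultrametric_leB.
Qed.

Variables (w : K) (T : finType) (f : T -> K).
Hypotheses (wu : is_uniformizer w) (ft : transversal OK (place_ideal v) f).

Lemma uniformizer_discrete x : v x < 1 -> v x <= v w.
Proof.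
have [w0 w1 wk _] := wu.
have [->|x0] := eqVneq x 0; first by rewrite abs0 // ltW.
have [k ->] := wk x x0; case: k => [[|k]|k]; rewrite ?expr0z ?ltxx //.
  by rewrite -exprnP exprS => _; rewrite ler_piMr // ?exprn_ile1 // ltW.
rewrite NegzE -exprnN -exprVn ltNge => /negP[].
by rewrite exprn_ege1 // invf_ge1 // ltW.
Qed.

(** Multiplication by w ^+ i identifies the quotient of two successive balls with the
    residue field O / p. *)
Lemma shell_transversal i :
  transversal (vball (v w ^+ i)) (vball (v w ^+ i.+1)) (fun t => w ^+ i * f t).
Proof.
have [w0 w1 _ wO] := wu; have [fO covf injf] := ft.
have wi0 : 0 < v w ^+ i by rewrite exprn_gt0.
have win : w ^+ i != 0 by rewrite -(abs_gt0 va) absX.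
split=> [t|x /= xi|t u].
- rewrite /vball /= absM // absX // ler_piMr //; first exact: ltW.
  exact: fin_OK_le1.
- have : v (x / w ^+ i) <= 1 by rewrite absM // absV // absX // ler_pdivrMr // mul1r.
  move=> /wO[s [t [sO tO vt xE]]].
  have [_ _ inv] := place_ideal_max va vp.
  have [|y yO [_ y1]] := inv t tO; first by case=> _; rewrite vt ltxx.
  have [l [_ l1]] := covf (s * y) (OK_mul sO yO).
  exists l; rewrite /vball /=.
  have t0 : t != 0 by rewrite -(abs_gt0 va) vt.
  have -> : x - w ^+ i * f l = w ^+ i * ((s / t) * (1 - t * y) + (s * y - f l)).
    rewrite mulrDr -[x in LHS](divfK win) xE.
    by move: (w ^+ i) => W; field.
  rewrite absM // absX // exprSr ler_pM2l //; apply: uniformizer_discrete.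
  apply: ultrametric_lt => //; rewrite absM // absM // absV // vt invr1 mulr1.
  by rewrite (le_lt_trans _ y1) // ler_piMl ?abs_ge0 // fin_OK_le1.
- rewrite /vball /= -mulrBr absM // absX // exprSr ler_pM2l // => tu.
  apply: injf; split; first exact: OK_sub.
  exact: le_lt_trans tu w1.
Qed.

Lemma ball_transversal i : exists (U : finType) (g : U -> K),
  transversal (vball 1) (vball (v w ^+ i)) g /\ #|U| = (#|T| ^ i)%N.
Proof.
have [w0 w1 _ _] := wu.
have wi_le1 j : v w ^+ j <= 1 by rewrite exprn_ile1 ?ltW.
elim: i => [|i [U [g [gU cU]]]].
  exists unit, (fun=> 0); split; last by rewrite card_unit.
  split=> [_|x xb|[] []//]; first by rewrite /vball /= abs0.
  by exists tt; rewrite subr0.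
exists (U * T)%type, (fun ut => g ut.1 + w ^+ i * f ut.2); split; last first.
  by rewrite card_prod cU expnSr.
apply: transversal_trans gU (shell_transversal i).
- exact: vball_subgroup.
- by apply: vball_subgroup; rewrite exprn_ge0 ?ltW.
- by move=> x /le_trans; apply.
- by move=> x /le_trans; apply; rewrite exprS ler_piMl ?exprn_ge0 ?ltW.
Qed.

Variable (p : nat).
Hypotheses (pp : prime p) (pv : v p%:R = p%:R^-1).

Let p0 : 0 < p%:R :> R. Proof. by rewrite ltr0n prime_gt0. Qed.
Let pK0 : p%:R != 0 :> K. Proof. by rewrite natK_eq0 gtn_eqF ?prime_gt0. Qed.

Lemma int_unit_coprime (z : int) : ~~ (p %| z)%Z -> v z%:~R = 1.
Proof.
move=> pz; apply/(notin_place_ideal va vp (OK_int K z)) => -[_ z1].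
have cop : coprimez p z by rewrite /coprimez /gcdz absz_nat eqz_nat -/(coprime _ _)
  prime_coprime.
have [[a b] /= ab] := coprimezP _ _ cop.
have : v 1 < 1; last by rewrite abs1 // ltxx.
have <- : a%:~R * p%:R + b%:~R * z%:~R = 1 :> K.
  by rewrite -[p%:R]/(p%:~R) -!intrM -intrD ab.
apply: ultrametric_lt => //; rewrite absM //; last first.
  by rewrite (le_lt_trans _ z1) // ler_piMl ?abs_ge0 // fin_int_le1.
rewrite pv (@le_lt_trans _ _ (p%:R^-1)) ?invf_lt1 ?ltr1n ?prime_gt1 //.
by rewrite ler_piMl ?fin_int_le1 // invr_ge0 ltW.
Qed.

Lemma int_dvd_le (z : int) : (p %| z)%Z -> v z%:~R <= p%:R^-1.
Proof.
case/dvdzP => k ->; rewrite intrM absM // -[p%:~R]/(p%:R) pv.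
by rewrite ler_piMl ?fin_int_le1 // invr_ge0 ltW.
Qed.

Lemma rat_den_unit (r : rat) : v r%:A <= 1 -> v (denq r)%:~R = 1.
Proof.
move=> r1; apply: int_unit_coprime; apply: contraTN r1 => pd; rewrite -ltNge.
have dn0 : (denq r)%:~R != 0 :> K by rewrite intK_eq0 denq_eq0.
have -> : r%:A = (numq r)%:~R / (denq r)%:~R :> K.
  rewrite -[in LHS](divq_num_den r) -[_%:A]/(GRing.in_alg K _).
  by rewrite fmorph_div !rmorph_int.
rewrite absM // absV // (@int_unit_coprime (numq r)).
  rewrite mul1r invf_gt1 ?abs_gt0 //.
  by rewrite (le_lt_trans (int_dvd_le pd)) // invf_lt1 ?ltr1n ?prime_gt1.
apply/negP => pn; have := coprime_num_den r; rewrite /coprime.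
move: pd pn; rewrite !dvdzE absz_nat => pd pn /eqP g1.
have : (p %| gcdn `|numq r| `|denq r|)%N by rewrite dvdn_gcd pn pd.
by rewrite g1 dvdn1 gtn_eqF ?prime_gt1.
Qed.

(** Independence over the field with p elements of the classes of the b i modulo p,
    stated with integral coefficients. *)
Definition indep_mod_p d (b : 'I_d -> K) := (forall i, v (b i) <= 1) /\
  forall m : 'I_d -> int, v (\sum_i (m i)%:~R * b i) <= p%:R^-1 ->
    forall i, (p %| m i)%Z.

Lemma int_comb_le1 d (b : 'I_d -> K) (m : 'I_d -> int) : (forall i, v (b i) <= 1) ->
  v (\sum_i (m i)%:~R * b i) <= 1.
Proof.
move=> b1; apply: ultrametric_sum => // i _; rewrite absM //.
by rewrite mulr_ile1 ?abs_ge0 ?fin_int_le1.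
Qed.

Definition digit_comb d (b : 'I_d -> K) (z : {ffun 'I_d -> 'I_p.-1.+1}) : K :=
  \sum_i ((z i)%:Z)%:~R * b i.

Lemma digit_comb_inj d (b : 'I_d -> K) z z' : indep_mod_p b ->
  vball p%:R^-1 (digit_comb b z - digit_comb b z') -> z = z'.
Proof.
move=> [_ bfree]; rewrite /vball /= /digit_comb -sumrB.
under eq_bigr do rewrite -mulrBl -intrB.
move=> /(bfree (fun i => (z i)%:Z - (z' i)%:Z)) dv; apply/ffunP => i; apply/val_inj => /=.
have := dv i; rewrite -eqz_mod_dvd => /eqP.
have lt (k : 'I_p.-1.+1) : 0 <= k%:Z < p by rewrite /= ltz_nat -[X in (_ < X)%N](prednK (prime_gt0 pp)) ltn_ord.
by rewrite !modz_small // => -[].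
Qed.

Lemma card_digits d : #|{ffun 'I_d -> 'I_p.-1.+1}| = (p ^ d)%N.
Proof. by rewrite card_ffun !card_ord prednK // prime_gt0. Qed.

(** The residues modulo p of the valuation ring form a vector space over the
    field with p elements, of which b is a basis when the family is maximal. *)
Lemma residue_basis : exists d (b : 'I_d -> K), indep_mod_p b /\
  forall x, v x <= 1 ->
    exists z : 'I_d -> int, v (x - \sum_i (z i)%:~R * b i) <= p%:R^-1.
Proof.
have [w0 w1 wk _] := wu.
have pinv0 : 0 <= (p%:R^-1 : R) by rewrite invr_ge0 ltW.
have pinv1 : (p%:R^-1 : R) < 1 by rewrite invf_lt1 ?ltr1n ?prime_gt1.
have [e pe] : exists e : nat, p%:R^-1 = v w ^+ e.
  have [k kE] := wk _ pK0; rewrite -pv kE.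
  case: k kE => k; first by exists k.
  rewrite NegzE -exprnN -exprVn pv => kE; have : 1 <= p%:R^-1 :> R.
    by rewrite kE exprn_ege1 // invf_ge1 // ltW.
  by rewrite leNgt pinv1.
have [U [g [[Ug covg injg] cU]]] := ball_transversal e.
have sub := vball_subgroup pinv0.
have card_le d (b : 'I_d -> K) : indep_mod_p b -> (p ^ d <= #|U|)%N.
  move=> bind; have [b1 _] := bind; rewrite -card_digits.
  apply: (@transversal_leq _ (vball 1) (vball p%:R^-1) _ _ (digit_comb b) g) => //.
  - by move=> z; apply: int_comb_le1.
  - by move=> z z'; exact: digit_comb_inj.
  - by rewrite pe.
pose P d := `[< exists b : 'I_d -> K, indep_mod_p b >].
have exP : exists d, P d.
  by exists 0%N; apply/asboolP; exists (fun=> 0); split => [[]|m _ []].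
have ubP d : P d -> (d <= #|U|)%N.
  move=> /asboolP[b /card_le]; apply: leq_trans.
  by rewrite ltnW // ltn_expl // prime_gt1.
case: (ex_maxnP exP ubP) => d /asboolP[b bind] maxd.
exists d, b; split => // x x1; have [b1 bfree] := bind.
pose b' (i : 'I_d.+1) := if unlift ord0 i is Some j then b j else x.
have : ~ indep_mod_p b'.
  move=> ind; have := maxd d.+1; have Pd : P d.+1 by apply/asboolP; exists b'.
  by move/(_ Pd); rewrite ltnn.
move=> /not_andP[|/existsNP[m /not_implyP[]]].
  case=> i; rewrite /b'; case: unliftP => [j _|_] //; exact: b1.
rewrite big_ord_recl /b' unlift_none => le1 ndv.
move: le1; under eq_bigr do rewrite liftK; move=> le1.
have pm0 : ~~ (p %| m ord0)%Z.
  apply/negP => pm0; apply: ndv => i.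
  have [->//|[j ->]] : i = ord0 \/ exists j, i = lift ord0 j.
    by case: (unliftP ord0 i) => [j ->|->]; [right; exists j|left].
  apply: (bfree (fun j => m (lift ord0 j))).
  move: le1; set S := \sum_(i < d) _ => le1.
  have -> : S = ((m ord0)%:~R * x + S) - (m ord0)%:~R * x by rewrite addrAC subrr add0r.
  apply: ultrametric_leB => //; rewrite absM //.
  by rewrite -[X in _ <= X]mulr1 ler_pM ?abs_ge0 ?int_dvd_le.
have cop : coprimez p (m ord0).
  by rewrite /coprimez /gcdz absz_nat eqz_nat -/(coprime _ _) prime_coprime.
have [[a c] /= ac] := coprimezP _ _ cop.
exists (fun j => - (c * m (lift ord0 j))).
set S := \sum_(i < d) _ in le1.
have -> : x - \sum_i (- (c * m (lift ord0 i)))%:~R * b i =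
    a%:~R * p%:R * x + c%:~R * ((m ord0)%:~R * x + S).
  have -> : \sum_i (- (c * m (lift ord0 i)))%:~R * b i = - (c%:~R * S).
    rewrite mulr_sumr -sumrN; apply: eq_bigr => i _.
    by rewrite mulrNz mulNr intrM mulrA.
  rewrite opprK mulrDr addrA mulrA -mulrDl -[p%:R]/(p%:~R) -!intrM -intrD ac.
  by rewrite mul1r.
apply: ultrametric_le => //; rewrite absM //.
  rewrite -[X in _ <= X]mulr1; apply: ler_pM; rewrite ?abs_ge0 // absM // pv.
  by rewrite ler_piMl // fin_int_le1.
by rewrite -[X in _ <= X]mul1r; apply: ler_pM; rewrite ?abs_ge0 ?fin_int_le1.
Qed.

(** Dividing by the coefficient of largest absolute value, all coefficients may be
    assumed v-integral and one equal to 1. Their denominators are then prime to p,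
    and clearing them gives a combination with integral coefficients, one of which
    is prime to p; by independence its absolute value exceeds 1 / p. *)
Lemma residue_basis_bound d (b : 'I_d -> K) (q : 'I_d -> rat) j : indep_mod_p b ->
  v (q j)%:A <= p%:R * v (\sum_i (q i)%:A * b i).
Proof.
move=> [b1 bfree]; have [qj0|qj0] := eqVneq (q j) 0.
  by rewrite qj0 scale0r abs0 // mulr_ge0 ?abs_ge0 // ltW.
have [j0 _ jmax] := @Order.TotalTheory.arg_maxP _ _ 'I_d j xpredT
  (fun i => v (q i)%:A) isT.
apply: le_trans (jmax j isT) _.
have vj0 : 0 < v (q j0)%:A.
  apply: lt_le_trans (jmax j isT); rewrite abs_gt0 //.
  by rewrite (fmorph_eq0 (GRing.in_alg K)).
have qj00 : q j0 != 0 by rewrite -(fmorph_eq0 (GRing.in_alg K)) -(abs_gt0 va).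
pose r i := q i / q j0.
have qE i : (q i)%:A = (q j0)%:A * (r i)%:A :> K.
  by rewrite -(rmorphM (GRing.in_alg K)) /r mulrC divfK.
have r1 i : v (r i)%:A <= 1.
  have : v (q i)%:A <= v (q j0)%:A by exact: jmax.
  by rewrite qE absM // ger_pMr.
under eq_bigr do rewrite qE -mulrA.
rewrite -mulr_sumr absM // mulrCA ler_pMr // mulrC -ler_pdivrMr // mul1r leNgt.
apply/negP => lt.
pose D := \prod_i denq (r i).
have vD : v D%:~R = 1.
  rewrite -[D%:~R]/(intr D) rmorph_prod abs_prod // big1 // => i _.
  exact: rat_den_unit.
pose m i := numq (r i) * \prod_(k | k != i) denq (r k).
have mE i : (m i)%:~R = D%:~R * (r i)%:A :> K.
  transitivity ((numq (r i))%:~R * (\prod_(k | k != i) denq (r k))%:~R : K).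
    exact: intrM.
  have -> : D%:~R = (denq (r i))%:~R * (\prod_(k | k != i) denq (r k))%:~R :> K.
    by rewrite /D (bigD1 i) //= intrM.
  rewrite mulrAC; congr (_ * _).
  have <- : (numq (r i))%:~R = (denq (r i))%:~R * (r i)%:A :> K.
    rewrite -!(rmorph_int (GRing.in_alg K)) -(rmorphM (GRing.in_alg K)).
    by congr (GRing.in_alg K _); rewrite numqE mulrC.
  by [].
have := bfree m; have -> : \sum_i (m i)%:~R * b i = D%:~R * \sum_i (r i)%:A * b i.
  by rewrite mulr_sumr; apply: eq_bigr => i _; rewrite mE mulrA.
rewrite absM // vD mul1r => /(_ (ltW lt) j0) /int_dvd_le.
rewrite mE absM // vD mul1r /r divff // scale1r abs1 // leNgt.
by rewrite invf_lt1 ?ltr1n ?prime_gt1.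
Qed.

(** Successive approximation: the error, divided by p, is approximated again. For an
    x outside the valuation ring a power of p is factored out first. *)
Lemma residue_basis_dense d (b : 'I_d -> K) :
  (forall x, v x <= 1 ->
    exists z : 'I_d -> int, v (x - \sum_i (z i)%:~R * b i) <= p%:R^-1) ->
  forall x e, 0 < e -> exists q : 'I_d -> rat, v (x - \sum_i (q i)%:A * b i) < e.
Proof.
move=> cov; have p_gt1 : 1 < p%:R :> R by rewrite ltr1n prime_gt1.
have vpX l : v (p%:R ^+ l) = p%:R ^- l by rewrite absX // pv exprVn.
have step k x : v x <= 1 ->
    exists q : 'I_d -> rat, v (x - \sum_i (q i)%:A * b i) <= p%:R ^- k.
  elim: k x => [|k IH] x x1.
    exists (fun=> 0); rewrite big1 ?subr0 ?expr0 ?invr1 // => i _.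
    by rewrite scale0r mul0r.
  have [z zx] := cov x x1; set y := x - _ in zx.
  have [|q qy] := IH (y / p%:R).
    by rewrite absM // absV // pv invrK -ler_pdivlMr // mul1r.
  exists (fun i => (z i)%:~R + p%:R * q i).
  have -> : x - \sum_i ((z i)%:~R + p%:R * q i)%:A * b i =
      p%:R * (y / p%:R - \sum_i (q i)%:A * b i).
    rewrite mulrBr mulrC divfK // /y mulr_sumr -addrA -opprD -big_split /=.
    congr (_ - _); apply: eq_bigr => i _.
    rewrite scalerDl mulrDl -[X in X%:A]/(intr (z i)).
    congr (_ * _ + _); first exact: (rmorph_int (GRing.in_alg K)).
    rewrite mulrA; congr (_ * _).
    rewrite -[_%:A]/(GRing.in_alg K _) rmorphM /=; congr (_ * _).
    exact: (rmorph_nat (GRing.in_alg K)).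
  by rewrite absM // pv exprS invfM ler_pM2l // invr_gt0.
have pbig (r : R) : exists l, r <= p%:R ^+ l.
  exists (Num.truncn r).+1; apply: ltW; apply: lt_le_trans (truncnS_gt _) _.
  by rewrite -natrX ler_nat ltnW // ltn_expl // prime_gt1.
move=> x e e0; have [l xl] := pbig (v x).
have [k ke] := pbig (p%:R ^+ l / e * p%:R).
have pl0 : 0 < p%:R ^+ l :> R by rewrite exprn_gt0.
have plK : p%:R ^+ l != 0 :> K by rewrite expf_neq0.
have [|q qx] := step k (x * p%:R ^+ l).
  by rewrite absM // vpX -ler_pdivlMr ?invr_gt0 // invrK mul1r.
exists (fun i => q i / p%:R ^+ l).
have -> : x - \sum_i (q i / p%:R ^+ l)%:A * b i =
    (x * p%:R ^+ l - \sum_i (q i)%:A * b i) / p%:R ^+ l.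
  rewrite mulrBl mulfK // mulr_suml; congr (_ - _); apply: eq_bigr => i _.
  rewrite mulrAC; congr (_ * _).
  rewrite -[_%:A]/(GRing.in_alg K _) fmorph_div /=; congr (_ / _).
  by rewrite -!natrX; exact: (rmorph_nat (GRing.in_alg K)).
rewrite absM // absV // vpX invrK.
apply: (@le_lt_trans _ _ (p%:R ^- k * p%:R ^+ l)).
  by rewrite ler_pM2r.
rewrite mulrC ltr_pdivrMr ?exprn_gt0 // mulrC -ltr_pdivrMr //.
by apply: lt_le_trans ke; rewrite ltr_pMr // divr_gt0.
Qed.

(** The valuation ring modulo p is counted in two ways: it has p ^ d elements, where d
    is the local degree, and it has #|T| ^ e elements as p generates the same ideal as
    w ^+ e. As v p = 1 / p, the e-th powers of both sides coincide. *)
Lemma nabs_uniformizer : nabs v w = #|T|%:R^-1.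
Proof.
have [w0 w1 wk _] := wu.
have pinv1 : (p%:R^-1 : R) < 1 by rewrite invf_lt1 ?ltr1n ?prime_gt1.
have [e e0 pe] : exists2 e : nat, (0 < e)%N & p%:R^-1 = v w ^+ e.
  have [k kE] := wk _ pK0; rewrite -pv kE; rewrite pv in kE.
  case: k kE => [[|k]|k] kE; last 2 first.
  - by exists k.+1.
  - have : 1 <= p%:R^-1 :> R.
      by rewrite kE NegzE -exprnN -exprVn exprn_ege1 // invf_ge1 // ltW.
    by rewrite leNgt pinv1.
  - by move: pinv1; rewrite kE expr0z ltxx.
have [d [b [bind cov]]] := residue_basis.
have dE : local_degree v = d.
  apply: (local_degree_eq va p0 (b := b)).
    by move=> q j; exact: residue_basis_bound.
  exact: residue_basis_dense.
have [U [g [gU cU]]] := ball_transversal e; rewrite -pe in gU.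
have cardE : (p ^ d = #|T| ^ e)%N.
  rewrite -cU -card_digits; have [b1 _] := bind.
  apply: (transversal_card (f := digit_comb b)) gU.
    by apply: vball_subgroup; rewrite invr_ge0 ltW.
  split.
  - by move=> z; apply: int_comb_le1.
  - move=> x x1; have [z zx] := cov x x1.
    pose dg : {ffun 'I_d -> 'I_p.-1.+1} := [ffun i => inord `|(z i %% p)%Z|%N].
    have dgE i : (dg i)%:Z = (z i %% p)%Z.
      have pz : (p : int) != 0 by rewrite eqz_nat gtn_eqF ?prime_gt0.
      rewrite ffunE inordK ?gez0_abs ?modz_ge0 //.
      rewrite prednK ?prime_gt0 // -ltz_nat gez0_abs ?modz_ge0 // ltz_pmod //.
      by rewrite ltz_nat prime_gt0.
    exists dg.
    have sE : x - digit_comb b dg =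
        (x - \sum_i (z i)%:~R * b i) + p%:R * \sum_i ((z i %/ p)%Z)%:~R * b i.
      rewrite mulr_sumr -addrA; congr (_ + _).
      rewrite addrC -sumrB /digit_comb -sumrN; apply: eq_bigr => i _.
      rewrite dgE mulrA -mulrBl -mulNr; congr (_ * _).
      rewrite -[p%:R]/(p%:~R) -intrM -intrB -intrN; congr (_%:~R).
      have := divz_eq (z i) p; move: (_ %/ _)%Z (_ %% _)%Z => a c ->; ring.
    rewrite /vball /= sE; apply: ultrametric_le => //.
    rewrite absM // pv ler_piMr ?invr_ge0 ?(ltW p0) //.
    exact: int_comb_le1.
  - by move=> z z'; exact: digit_comb_inj.
rewrite /nabs dE; apply/eqP; rewrite -(@eqrXn2 _ e) ?invr_ge0 ?exprn_ge0 ?ler0n ?abs_ge0 //.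
by rewrite -exprM mulnC exprM -pe !exprVn -!natrX cardE.
Qed.

End FiniteLocalDegree.

(** * The norm of an ideal as a product over the finite places *)

Section IdealNorm.
Variables (R : realType) (K : fieldExtType rat).
Local Notation OK := (@ring_of_integers K).
Local Notation place := (K -> R).
Implicit Types (u v : place) (s : seq place).

(** The ideals of these places contain x, so they are determined by subsets of the
    finite quotient O / (x). *)
Lemma finite_places_dividing (x : K) : OK x -> x != 0 ->
  exists2 s, uniq s & forall v, v \in s <-> fin_place v /\ v x < 1.
Proof.
move=> xO x0; pose A : set place := [set v | fin_place v /\ v x < 1].
have [k [f [fO covf _]]] := ideal_transversal R (nonzero_principal xO x0).
pose code v := [set t : 'I_k | `[< place_ideal v (f t) >]]%SET.
have code_inj u v : A u -> A v -> code u = code v -> u = v.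
  move=> Au Av cuv; apply: fin_place_inj; [by case: Au|by case: Av|].
  have sub u' v' : A u' -> A v' -> code u' = code v' -> place_ideal u' `<=` place_ideal v'.
    move=> [[ua up] ux] [[va vp] vx] cE y [yO uy].
    have [t [z zO tE]] := covf y yO.
    have ideal_xz w : fin_place w -> w x < 1 -> w (x * z) < 1.
      move=> [wa wp] wx; rewrite absM //.
      by rewrite (le_lt_trans _ wx) // ler_piMr ?abs_ge0 // fin_OK_le1.
    have : t \in code u'.
      rewrite inE; apply/asboolP; split => //.
      have -> : f t = y - x * z by rewrite tE; ring.
      by apply: ultrametric_ltB => //; exact: ideal_xz.
    rewrite cE inE => /asboolP[_ vt]; split => //.
    have -> : y = f t + x * z by rewrite tE; ring.
    by apply: ultrametric_lt => //; exact: ideal_xz.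
  by apply/seteqP; split; apply: sub.
have finA : finite_set A.
  pose g S : place := xget (fun=> 0) [set v | A v /\ code v = S].
  apply: (@sub_finite_set _ _ [set g S | S in setT]); last first.
    exact/finite_image/finite_finset.
  move=> v Av; exists (code v) => //; rewrite /g.
  by case: xgetP => [u _ [Au cu]|/(_ v)[]//]; apply: code_inj.
exists (fset_set A); first exact: fset_uniq.
by move=> v; rewrite in_fset_set // inE.
Qed.

Lemma max_ideal_sub (p q : set K) : max_ideal p -> max_ideal q -> p `<=` q -> p = q.
Proof.
move=> [[pi _] _ pinv] [[qi _] q1 _] pq; have [qO _ _ qM] := qi.
have sq := ideal_subgroup qi.
apply/seteqP; split => // x qx; apply: contrapT => px; apply: q1.
have [y yO pxy] := pinv x (qO _ qx) px.
have -> : 1 = (1 - x * y) + y * x by ring.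
by apply: subgroupD => //; [exact: pq|exact: qM].
Qed.

(* y v has the largest absolute value at v among the elements of a: it generates a
   locally at v. *)
Variables (a : set K) (y : place -> K).
Hypothesis an : nonzero_ideal a.
Hypothesis ya : forall v, fin_place v -> a (y v) /\ forall x, a x -> v x <= v (y v).

Let aO : a `<=` OK. Proof. by have [[]] := an. Qed.
Let aM c x : OK c -> a x -> a (c * x). Proof. by have [[_ _ _ H] _] := an; exact: H. Qed.

Lemma level_le1 v : fin_place v -> v (y v) <= 1.
Proof. by move=> vf; have [va vp] := vf; apply: fin_OK_le1 => //; apply: aO; case: (ya vf). Qed.

Lemma level_gt0 v : fin_place v -> 0 < v (y v).
Proof.
move=> vf; have [va _] := vf; have [_ [x ax x0]] := an.
by apply: (lt_le_trans _ ((ya vf).2 _ ax)); rewrite abs_gt0.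
Qed.

Lemma level_neq0 v : fin_place v -> y v != 0.
Proof. by move=> vf; have [va _] := vf; rewrite -(abs_gt0 va) level_gt0. Qed.

Definition level_ideal s : set K :=
  [set x | OK x /\ forall v, v \in s -> v x <= v (y v)].

Lemma level_idealP s : (forall v, v \in s -> fin_place v) -> is_ideal (level_ideal s).
Proof.
move=> sf; split=> [x []//||x z [xO xs] [zO zs]|c x cO [xO xs]].
- split; first exact: OK0.
  by move=> v vs; have [va _] := sf _ vs; rewrite abs0 // abs_ge0.
- split=> [|v vs]; first exact: OK_add.
  by have [va vp] := sf _ vs; apply: ultrametric_le => //; [exact: xs|exact: zs].
- split=> [|v vs]; first exact: OK_mul.
  have [va vp] := sf _ vs; apply: le_trans (xs _ vs).
  by rewrite absM // ler_piMl ?abs_ge0 // fin_OK_le1.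
Qed.

(** For each place in s some power of an element of its ideal outside that of v
    qualifies; the product of these elements is taken. *)
Lemma level_ideal_unit s v : (forall u, u \in s -> fin_place u) ->
  fin_place v -> v \notin s -> exists2 x, level_ideal s x & v x = 1.
Proof.
move=> sf vf vs; have [va vp] := vf.
have /choice[e eP] u : exists e, u \in s -> [/\ OK e, v e = 1 & u e <= u (y u)].
  have [us|nus] := boolP (u \in s); last by exists 0.
  have uf := sf _ us; have [ua up] := uf.
  have [x [xO ux] nx] : exists2 x, place_ideal u x & ~ place_ideal v x.
    apply: contrapT => /forall2NP H; move: vs; rewrite -(_ : u = v) ?us //.
    apply: fin_place_inj => //; apply: max_ideal_sub.
    - exact: place_ideal_max.
    - exact: place_ideal_max.
    - by move=> x ux; apply: contrapT => nx; case: (H x).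
  have vx : v x = 1 by apply/(notin_place_ideal va vp).
  have [k xk] : exists k, u x ^+ k <= u (y u).
    apply: contrapT => /forallNP H.
    have : 1 <= u x.
      apply: (@le_of_powers _ (u (y u))^-1); rewrite ?abs_ge0 ?ler01 // => i.
      have := H i => /negP; rewrite -ltNge => /ltW h.
      rewrite expr1n -mulrA ler_pdivlMl ?level_gt0 // mulr1.
      by rewrite (le_trans h) // ler_peMl ?exprn_ge0 ?abs_ge0 // ler1n.
    by rewrite leNgt ux.
  exists (x ^+ k) => _; split; first exact: OK_exp.
    by rewrite absX // vx expr1n.
  by rewrite absX.
exists (\prod_(u <- s) e u).
  split=> [|u us].
    by rewrite big_seq; apply: OK_prod => u us; case: (eP u us).
  have [ua up] := sf _ us; have [_ _ ue] := eP u us.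
  rewrite (big_rem u) //= absM //; apply: le_trans ue.
  rewrite ler_piMr ?abs_ge0 // fin_OK_le1 // big_seq; apply: OK_prod => u' u's.
  by case: (eP u' (mem_rem u's)).
rewrite abs_prod // big_seq big1 // => u us; by case: (eP u us).
Qed.

(** The multiplier b has the absolute value of w ^+ i at v and belongs to the level
    ideal; it identifies O modulo the ideal of v with the quotient of the two ideals.
    It comes from an element of value 1 at v that satisfies the conditions of s. *)
Lemma level_transversal s v (w : K) (T : finType) (f : T -> K) i :
  (forall u, u \in s -> fin_place u) -> fin_place v -> v \notin s ->
  is_uniformizer v w -> transversal OK (place_ideal v) f ->
  exists b, transversal [set x | level_ideal s x /\ v x <= v w ^+ i]
    [set x | level_ideal s x /\ v x <= v w ^+ i.+1] (fun t => b * f t).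
Proof.
move=> sf vf vs wu [fO covf injf]; have [va vp] := vf; have [w0 w1 _ wO] := wu.
have [_ _ sD sM] := level_idealP sf; have ssub := ideal_subgroup (level_idealP sf).
have [e es ve] := level_ideal_unit sf vf vs.
have wi0 : 0 < v w ^+ i by rewrite exprn_gt0.
have [z [zO vz]] : exists z, OK z /\ v z = v w ^+ i.
  have [|z [t [zO tO vt E]]] := wO (w ^+ i).
    by rewrite absX // exprn_ile1 // ltW.
  by exists z; split => //; rewrite -absX // E absM // absV // vt invr1 mulr1.
have eO : OK e by case: es.
pose b := z * e; have vb : v b = v w ^+ i by rewrite absM // vz ve mulr1.
have bs : level_ideal s b by exact: sM.
have bfs t : level_ideal s (b * f t) by rewrite mulrC; apply: sM.
have b0 : b != 0 by rewrite -(abs_gt0 va) vb.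
exists b; split=> [t|x [xs vx]|t t' [_]].
- split => //; rewrite absM // vb ler_piMr ?(ltW wi0) //.
  exact: fin_OK_le1.
- have : v (x / b) <= 1 by rewrite absM // absV // vb ler_pdivrMr // mul1r.
  move=> /wO[c [t [cO tO vt xE]]].
  have [_ _ inv] := place_ideal_max va vp.
  have [|r rO [_ r1]] := inv t tO; first by case=> _; rewrite vt ltxx.
  have [l [_ l1]] := covf (c * r) (OK_mul cO rO).
  exists l; split; first exact: ssub.2.
  have t0 : t != 0 by rewrite -(abs_gt0 va) vt.
  have -> : x - b * f l = b * ((c / t) * (1 - t * r) + (c * r - f l)).
    have -> : x = b * (c / t) by rewrite -xE mulrC divfK.
    by rewrite -mulrBr; congr (b * _); field.
  rewrite absM // vb exprSr ler_pM2l //; apply: (uniformizer_discrete vf wu).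
  apply: ultrametric_lt => //; rewrite absM // absM // absV // vt invr1 mulr1.
  by rewrite (le_lt_trans _ r1) // ler_piMl ?abs_ge0 // fin_OK_le1.
- rewrite -mulrBr absM // vb exprSr ler_pM2l // => tt'.
  apply: injf; split; first exact: OK_sub.
  exact: le_lt_trans tt' w1.
Qed.

(** The places are added one at a time, and the condition at v is tightened one power
    of a uniformizer w at a time, from v x <= 1 to v x <= v (y v); each step multiplies
    the number of classes by the size of the residue field, the inverse of nabs v w. *)
Lemma level_ideal_card s : uniq s -> (forall v, v \in s -> fin_place v) ->
  exists (T : finType) (f : T -> K), transversal OK (level_ideal s) f /\
    (#|T|%:R)^-1 = \prod_(v <- s) nabs v (y v).
Proof.
elim: s => [_ _|v s IH /= /andP[vs us] sf].
  exists unit, (fun=> 0); rewrite big_nil card_unit invr1; split => //.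
  split=> [_|x xO|[] []//]; first exact: OK0.
  by exists tt; rewrite subr0.
have sf' u : u \in s -> fin_place u by move=> us'; apply: sf; rewrite inE us' orbT.
have vf : fin_place v by apply: sf; rewrite inE eqxx.
have [va vp] := vf.
have [T [f [fs cT]]] := IH us sf'.
have [w wu] := fin_place_structure vf; have [w0 w1 wk _] := wu.
have [pn _ _] := place_ideal_max va vp.
have [q [g gq]] := ideal_transversal R pn.
have [p pp pv] := fin_prime vp.
have nw := nabs_uniformizer vf wu gq pp pv.
have [k kE] : exists k : nat, v (y v) = v w ^+ k.
  have [[k|k] kE] := wk _ (level_neq0 vf); first by exists k.
  have : 1 < v (y v).
    rewrite kE NegzE -exprnN -exprVn exprn_egt1 // invf_gt1 //.
  by rewrite ltNge level_le1.
have A i : exists (U : finType) (h : U -> K),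
    transversal OK [set x | level_ideal s x /\ v x <= v w ^+ i] h /\
    #|U| = (#|T| * q ^ i)%N.
  elim: i => [|i [U [h [hU cU]]]].
    exists T, f; split; last by rewrite muln1.
    suff -> : [set x | level_ideal s x /\ v x <= v w ^+ 0] = level_ideal s by [].
    apply/seteqP; split=> [x []//|x xs]; split => //.
    by have [xO _] := xs; rewrite expr0 fin_OK_le1.
  have [b bP] := level_transversal i sf' vf vs wu gq.
  exists (U * 'I_q)%type, (fun t => h t.1 + b * g t.2); split; last first.
    by rewrite card_prod cU card_ord expnSr mulnA.
  have sl := ideal_subgroup (level_idealP sf').
  apply: transversal_trans hU bP; first exact: subgroup_OK.
  - split=> [|x z [xs xi] [zs zi]]; split.
    + exact: sl.1.
    + by rewrite abs0 // exprn_ge0 // ltW.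
    + exact: sl.2.
    + exact: ultrametric_leB.
  - by move=> x [[]].
  - move=> x [xs xi]; split => //; apply: le_trans xi _.
    by rewrite exprS ler_piMl ?exprn_ge0 // ltW.
have [U [h [hU cU]]] := A k.
exists U, h; split.
  suff -> : level_ideal (v :: s) = [set x | level_ideal s x /\ v x <= v w ^+ k] by [].
  apply/seteqP; split=> [x [xO xs]|x [[xO xs] xk]].
    split; last by rewrite -kE; apply: xs; rewrite inE eqxx.
    by split => // u us'; apply: xs; rewrite inE us' orbT.
  split => // u; rewrite inE => /orP[/eqP ->|]; last exact: xs.
  by rewrite kE.
rewrite big_cons -cT cU natrM invfM mulrC; congr (_ * _).
rewrite /nabs kE -exprM mulnC exprM -/(nabs v w) nw card_ord natrX.
by rewrite exprVn.
Qed.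

(** An ideal is determined by its local levels: if x had small enough absolute
    values without lying in a, the ideal of the c with c x in a would be contained
    in a maximal ideal, against the comparison of x with y v at that place. *)
Lemma level_ideal_eq s : (forall v, v \in s <-> fin_place v /\ v (y v) < 1) ->
  level_ideal s = a.
Proof.
move=> sP; apply/seteqP; split=> [x [xO xs]|x ax]; last first.
  split=> [|v vs]; first exact: aO.
  by have [vf _] := (sP v).1 vs; apply: (ya vf).2.
apply: contrapT => nax.
have [[ai0 a0 aD _] [b ab b0]] := an.
pose J : set K := [set c | OK c /\ a (c * x)].
have Jn : nonzero_ideal J.
  split; last by exists b => //; split; [exact: aO|rewrite mulrC; exact: aM].
  split=> [c []//||c d [cO ac] [dO ad]|c d cO [dO ad]].
  - by split; [exact: OK0|rewrite mul0r].
  - by split; [exact: OK_add|rewrite mulrDl; exact: aD].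
  - by split; [exact: OK_mul|rewrite -mulrA; exact: aM].
have [|p pm Jp] := max_ideal_exists R Jn; first by case=> _; rewrite mul1r.
have [v vf vpE] := fin_place_exists R pm; have [va vp] := vf.
have [w [_ _ _ wO]] := fin_place_structure vf.
have vxy : v x <= v (y v).
  have [vs|vs] := boolP (v \in s); first exact: xs.
  have -> : v (y v) = 1.
    apply/eqP; rewrite eq_le level_le1 //= leNgt; apply: contra vs => vy.
    exact/sP.
  exact: fin_OK_le1.
have [|c [t [cO tO vt E]]] := wO (x / y v).
  by rewrite absM // absV // ler_pdivrMr ?level_gt0 // mul1r.
have : J t.
  split => //; have -> : t * x = c * y v.
    rewrite -[x](divfK (level_neq0 vf)) E.
    have t0 : t != 0 by rewrite -(abs_gt0 va) vt.
    by rewrite mulrA; congr (_ * _); rewrite mulrC divfK.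
  by apply: aM => //; case: (ya vf).
by move/Jp; rewrite -vpE => -[_]; rewrite vt ltxx.
Qed.

(** The list s may contain places where y v has absolute value 1: they contribute a
    factor 1, and this allows one list to serve for several ideals. *)
Lemma ideal_norm_prod s : uniq s -> (forall v, v \in s -> fin_place v) ->
  (forall v, fin_place v -> v (y v) < 1 -> v \in s) ->
  \prod_(v <- s) nabs v (y v) = (ideal_norm a)%:R^-1.
Proof.
move=> us sf sP; pose s' := [seq v <- s | v (y v) < 1].
have s'P v : v \in s' <-> fin_place v /\ v (y v) < 1.
  rewrite mem_filter; split=> [/andP[vy /sf vf]//|[vf vy]].
  by rewrite vy /=; exact: sP.
have [|v /s'P[]//|T [f [ft cT]]] := @level_ideal_card s'; first exact: filter_uniq.
have asub := ideal_subgroup an.1.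
rewrite level_ideal_eq // in ft.
rewrite (ideal_norm_transversal asub ft) cT.
rewrite big_filter [RHS]big_mkcond big_seq [RHS]big_seq; apply: eq_bigr => v vs.
case: ifPn => //; rewrite -leNgt => vy.
have vf := sf _ vs; have -> : nabs v (y v) = 1 ^+ local_degree v.
  by congr (_ ^+ _); apply/eqP; rewrite eq_le vy level_le1.
by rewrite expr1n.
Qed.

End IdealNorm.

(** * The norm of a principal ideal *)

Section PrincipalNorm.
Variables (R : realType) (K : fieldExtType rat).
Notation n := (\dim {:K}).
Local Notation OK := (@ring_of_integers K).

Lemma absz_det_unit m (A : 'M[int]_m) : A \in unitmx -> `|\det A|%N = 1%N.
Proof.
move=> Au; have := congr1 (fun B => `|\det B|%N) (mulmxV Au).
by rewrite /= det_mulmx det1 abszM => /eqP; rewrite muln_eq1 => /andP[/eqP].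
Qed.

(** In Z-bases of O adapted to multiplication by x its matrix is diagonal, and
    O/(x) is a product of cyclic groups whose orders are the diagonal entries. *)
Lemma ideal_norm_principal (x : K) : OK x -> x != 0 ->
  (ideal_norm (principal x))%:R = `|field_norm x|.
Proof.
move=> xO x0; have [w [wb wO spO]] := OK_zbasis R K.
have [A xE NE] := mul_matrix wb wO spO xO.
have [L Lu [Q Qu [d _ AE]]] := int_Smith_normal_form A.
pose dd (i : 'I_n) : int := d`_i.
pose e (c : 'rV[int]_n) : K := \sum_i (c 0 i)%:~R * w i.
pose w' i : K := \sum_j (Q i j)%:~R * w j.
pose e' (c : 'rV[int]_n) : K := \sum_i (c 0 i)%:~R * w' i.
have e'E c : e' c = e (c *m Q).
  rewrite /e' /e; under eq_bigr do rewrite mulr_sumr.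
  rewrite exchange_big /=; apply: eq_bigr => j _; rewrite mxE rmorph_sum /= mulr_suml.
  by apply: eq_bigr => i _; rewrite rmorphM mulrA.
have eO c : OK (e c) by apply: OK_sum => i _; apply: OK_mul => //; exact: OK_int.
have e'O c : OK (e' c) by rewrite e'E.
have e'span y : OK y -> exists c, y = e' c.
  move=> /spO[z yE]; exists (\row_i z i *m invmx Q); rewrite e'E mulmxKV //.
  by rewrite yE; apply: eq_bigr => i _; rewrite mxE.
have e'inj c : e' c = 0 -> c = 0.
  rewrite e'E => /(zspan_free wb) cQ0; apply: (can_inj (mulmxK Qu)).
  by rewrite mul0mx; apply/rowP => i; rewrite cQ0 mxE.
have e'B c c' : e' (c - c') = e' c - e' c'.
  by rewrite /e' -sumrB; apply: eq_bigr => i _; rewrite !mxE rmorphB mulrBl.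
have xe c : x * e c = e (c *m A).
  rewrite /e mulr_sumr; under eq_bigr do rewrite mulrCA xE mulr_sumr.
  rewrite exchange_big /=; apply: eq_bigr => j _; rewrite mxE rmorph_sum /= mulr_suml.
  by apply: eq_bigr => i _; rewrite rmorphM mulrA.
pose D : 'M[int]_n := \matrix_(i, j) (d`_i *+ (i == j :> nat)).
have DE (t : 'rV[int]_n) i : (t *m D) 0 i = t 0 i * d`_i.
  rewrite mxE (bigD1 i) //= big1 ?addr0 => [|j ji]; first by rewrite mxE eqxx.
  by rewrite mxE (_ : (j == i :> nat) = false) ?mulr0 //; exact: negbTE.
have princE y : principal x y <-> exists t, y = e' (t *m D).
  split=> [[z zO <-]|[t ->]].
    have [c ->] := e'span z zO; exists (c *m Q *m L).
    by rewrite !e'E xe AE !mulmxA.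
  exists (e (t *m invmx L)) => //.
  by rewrite xe AE !mulmxA mulmxKV // e'E.
have detA : `|\det A|%N = (\prod_(i < n) `|dd i|)%N.
  rewrite AE !det_mulmx !abszM (absz_det_unit Lu) (absz_det_unit Qu) mul1n muln1.
  have -> : \matrix_(i, j) (d`_i *+ (i == j :> nat)) = diag_mx (\row_(i < n) dd i).
    apply/matrixP => i j; rewrite !mxE.
    by congr (_ *+ nat_of_bool _); rewrite -val_eqE.
  rewrite det_diag (big_morph _ abszM (erefl : `|1%Z|%N = 1%N)).
  by apply: eq_bigr => i _; rewrite mxE.
have d0 (i : 'I_n) : dd i != 0.
  have : field_norm x != 0 by rewrite (field_norm_eq0 R).
  rewrite NE intr_eq0 -absz_eq0 detA (bigD1 i) //= muln_eq0 negb_or absz_eq0.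
  by case/andP.
have dgt i : (0 < `|dd i|)%N by rewrite absz_gt0.
have trv : transversal OK (principal x)
    (fun z : {dffun forall i : 'I_n, 'I_`|dd i|} => e' (\row_i (z i)%:Z)).
  split=> [z|y yO|z z'].
  - exact: e'O.
  - have [c ->] := e'span y yO.
    have lt i : (`|(c 0%R i %% dd i)%Z| < `|dd i|)%N.
      by rewrite -ltz_nat gez0_abs ?modz_ge0 // ltz_mod.
    exists [ffun i => Ordinal (lt i)]; rewrite -e'B; apply/princE.
    exists (\row_i (c 0%R i %/ dd i)%Z); congr e'; apply/rowP => i.
    rewrite DE !mxE ffunE /= gez0_abs ?modz_ge0 //.
    by rewrite {1}(divz_eq (c 0 i) (dd i)) addrK.
  - rewrite -e'B => /princE[t tE].
    have /e'inj/rowP E : e' (\row_i (z i)%:Z - \row_i (z' i)%:Z - t *m D) = 0.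
      by rewrite e'B tE subrr.
    apply/ffunP => i; apply/val_inj => /=.
    have := E i; rewrite 2!mxE [(- (t *m D)) 0 i]mxE DE !mxE => /subr0_eq zz.
    have : (dd i %| (z i)%:Z - (z' i)%:Z)%Z by apply/dvdzP; exists (t 0 i).
    rewrite -eqz_mod_dvd => /eqP.
    rewrite -modz_abs -[in RHS]modz_abs.
    by rewrite !modz_small ?ltz_nat ?ltn_ord // => -[].
rewrite (ideal_norm_transversal (ideal_subgroup (principal_ideal xO)) trv).
rewrite card_dep_ffun NE -intr_norm -natr_absz natr_absz.
rewrite -abszE detA; congr (_%:R).
by rewrite foldrE big_map big_enum; apply: eq_bigr => i _; rewrite card_ord.
Qed.

End PrincipalNorm.

(** * The archimedean places *)

Section ComplexModulus.
Variable R : realType.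
Local Notation C := (R[i]).
Local Notation normc := (@Normc.normc R).
Local Notation toC := (real_complex R).
Implicit Types x y z : C.

Lemma normc_ge0 z : 0 <= normc z.
Proof. by case: z => a b; exact: sqrtr_ge0. Qed.

Lemma normc_leD x y : normc (x + y) <= normc x + normc y.
Proof. exact: le_normcD. Qed.

Lemma normc_opp x : normc (- x) = normc x. Proof. exact: normcN. Qed.

Lemma normc_le_sum (I : Type) (r : seq I) (P : pred I) (F : I -> C) :
  normc (\sum_(i <- r | P i) F i) <= \sum_(i <- r | P i) normc (F i).
Proof.
elim/big_ind2: _ => [|x a y b xa yb|//]; first by rewrite Normc.normc0.
exact: le_trans (normc_leD _ _) (lerD xa yb).
Qed.

Lemma normc_prod (I : Type) (r : seq I) (P : pred I) (F : I -> C) :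
  normc (\prod_(i <- r | P i) F i) = \prod_(i <- r | P i) normc (F i).
Proof.
by elim/big_ind2: _ => [|x a y b <- <-|//]; rewrite ?Normc.normc1 ?Normc.normcM.
Qed.

Lemma normc_real (a : R) : normc (toC a) = `|a|.
Proof. by rewrite /real_complex_def /= expr0n /= addr0 sqrtr_sqr. Qed.

Lemma normc_conj z : normc (conjc z) = normc z.
Proof. by case: z => a b /=; rewrite sqrrN. Qed.

Lemma normc_geRe z : `|complex.Re z| <= normc z.
Proof. by case: z => a b /=; rewrite -sqrtr_sqr ler_wsqrtr // lerDl sqr_ge0. Qed.

Lemma normc_geIm z : `|complex.Im z| <= normc z.
Proof. by case: z => a b /=; rewrite -sqrtr_sqr ler_wsqrtr // lerDr sqr_ge0. Qed.

Lemma normc_leReIm z : normc z <= `|complex.Re z| + `|complex.Im z|.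
Proof.
case: z => a b /=.
apply: (@le_trans _ _ (Num.sqrt ((`|a| + `|b|) ^+ 2))); last first.
  by rewrite sqrtr_sqr ger0_norm // addr_ge0.
rewrite ler_wsqrtr // sqrrD !real_normK ?num_real // addrAC lerDl.
by rewrite mulrn_wge0 // mulr_ge0.
Qed.

Lemma normc_leBD x y : normc y <= normc (x - y) + normc x.
Proof.
have {1}-> : y = - (x - y) + x by rewrite opprB subrK.
by apply: le_trans (normc_leD _ _) _; rewrite normc_opp.
Qed.

Lemma ratr_complex (q : rat) : ratr q = (toC (ratr q : R)) :> C.
Proof. by rewrite -(fmorph_eq_rat (real_complex R \o ratr)). Qed.

Lemma normc_ratr (q : rat) : normc (ratr q) = `|ratr q|.
Proof. by rewrite ratr_complex normc_real. Qed.

Lemma rat_approx (x e : R) : 0 < e -> exists q : rat, `|x - ratr q| < e.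
Proof.
move=> e0; have [|q] := @rat_in_itvoo R (x - e) x; first by rewrite gtrBl.
rewrite in_itv /= => /andP[lo hi]; exists q.
by rewrite gtr0_norm ?subr_gt0 // ltrBlDr -ltrBlDl.
Qed.

End ComplexModulus.

Section ArchimedeanPlaces.
Variables (R : realType) (K : fieldExtType rat).
Notation n := (\dim {:K}).
Local Notation C := (R[i]).
Local Notation normc := (@Normc.normc R).
Local Notation toC := (real_complex R).
Local Notation emb := (@emb R K).

Definition emb_abs (j : 'I_n) (x : K) : R := normc (emb j x).

Lemma emb_inj i j : emb i =1 emb j -> i = j.
Proof. by move=> e; apply: (@emb_primitive_inj R K); exact: e. Qed.

Lemma emb_conj_exists : exists bar : 'I_n -> 'I_n,
  forall j x, emb (bar j) x = conjc (emb j x).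
Proof.
have /choice[bar barP] (j : 'I_n) : exists k, conjc \o emb j =1 emb k.
  exact: (emb_surj (conjc \o emb j)).
by exists bar => j x; rewrite -barP.
Qed.

Definition emb_bar : 'I_n -> 'I_n := sval (cid emb_conj_exists).

Lemma emb_barE j x : emb (emb_bar j) x = conjc (emb j x).
Proof. exact: (svalP (cid emb_conj_exists)). Qed.

Lemma emb_barK : involutive emb_bar.
Proof. by move=> j; apply: emb_inj => x; rewrite !emb_barE conjcK. Qed.

Lemma emb_abs_bar j : emb_abs (emb_bar j) = emb_abs j.
Proof. by apply/funext => x; rewrite /emb_abs emb_barE normc_conj. Qed.

Lemma emb_abs_abs j : absolute_value (emb_abs j).
Proof.
split=> [x|x|x y|x y]; rewrite /emb_abs.
- exact: normc_ge0.
- split=> [/Normc.eq0_normc/eqP|->]; last by rewrite rmorph0 Normc.normc0.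
  by rewrite fmorph_eq0 => /eqP.
- by rewrite rmorphM Normc.normcM.
- by rewrite rmorphD normc_leD.
Qed.

Lemma emb_abs_arch j : archimedean (emb_abs j).
Proof. by move=> q; rewrite /emb_abs emb_rat normc_ratr. Qed.

Lemma emb_abs_nat j m : emb_abs j m%:R = m%:R.
Proof. by have := emb_abs_arch j m%:R; rewrite scaler_nat ratr_nat normr_nat. Qed.

Definition emb_max (x : K) : R := \big[Num.max/0]_j emb_abs j x.

Lemma emb_abs_le_max j x : emb_abs j x <= emb_max x.
Proof. exact: le_bigmax. Qed.

Lemma emb_max_ge0 x : 0 <= emb_max x. Proof. exact: bigmax_ge_id. Qed.

Lemma emb_max_le x r : 0 <= r -> (forall j, emb_abs j x <= r) -> emb_max x <= r.
Proof. by move=> r0 xr; apply/bigmax_leP; split. Qed.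

(** The coordinates of x are linear in the emb j x, so the two sides differ by a
    constant at most; applied to powers of x this constant disappears. *)
Lemma arch_le_emb_max (v : K -> R) x : absolute_value v -> archimedean v ->
  v x <= emb_max x.
Proof.
move=> va vQ; pose w i := (vbasis {:K})`_i : K.
have wb : is_qbasis R w by exact: vbasis_qbasis.
pose V := emb_mx R w; pose D := \sum_i \sum_k normc (invmx V k i) * v (w i).
have D0 : 0 <= D.
  by do 2 (apply: sumr_ge0 => ? _); rewrite mulr_ge0 ?normc_ge0 ?abs_ge0.
have bound y : v y <= D * emb_max y.
  have [q qE] := qbasis_span wb y.
  have qV i : ratr (q i) = \sum_k emb k y * invmx V k i.
    have : map_mx ratr (\row_i q i) *m V = \row_k emb k y.
      apply/rowP => k; rewrite !mxE qE rmorph_sum; apply: eq_bigr => l _.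
      by rewrite !mxE embZ.
    move/(congr1 (fun M => (M *m invmx V) 0 i)).
    rewrite mulmxK ?unitmxE ?unitfE // !mxE => ->.
    by apply: eq_bigr => k _; rewrite !mxE.
  rewrite [in v y]qE (le_trans (le_abs_sum va _ _ _)) // /D mulr_suml.
  apply: ler_sum => i _.
  have -> : v (q i *: w i) = normc (ratr (q i)) * v (w i).
    by rewrite -mulr_algl absM // vQ normc_ratr.
  rewrite -mulr_suml mulrAC; apply: ler_wpM2r; first exact: abs_ge0.
  rewrite qV (le_trans (normc_le_sum _ _ _)) // mulr_suml; apply: ler_sum => k _.
  by rewrite Normc.normcM mulrC ler_wpM2l ?normc_ge0 // emb_abs_le_max.
apply: (@le_of_powers _ D) => [||i]; [exact: abs_ge0|exact: emb_max_ge0|].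
rewrite -absX // (le_trans (bound _)) // -mulrA; apply: ler_wpM2l => //.
apply: (@le_trans _ _ (emb_max x ^+ i)); last first.
  by rewrite ler_peMl ?ler1n // exprn_ge0 // emb_max_ge0.
apply: emb_max_le => [|j]; first by rewrite exprn_ge0 // emb_max_ge0.
rewrite (absX (emb_abs_abs j)) lerXn2r ?nnegrE ?emb_max_ge0 ?emb_abs_le_max //.
exact: normc_ge0.
Qed.

(** Weights of the idempotents of the algebra K (x) R: half of them at an
    embedding and half at its conjugate, so that they sum up to 1 everywhere. *)
Definition emb_weight (j i : 'I_n) : R :=
  ((i == j)%:R + (i == emb_bar j)%:R) / 2.

Lemma emb_weight_sum i : \sum_j emb_weight j i = 1.
Proof.
rewrite -mulr_suml big_split /= (bigD1 i) //= eqxx big1 ?addr0; last first.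
  by move=> j ji; rewrite eq_sym (negPf ji).
rewrite (bigD1 (emb_bar i)) //= emb_barK eqxx big1 ?addr0; last first.
  move=> j ji; rewrite (_ : (i == emb_bar j) = false) //.
  by apply: contra_neqF ji => /eqP ->; rewrite emb_barK.
by rewrite -[1 + _]/(2%:R) divff // pnatr_eq0.
Qed.

Lemma emb_weight_le1 j i : 0 <= emb_weight j i <= 1.
Proof.
rewrite /emb_weight; case: eqP => _; case: eqP => _ /=; lra.
Qed.

Lemma emb_weight_bar j i : emb_weight j (emb_bar i) = emb_weight j i.
Proof.
rewrite /emb_weight addrC (inj_eq (can_inj emb_barK)).
congr ((_ + _%:R) / _); congr nat_of_bool.
by rewrite -(inj_eq (can_inj emb_barK)) emb_barK.
Qed.

(** The linear system that prescribes the conjugates of an element of K (x) R is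
    real, because its right-hand side is invariant under complex conjugation. *)
Lemma emb_weight_approx j (e : R) : 0 < e ->
  exists x : K, forall i, normc (emb i x - (toC (emb_weight j i))) <= e.
Proof.
move=> e0; pose w i := (vbasis {:K})`_i : K.
have wb : is_qbasis R w by exact: vbasis_qbasis.
pose V := emb_mx R w.
have Vu : V \in unitmx by rewrite unitmxE unitfE.
pose c : 'rV[C]_n := \row_i (toC (emb_weight j i)).
pose t := c *m invmx V.
have tV : t *m V = c by rewrite mulmxKV.
have tconj : map_mx conjc t = t.
  apply: (can_inj (mulmxK Vu)); rewrite tV; apply/rowP => k.
  have <- : conjc ((t *m V) 0 (emb_bar k)) = c 0 k.
    by rewrite tV !mxE emb_weight_bar conjc_real.
  rewrite mxE [in RHS]mxE rmorph_sum; apply: eq_bigr => l _.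
  rewrite rmorphM; congr (_ * _); first exact: mxE.
  by rewrite /= !mxE emb_barE conjcK.
have treal l : t 0 l = (toC (complex.Re (t 0 l))).
  have /rowP/(_ l) := tconj; rewrite mxE; case: (t 0 l) => a b [] bE.
  by congr (_ +i* _)%C; move: bE => /eqP; rewrite -subr_eq0 -opprD oppr_eq0
    -mulr2n mulrn_eq0 /= => /eqP.
pose D := 1 + \sum_(l < n) \sum_k normc (emb k (w l)).
have D0 : 0 < D.
  by rewrite ltr_pwDl // sumr_ge0 // => l _; rewrite sumr_ge0 // => k _; exact: normc_ge0.
have /choice[q qP] (l : 'I_n) : exists q : rat,
    `|complex.Re (t 0 l) - ratr q| < e / D by apply: rat_approx; rewrite divr_gt0.
exists (\sum_l q l *: w l) => i.
have -> : emb i (\sum_l q l *: w l) - (toC (emb_weight j i)) =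
    \sum_l - (toC (complex.Re (t 0 l) - ratr (q l))) * emb i (w l).
  have -> : (toC (emb_weight j i)) = \sum_l t 0 l * emb i (w l).
    have /rowP/(_ i) := tV; rewrite !mxE => <-; apply: eq_bigr => l _.
    by rewrite [V l i]mxE.
  rewrite rmorph_sum -sumrB; apply: eq_bigr => l _.
  rewrite embZ -mulrBl; congr (_ * _).
  by rewrite rmorphB opprB /= -treal -ratr_complex.
apply: le_trans (normc_le_sum _ _ _) _.
apply: (@le_trans _ _ (e / D * \sum_(l < n) normc (emb i (w l)))).
  rewrite mulr_sumr; apply: ler_sum => l _.
  rewrite Normc.normcM normc_opp normc_real; apply: ler_wpM2r; first exact: normc_ge0.
  exact: ltW.
rewrite mulrAC ler_pdivrMr // ler_pM2l // /D.
apply: (@le_trans _ _ (\sum_(l < n) \sum_k normc (emb k (w l)))); last by rewrite lerDr.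
apply: ler_sum => l _; rewrite (bigD1 i) //= lerDl sumr_ge0 // => k _.
exact: normc_ge0.
Qed.

(** An element close to the idempotent of j has a small absolute value at i, unless i
    is j or its conjugate. *)
Lemma emb_abs_eq i j : emb_abs i = emb_abs j -> i = j \/ i = emb_bar j.
Proof.
move=> ij; apply: contrapT => /not_orP[/eqP nij /eqP nibj].
have e0 : 0 < 1 / 5 :> R by rewrite divr_gt0.
have [x xP] := emb_weight_approx j e0.
have wi : emb_weight j i = 0.
  by rewrite /emb_weight (negPf nij) (negPf nibj) addr0 mul0r.
have wj : 1 / 2 <= emb_weight j j.
  by rewrite /emb_weight eqxx ler_pM2r ?invr_gt0 // lerDl.
have xi : emb_abs i x <= 1 / 5 by have := xP i; rewrite wi subr0.
have := normc_leBD (emb j x) (toC (emb_weight j j)); rewrite -/(emb_abs j x).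
rewrite normc_real ger0_norm; last by have /andP[] := emb_weight_le1 j j.
rewrite -ij; move: (xP j) wj xi; clear.
move: (emb_weight j j) (emb_abs i x) (normc _) => A B D; lra.
Qed.

Lemma power_separation (a b c : R) : 0 <= b -> b < a -> 0 < c ->
  exists m : nat, b ^+ m <= c * a ^+ m.
Proof.
move=> b0 ba c0; have a0 : 0 < a by exact: le_lt_trans ba.
apply: contrapT => /forallNP H; move: ba; rewrite ltNge => /negP; apply.
apply: (@le_of_powers _ c^-1) => // [|m]; first exact: ltW.
have /negP := H m; rewrite -ltNge => /ltW h.
rewrite -mulrA ler_pdivlMl // (le_trans h) // ler_peMl ?ler1n // exprn_ge0 //.
Qed.

(** If v differed from every emb_abs j, some z j would satisfy
    v (z j) > emb_abs j (z j), by a large factor after raising to a power. As the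
    approximate idempotents y j have sum close to 1, one of them is not small
    for v; but z j * y j is then small at all embeddings and not for v. *)
Lemma arch_place_emb (v : K -> R) : absolute_value v -> archimedean v ->
  exists j, v = emb_abs j.
Proof.
move=> va vQ; apply: contrapT => /forallNP H.
have n0 : (0 < n)%N by rewrite adim_gt0.
have nR : 0 < n%:R :> R by rewrite ltr0n.
have n1 : 1 <= n%:R :> R by rewrite ler1n.
have /choice[z zP] (j : 'I_n) : exists z : K, emb_abs j z < v z.
  apply: contrapT => /forallNP zP; apply: (H j); apply/funext => x.
  have [->|x0] := eqVneq x 0; first by rewrite !abs0 //; exact: emb_abs_abs.
  apply/eqP; rewrite eq_le; apply/andP; split; rewrite leNgt; apply/negP.
    exact: zP.
  move=> lt; apply: (zP x^-1); rewrite !absV //; last exact: emb_abs_abs.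
  by rewrite ltf_pV2 // posrE abs_gt0 //; exact: emb_abs_abs.
have /choice[m mP] (j : 'I_n) : exists m : nat,
    emb_abs j (z j) ^+ m <= (8 * n%:R)^-1 * v (z j) ^+ m.
  apply: power_separation => //; first exact: normc_ge0.
  by rewrite invr_gt0 mulr_gt0.
pose Z j := z j ^+ m j.
have Zj j : emb_abs j (Z j) <= (8 * n%:R)^-1 * v (Z j).
  by rewrite !absX //; exact: emb_abs_abs.
have vZ j : 0 < v (Z j).
  rewrite absX // exprn_gt0 // (le_lt_trans _ (zP j)) //; exact: normc_ge0.
pose S := \sum_j emb_max (Z j) / v (Z j).
have S0 : 0 <= S.
  by apply: sumr_ge0 => j _; rewrite divr_ge0 ?emb_max_ge0 // ltW.
pose e := (8 * n%:R * (1 + S))^-1.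
have e0 : 0 < e by rewrite invr_gt0 !mulr_gt0 // ltr_pwDl.
have e1 : e <= (8 * n%:R)^-1.
  rewrite /e invfM ler_piMr //; first by rewrite invr_ge0 mulr_ge0 // ltW.
  by rewrite invf_le1 ?lerDl // ltr_pwDl.
have n8 : (8 * n%:R)^-1 <= 8^-1 :> R.
  by rewrite lef_pV2 ?posrE ?mulr_gt0 // ler_peMr.
have ne : n%:R * e <= 8^-1.
  rewrite (le_trans (_ : _ <= n%:R * (8 * n%:R)^-1)) ?ler_pM2l //.
  by rewrite invfM mulrCA divff ?mulr1 // gt_eqF.
have /choice[y yP] j := emb_weight_approx j e0.
have sy i : 1 / 2 <= emb_abs i (\sum_j y j).
  have : normc (emb i (\sum_j y j) - 1) <= n%:R * e.
    have -> : emb i (\sum_j y j) - 1 = \sum_j (emb i (y j) - (toC (emb_weight j i))).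
      rewrite sumrB -rmorph_sum; congr (_ - _).
      by rewrite -rmorph_sum emb_weight_sum.
    apply: le_trans (normc_le_sum _ _ _) _.
    rewrite mulr_natl -[X in _ *+ X]card_ord -sumr_const; apply: ler_sum => j _.
    exact: yP.
  move=> h; have := normc_leBD (emb i (\sum_j y j)) 1.
  rewrite -/(emb_abs i (\sum_j y j)).
  rewrite Normc.normc1 => h2; move: h h2 ne; clear.
  move: (normc _) (emb_abs _ _) (n%:R * e) => A B E; lra.
have vsy : 1 / 2 <= v (\sum_j y j).
  have sy0 : \sum_j y j != 0.
    apply: contraTneq (sy (Ordinal n0)) => ->.
    by rewrite abs0 -?ltNge ?divr_gt0 //; exact: emb_abs_abs.
  have := arch_le_emb_max (\sum_j y j)^-1 va vQ; rewrite absV //.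
  have : emb_max (\sum_j y j)^-1 <= 2.
    apply: emb_max_le => // i; rewrite absV; last exact: emb_abs_abs.
    have yi0 : 0 < emb_abs i (\sum_j y j) by apply: lt_le_trans (sy i); rewrite divr_gt0.
    by rewrite -[2]invrK lef_pV2 ?posrE ?invr_gt0 //; have := sy i; rewrite mul1r.
  move=> /[swap] /le_trans /[apply].
  rewrite mul1r -[X in _ -> _ <= X]invrK lef_pV2 // posrE ?invr_gt0 //.
  by rewrite abs_gt0.
have [j vyj] : exists j, (2 * n%:R)^-1 <= v (y j).
  apply: contrapT => /forallNP small.
  have : v (\sum_j y j) < 1 / 2.
    apply: le_lt_trans (le_abs_sum va _ _ _) _.
    have -> : 1 / 2 = \sum_(j < n) (2 * n%:R)^-1 :> R.
      by rewrite sumr_const card_ord -[RHS]mulr_natl mul1r invfM [RHS]mulrCA divff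
        ?mulr1 // gt_eqF.
    apply: ltr_sum => [|j _]; last by rewrite ltNge; apply/negP/small.
    by apply/hasP; exists (Ordinal n0); rewrite // mem_index_enum.
  by rewrite ltNge vsy.
have key : v (Z j * y j) <= (4 * n%:R)^-1 * v (Z j).
  apply: le_trans (arch_le_emb_max _ va vQ) _.
  have vZ4 : 0 <= (4 * n%:R)^-1 * v (Z j) by rewrite mulr_ge0 ?invr_ge0 ?mulr_ge0 // ltW.
  apply: emb_max_le => // i; rewrite absM; last exact: emb_abs_abs.
  have yi : emb_abs i (y j) <= emb_weight j i + e.
    have := yP j i; have /andP[w0 _] := emb_weight_le1 j i.
    have := normc_leD (emb i (y j) - (toC (emb_weight j i))) (toC (emb_weight j i)).
    rewrite subrK normc_real ger0_norm // -/(emb_abs i (y j)) => /le_trans -> //.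
    by rewrite addrC lerD2l.
  have [iE|wi] : emb_abs i = emb_abs j \/ emb_weight j i = 0.
    rewrite /emb_weight; have [->|_] := eqVneq i j; first by left.
    have [->|_] := eqVneq i (emb_bar j); first by left; exact: emb_abs_bar.
    by right; rewrite addr0 mul0r.
    have yi2 : emb_abs i (y j) <= 2.
      apply: le_trans yi _; have /andP[_ w1] := emb_weight_le1 j i.
      rewrite -[2]/(1 + 1); apply: lerD => //; apply: le_trans e1 _.
      by rewrite invf_le1 ?mulr_gt0 // mulr_ege1 // ler1n.
    rewrite iE (_ : (4 * n%:R)^-1 * v (Z j) = (8 * n%:R)^-1 * v (Z j) * 2).
      apply: ler_pM => //; [exact: normc_ge0|exact: normc_ge0|by rewrite -iE].
    have -> : 8 = 4 * 2 :> R by rewrite -natrM.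
    by move: nR; move: (v (Z j)) (n%:R : R) => V N N0; field; rewrite gt_eqF.
  rewrite wi add0r in yi.
  have ZS : emb_abs i (Z j) <= (1 + S) * v (Z j).
    apply: le_trans (emb_abs_le_max i _) _; rewrite -ler_pdivrMr //.
    rewrite /S (bigD1 j) //= addrCA lerDl addr_ge0 // sumr_ge0 // => l _.
    by rewrite divr_ge0 ?emb_max_ge0 // ltW.
  apply: (@le_trans _ _ ((1 + S) * v (Z j) * e)).
    by apply: ler_pM => //; exact: normc_ge0.
  have S10 : 1 + S != 0 by rewrite gt_eqF // ltr_pwDl.
  have -> : (1 + S) * v (Z j) * e = (8 * n%:R)^-1 * v (Z j).
    rewrite /e; move: nR S10; move: (v (Z j)) (1 + S) (n%:R : R) => V T N N0 T0.
    by field; rewrite T0 gt_eqF.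
  rewrite ler_pM2r // lef_pV2 ?posrE ?mulr_gt0 // ler_pM2r //.
  by rewrite ler_nat.
move: key; rewrite absM // mulrC ler_pM2r // => /(le_trans vyj).
by rewrite lef_pV2 ?posrE ?mulr_gt0 // ler_pM2r // ler_nat.
Qed.

End ArchimedeanPlaces.

(** * Archimedean local degrees *)

Section ArchimedeanLocalDegree.
Variables (R : realType) (K : fieldExtType rat).
Notation n := (\dim {:K}).
Local Notation C := (R[i]).
Local Notation normc := (@Normc.normc R).
Local Notation emb := (@emb R K).
Local Notation emb_abs := (@emb_abs R K).
Local Notation emb_bar := (@emb_bar R K).

(** K is contained in the real line, where Q is dense. *)
Lemma local_degree_real j : emb_bar j = j -> local_degree (emb_abs j) = 1%N.
Proof.
move=> jb; apply: (local_degree_eq (emb_abs_abs R j) ltr01 (b := fun=> 1)).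
  by move=> q i; rewrite mul1r big_ord1 mulr1 (ord1 i).
move=> x e e0.
have xr : emb j x = real_complex R (complex.Re (emb j x)).
  have := emb_barE R j x; rewrite jb; case: (emb j x) => a b [] bE.
  congr (_ +i* _)%C; move: bE => /eqP; rewrite -subr_eq0 opprK -mulr2n mulrn_eq0 /=.
  by move/eqP.
have [q qP] := rat_approx (complex.Re (emb j x)) e0.
exists (fun=> q); rewrite big_ord1 mulr1 /emb_abs rmorphB emb_rat xr ratr_complex.
by rewrite -rmorphB normc_real.
Qed.

(** 1 and any element of K whose image is not real form a basis of C over the real
    line, in which Q is dense. *)
Lemma local_degree_complex j : emb_bar j != j -> local_degree (emb_abs j) = 2%N.
Proof.
move=> jb.
have [th thIm] : exists th : K, complex.Im (emb j th) != 0.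
  apply: contrapT => /forallNP H; move/eqP: jb; apply; apply: (@emb_inj R K) => x.
  rewrite emb_barE; have /negP := H x; rewrite negbK.
  by case: (emb j x) => a b /= /eqP ->; rewrite oppr0.
case thE : (emb j th) => [a b]; rewrite thE /= in thIm.
pose bs (i : 'I_2) : K := if i == ord0 then 1 else th.
have sumE (q : 'I_2 -> rat) :
    \sum_i (q i)%:A * bs i = (q ord0)%:A + (q (lift ord0 ord0))%:A * th.
  by rewrite big_ord_recl big_ord1 /bs /= mulr1.
have embE (q : 'I_2 -> rat) : emb j (\sum_i (q i)%:A * bs i) =
    ((ratr (q ord0) + ratr (q (lift ord0 ord0)) * a) +i* (ratr (q (lift ord0 ord0)) * b))%C.
  rewrite sumE rmorphD rmorphM !emb_rat thE !ratr_complex.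
  by apply/eqP; rewrite eq_complex /= !mul0r subr0 addr0 add0r !eqxx.
have b0 : 0 < `|b| by rewrite normr_gt0.
pose M := 1 + (1 + `|a|) / `|b|.
have q_le (q0 q1 : R) : `|q0| <= M * normc ((q0 + q1 * a) +i* (q1 * b))%C /\
    `|q1| <= M * normc ((q0 + q1 * a) +i* (q1 * b))%C.
  set z := (_ +i* _)%C.
  have zr : `|q0 + q1 * a| <= normc z by exact: (normc_geRe z).
  have zi : `|q1| * `|b| <= normc z by rewrite -normrM; exact: (normc_geIm z).
  have q1b : `|q1| <= normc z / `|b| by rewrite ler_pdivlMr.
  have q0b : `|q0| <= normc z + normc z / `|b| * `|a|.
    have -> : q0 = (q0 + q1 * a) - q1 * a by rewrite addrK.
    apply: le_trans (ler_normB _ _) _; rewrite normrM; apply: lerD => //.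
    by apply: ler_wpM2r.
  have ME : M * normc z = normc z + normc z / `|b| * `|a| + normc z / `|b|.
    by rewrite /M; move: (normc z) `|a| `|b| b0 => Z A B B0; field; rewrite gt_eqF.
  have zb0 : 0 <= normc z / `|b| by rewrite divr_ge0 ?normc_ge0 // ltW.
  rewrite ME; split; first by rewrite (le_trans q0b) // lerDl.
  rewrite (le_trans q1b) // lerDr addr_ge0 ?normc_ge0 //.
  by rewrite mulr_ge0.
have M0 : 0 < M by rewrite ltr_pwDl // divr_ge0 // addr_ge0.
apply: (local_degree_eq (emb_abs_abs R j) M0 (b := bs)).
  move=> q i; rewrite (emb_abs_arch R j) /emb_abs embE.
  have [h0 h1] := q_le (ratr (q ord0)) (ratr (q (lift ord0 ord0))).
  have [->|->] // : i = ord0 \/ i = lift ord0 ord0.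
  by case: (unliftP ord0 i) => [k ->|->]; [right; rewrite (ord1 k)|left].
move=> x e e0; case xE : (emb j x) => [c d].
have e2 : 0 < e / 2 by rewrite divr_gt0.
have eb : 0 < e / 2 / `|b| by rewrite divr_gt0.
have [q1 q1P] := rat_approx (d / b) eb.
have [q0 q0P] := rat_approx (c - ratr q1 * a) e2.
exists (fun i => if i == ord0 then q0 else q1).
rewrite /emb_abs rmorphB embE xE /=.
set z := (X in Num.sqrt X); have -> : Num.sqrt z =
    normc ((c - (ratr q0 + ratr q1 * a)) +i* (d - ratr q1 * b))%C by [].
apply: le_lt_trans (normc_leReIm _) _; rewrite /= (splitr e); apply: ltrD.
  by rewrite opprD addrCA addrC -addrA addrC in q0P *; move: q0P; rewrite addrAC.
have -> : d - ratr q1 * b = (d / b - ratr q1) * b by rewrite mulrBl divfK.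
by rewrite normrM -ltr_pdivlMr.
Qed.

(** A complex place is induced by two conjugate embeddings and a real one by a single
    one, so the local degrees count embeddings. *)
Lemma local_degree_emb j :
  local_degree (emb_abs j) = #|[pred i | emb_abs i == emb_abs j]|.
Proof.
have -> : #|[pred i | emb_abs i == emb_abs j]| = #|pred2 j (emb_bar j)|.
  apply: eq_card => i; rewrite !inE; apply/eqP/orP.
    by move/emb_abs_eq => [->|->]; [left|right].
  by case=> /eqP -> //; exact: emb_abs_bar.
rewrite card2; have [jb|jb] := eqVneq (emb_bar j) j.
  by rewrite local_degree_real.
by rewrite local_degree_complex.
Qed.

Lemma emb_real_of_degree1 j x : local_degree (emb_abs j) = 1%N ->
  complex.Im (emb j x) = 0.
Proof.
have [jb _|jb] := eqVneq (emb_bar j) j; last by rewrite local_degree_complex.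
have := emb_barE R j x; rewrite jb; case: (emb j x) => a b [] /= bE.
by move: bE => /eqP; rewrite -subr_eq0 opprK -mulr2n mulrn_eq0 /= => /eqP.
Qed.

Definition inf_places : seq (K -> R) := undup [seq emb_abs j | j : 'I_n].

Lemma inf_placesP v : v \in inf_places <-> absolute_value v /\ archimedean v.
Proof.
rewrite mem_undup; split=> [/mapP[j _ ->]|[va vQ]].
  by split; [exact: emb_abs_abs|exact: emb_abs_arch].
by have [j ->] := arch_place_emb va vQ; apply/mapP; exists j; rewrite // mem_enum.
Qed.

Lemma prod_inf_places (F : (K -> R) -> R) :
  \prod_(v <- inf_places) F v ^+ local_degree v = \prod_j F (emb_abs j).
Proof.
have := big_undup_iterop_count *%R [seq emb_abs j | j : 'I_n] xpredT F.
rewrite big_map big_enum /= => <-; rewrite /inf_places big_seq [RHS]big_seq.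
apply: eq_bigr => v; rewrite mem_undup => /mapP[j _ ->].
rewrite -[RHS]/(_ ^+ _); congr (_ ^+ _).
rewrite local_degree_emb count_map cardE -size_filter /=.
by rewrite enumT; congr size; apply: eq_filter => i.
Qed.

Lemma local_degree_emb_gt0 j : (0 < local_degree (emb_abs j))%N.
Proof. by rewrite local_degree_emb; apply/card_gt0P; exists j; rewrite inE. Qed.

Lemma field_norm_emb_abs (x : K) : `|ratr (field_norm x)| = \prod_j emb_abs j x :> R.
Proof.
rewrite -normc_ratr field_normE normc_prod; exact: eq_bigr.
Qed.

Lemma sigmaP (v : inf_place R K) :
  exists2 j, sval v = emb_abs j & sigma v = emb j :> (K -> C).
Proof.
have [va vQ] := svalP v; have [j vE] := arch_place_emb va vQ.
have [s sE sv] : [set f : K -> C | exists2 s : {rmorphism K -> C},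
    f = s & forall x, normc (s x) = sval v x] (sigma v).
  rewrite /sigma; case: xgetP => [f -> //|/(_ (emb j))[]].
  by exists (emb j) => // x; rewrite vE.
have [i si] := emb_surj s.
have sigE : sigma v = emb i :> (K -> C) by rewrite sE; apply/funext.
by exists i => //; apply/funext => x; rewrite /emb_abs -sv si.
Qed.

End ArchimedeanLocalDegree.

(** * The unit theorem *)

Section UnitTheorem.
Variables (R : realType) (K : fieldExtType rat).
Notation n := (\dim {:K}).
Local Notation OK := (@ring_of_integers K).
Local Notation normc := (@Normc.normc R).
Local Notation emb := (@emb R K).
Local Notation emb_abs := (@emb_abs R K).
Local Notation emb_bar := (@emb_bar R K).

Lemma ln_prod (I : finType) (F : I -> R) : (forall i, 0 < F i) ->
  ln (\prod_i F i) = \sum_i ln (F i).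
Proof.
move=> F0; have [_ ->] // : 0 < \prod_i F i /\ ln (\prod_i F i) = \sum_i ln (F i).
apply: (big_ind2 (fun p s => 0 < p /\ ln p = s)) => [|p s p' s' [p0 <-] [p'0 <-]|i _].
- by rewrite ln1.
- by rewrite mulr_gt0 // lnM.
- by rewrite F0.
Qed.

(** Real coordinates on K (x) R: of two conjugate embeddings one contributes its
    real part and the other one its imaginary part. *)
Definition real_coord (j : 'I_n) (x : K) : R :=
  if (j <= emb_bar j)%N then complex.Re (emb j x) else complex.Im (emb j x).

Lemma real_coordB j x y : real_coord j (x - y) = real_coord j x - real_coord j y.
Proof.
rewrite /real_coord rmorphB; case: (emb j x) => a b; case: (emb j y) => c d.
by case: ifP.
Qed.

Lemma real_coord_le j x : `|real_coord j x| <= emb_abs j x.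
Proof. by rewrite /real_coord; case: ifP => _; [exact: normc_geRe|exact: normc_geIm]. Qed.

Lemma emb_abs_le_coord j x :
  emb_abs j x <= `|real_coord j x| + `|real_coord (emb_bar j) x|.
Proof.
apply: le_trans (normc_leReIm _) _; rewrite /real_coord emb_barK.
have -> : emb (emb_bar j) x = conjc (emb j x) by exact: emb_barE.
have [jb|jb] := eqVneq (emb_bar j) j.
  have : conjc (emb j x) = emb j x by rewrite -emb_barE jb.
  rewrite jb leqnn; case: (emb j x) => a b [] bE /=.
  have -> : b = 0.
    by move: bE => /eqP; rewrite -subr_eq0 -opprD oppr_eq0 -mulr2n mulrn_eq0 /= => /eqP.
  by rewrite normr0 lerD2l.
case: (leqP j (emb_bar j)) => h.
  rewrite leqNgt ltn_neqAle h andbT eq_sym jb /=.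
  by case: (emb j x) => a b; rewrite /= normrN.
by rewrite (ltnW h); case: (emb j x) => a b; rewrite /= addrC.
Qed.

Lemma truncn_eq_dist (a b : R) : 0 <= a -> 0 <= b ->
  Num.truncn a = Num.truncn b -> `|a - b| < 1.
Proof.
move=> a0 b0 ab; have /andP[la ha] := truncn_itv a0; have /andP[lb hb] := truncn_itv b0.
rewrite ab in la ha; rewrite -addn1 natrD in ha hb; rewrite ltr_norml.
by move: la ha lb hb; move: (_%:R) => T; clear; move=> *; apply/andP; split; lra.
Qed.

(** Box principle: there are (M + 1) ^ n combinations of a Z-basis with coefficients
    in [0, M]. Cutting the range of the j-th real coordinate in M / expR (eta j)
    intervals leaves at most M ^ n boxes, as the eta j sum up to 0; so two of the
    combinations share a box, and their difference is the element sought. *)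
Lemma small_element : exists2 C : R, 0 < C &
  forall eta : 'I_n -> R, (forall j, eta (emb_bar j) = eta j) -> \sum_j eta j = 0 ->
  exists x, [/\ OK x, x != 0 & forall j, emb_abs j x <= C * expR (eta j)].
Proof.
have [w [wb wO spO]] := OK_zbasis R K.
pose c : R := 1 + \sum_j \sum_i emb_abs j (w i).
have c_gt j : \sum_i emb_abs j (w i) < c.
  rewrite /c [X in _ < 1 + X](bigD1 j) //= addrCA ltrDl ltr_pwDl // sumr_ge0 // => k _.
  by rewrite sumr_ge0 // => i _; exact: normc_ge0.
have c0 : 0 < c.
  rewrite /c ltr_pwDl // sumr_ge0 // => k _.
  by rewrite sumr_ge0 // => i _; exact: normc_ge0.
clearbody c.
exists (8 * c) => [|eta etab eta0]; first by rewrite mulr_gt0.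
(* large enough for each M / expR (eta j) to be at least 2, so that rounding it
   down to k j at most halves it *)
pose M := (Num.truncn (\sum_j 2 * expR (eta j) : R)).+1.
have M0 : 0 < M%:R :> R by rewrite ltr0n.
have Mge j : 2 * expR (eta j) <= M%:R.
  apply: ltW; apply: le_lt_trans (truncnS_gt _); rewrite (bigD1 j) //= lerDl.
  by rewrite sumr_ge0 // => i _; rewrite mulr_ge0 // expR_ge0.
pose T j : R := M%:R / expR (eta j).
have T0 j : 0 <= T j by rewrite divr_ge0 ?expR_ge0 ?ltW.
pose k j := Num.truncn (T j).
have k_le j : (k j)%:R <= T j by rewrite truncn_le.
have k_gt0 j : (0 < k j)%N.
  rewrite /k truncn_gt0 /T ler_pdivlMr ?expR_gt0 // mul1r (le_trans _ (Mge j)) //.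
  by rewrite ler_peMl ?expR_ge0 // ler1n.
have k_ge j : T j <= 2 * (k j)%:R.
  apply: ltW; apply: lt_le_trans (truncnS_gt _) _.
  by rewrite -natrM ler_nat -/(k j) mul2n -addnn -addn1 leq_add2l.
have prodk : (\prod_j k j < M.+1 ^ n)%N.
  apply: (@leq_ltn_trans (M ^ n)); last by rewrite ltn_exp2r ?adim_gt0.
  rewrite -(ler_nat R) natr_prod natrX.
  apply: (@le_trans _ _ (\prod_j T j)).
    by apply: ler_prod => j _; rewrite ler0n k_le.
  rewrite prodf_div -expR_sum eta0 expR0 divr1.
  by rewrite big_const card_ord -Monoid.iteropE /=.
pose el (z : {ffun 'I_n -> 'I_M.+1}) : K := \sum_i (z i)%:R * w i.
have elO z : OK (el z).
  by apply: OK_sum => i _; apply: OK_mul => //; exact: OK_nat.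
have el_lt j z : `|real_coord j (el z)| < M%:R * c.
  apply: le_lt_trans (real_coord_le _ _) _.
  apply: le_lt_trans (le_abs_sum (emb_abs_abs R j) _ _ _) _.
  apply: (@le_lt_trans _ _ (M%:R * \sum_i emb_abs j (w i))); last by rewrite ltr_pM2l.
  rewrite mulr_sumr; apply: ler_sum => i _; rewrite (absM (emb_abs_abs R j)).
  apply: ler_wpM2r; first exact: normc_ge0.
  by rewrite emb_abs_nat ler_nat -ltnS.
have Mc0 : 0 < M%:R * c by rewrite mulr_gt0.
pose pos j z : R := (real_coord j (el z) + M%:R * c) / (2 * (M%:R * c)) * (k j)%:R.
have pos_ge0 j z : 0 <= pos j z.
  rewrite /pos mulr_ge0 // divr_ge0 //; last by rewrite mulr_ge0 // ltW.
  by have := el_lt j z; rewrite ltr_norml => /andP[/ltW]; rewrite -subr_ge0 opprK.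
have pos_lt j z : (Num.truncn (pos j z) < k j)%N.
  rewrite truncn_lt_nat // /pos -[X in _ < X]mul1r ltr_pM2r ?ltr0n //.
  rewrite ltr_pdivrMr ?mulr_gt0 // mul1r mulr2n mulrDl !mul1r ltrD2r.
  exact: le_lt_trans (ler_norm _) (el_lt j z).
pose box z : {dffun forall j : 'I_n, 'I_(k j)} := [ffun j => Ordinal (pos_lt j z)].
have : ~ injective box.
  move=> /leq_card; rewrite card_ffun !card_ord card_dep_ffun foldrE big_map big_enum /=.
  rewrite (eq_bigr k) => [|j _]; last by rewrite card_ord.
  by rewrite leqNgt prodk.
move=> /existsNP[z /existsNP[z' /not_implyP[zz' nzz']]].
exists (el z - el z'); split; first exact: OK_sub.
  apply/eqP => d0; apply: nzz'; apply/ffunP => i; apply/val_inj => /=.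
  have := @zspan_free R K w (fun i => (z i)%:Z - (z' i)%:Z) wb.
  have -> : \sum_i ((z i)%:Z - (z' i)%:Z)%:~R * w i = 0.
    by rewrite -[RHS]d0 -sumrB; apply: eq_bigr => l _; rewrite rmorphB mulrBl.
  by move=> /(_ erefl i)/eqP; rewrite subr_eq0 => /eqP[].
have coord_le j : `|real_coord j (el z - el z')| <= 4 * c * expR (eta j).
  have pd : `|pos j z - pos j z'| < 1.
    apply: truncn_eq_dist => //.
    have := congr1 (fun f : {dffun forall j : 'I_n, 'I_(k j)} => (f j : nat)) zz'.
    by rewrite !ffunE.
  move: pd; rewrite /pos -mulrBl -mulrBl opprD addrACA subrr addr0 -real_coordB.
  rewrite 2!normrM normfV normr_nat (@gtr0_norm _ (2 * _)) ?mulr_gt0 //.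
  rewrite mulrAC ltr_pdivrMr ?mulr_gt0 // mul1r => /ltW pd.
  have : `|real_coord j (el z - el z')| * T j <= 4 * (M%:R * c).
    apply: (@le_trans _ _ (`|real_coord j (el z - el z')| * (2 * (k j)%:R))).
      by apply: ler_wpM2l.
    by rewrite mulrCA -[4]/(2 * 2)%:R natrM -mulrA ler_pM2l.
  rewrite /T [_ * (_ / _)]mulrA ler_pdivrMr ?expR_gt0 // [_ * M%:R]mulrC.
  by rewrite (mulrCA 4) -!mulrA ler_pM2l // !mulrA.
move=> j; apply: le_trans (emb_abs_le_coord _ _) _.
have -> : 8 * c * expR (eta j) = 4 * c * expR (eta j) + 4 * c * expR (eta (emb_bar j)).
  by rewrite etab -mulrDl -mulrDl -natrD.
by apply: lerD.
Qed.

Lemma emb_abs_gt0 j x : (0 < emb_abs j x) = (x != 0).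
Proof. exact: (abs_gt0 (emb_abs_abs R j)). Qed.

Lemma unit_norm_prod u : int_unit u -> \prod_j emb_abs j u = 1.
Proof.
move=> [u0 uO uVO]; rewrite -field_norm_emb_abs.
have [m [mE _]] := dvd_norm R uO; have [m' [m'E _]] := dvd_norm R uVO.
have : field_norm u * field_norm u^-1 = 1.
  rewrite -(field_normM R) divff //; apply: (fmorph_inj (ratr : {rmorphism rat -> R[i]})).
  by rewrite /= field_normE rmorph1 big1 // => j _; rewrite rmorph1.
rewrite mE m'E -intrM -[1]/(1%:~R) => /eqP; rewrite eqr_int => /eqP/(congr1 absz).
rewrite abszM => /eqP; rewrite muln_eq1 => /andP[/eqP m1 _].
by rewrite ratr_int -intr_norm -abszE m1.
Qed.

(** Elements of bounded norm fall in finitely many classes modulo an integer D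
    that they all divide, and the quotient of two congruent ones is a unit: so
    the elements of small_element can be divided by finitely many ones to yield
    units. *)
Lemma unit_near : exists B : R, forall eta : 'I_n -> R,
  (forall j, eta (emb_bar j) = eta j) -> \sum_j eta j = 0 ->
  exists2 u, int_unit u & forall j, `|ln (emb_abs j u) - eta j| <= B.
Proof.
have [C C0 Csmall] := small_element.
pose D := (Num.truncn (C ^+ n))`!.
have D0 : D%:R != 0 :> K by rewrite natK_eq0 -lt0n fact_gt0.
have [k [f [fO covf _]]] := ideal_transversal R (nonzero_principal (OK_nat K D) D0).
pose good (t : 'I_k) x := [/\ OK x, x != 0, principal D%:R (x - f t)
  & exists2 y, OK y & D%:R = x * y].
(* g t is fixed in advance in the class t, independently of eta *)
have /choice[g gP] (t : 'I_k) : exists g, forall x, good t x -> good t g.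
  have [[x xg]|nog] := pselect (exists x, good t x); first by exists x.
  by exists 0 => x xg; case: nog; exists x.
pose C2 : R := 1 + \sum_t \sum_j C / emb_abs j (g t).
have Cg0 j t : 0 <= C / emb_abs j (g t) by rewrite divr_ge0 ?normc_ge0 ?ltW.
have C2_ge1 : 1 <= C2.
  by rewrite lerDl sumr_ge0 // => t _; rewrite sumr_ge0.
have C2_ge j t : C / emb_abs j (g t) <= C2.
  rewrite /C2 (bigD1 t) //= (bigD1 j) //= addrCA -addrA lerDl.
  by rewrite addr_ge0 // ?addr_ge0 ?sumr_ge0 // => l _; rewrite sumr_ge0.
have lnC2 : 0 <= ln C2 by rewrite ln_ge0.
exists (n%:R * ln C2) => eta etab eta0.
have [x [xO x0 xle]] := Csmall eta etab eta0.
have [m [mE [y yO xy]]] := dvd_norm R xO.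
have Nx : (`|m|%N <= Num.truncn (C ^+ n))%N.
  rewrite truncn_ge_nat ?exprn_ge0 ?(ltW C0) // natr_absz intr_norm.
  have -> : m%:~R = ratr (field_norm x) :> R by rewrite mE ratr_int.
  rewrite field_norm_emb_abs.
  apply: (@le_trans _ _ (\prod_j (C * expR (eta j)))).
    by apply: ler_prod => j _; rewrite normc_ge0 xle.
  rewrite big_split /= -expR_sum eta0 expR0 mulr1.
  by rewrite big_const card_ord -Monoid.iteropE.
have m0 : (0 < `|m|)%N.
  rewrite absz_gt0; apply: contraTneq x0 => m0.
  by rewrite negbK -(field_norm_eq0 R) mE m0.
have [t xt] := covf x xO.
have xg : good t x.
  split => //; have /dvdnP[q qE] : (`|m| %| D)%N by apply: dvdn_fact; rewrite m0.
  exists ((q%:R * Num.sg m)%:~R * y).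
    by apply: OK_mul => //; exact: OK_int.
  rewrite mulrCA -xy -intrM qE; rewrite -[(q * _)%:R]/((q * `|m|)%N%:~R); congr (_%:~R).
  by rewrite PoszM abszE normrEsg mulrA; congr (_ * _); rewrite natz.
have [gO g0 gt [y' y'O Dg]] := gP t x xg.
have [_ _ _ [y'' y''O Dx]] := xg.
have sp := ideal_subgroup (principal_ideal (OK_nat K D)).
have [z zO zE] : principal D%:R (x - g t).
  have -> : x - g t = (x - f t) - (g t - f t) by ring.
  exact: sp.2.
pose u := x / g t.
have u0 : u != 0 by rewrite mulf_neq0 ?invr_eq0.
have uu : int_unit u.
  split => //.
    have -> : u = 1 + y' * z.
      rewrite /u -[x](subrK (g t)) -zE Dg mulrDl divff // addrC; congr (_ + _).
      by rewrite -(mulrA (g t)) mulrAC divff // mul1r.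
    by apply: OK_add; [exact: OK1|exact: OK_mul].
  have -> : u^-1 = 1 - y'' * z.
    have gE : g t = x - x * y'' * z by rewrite -Dx zE; ring.
    rewrite /u invf_div gE mulrBl divff //; congr (_ - _).
    by rewrite -(mulrA x) mulrAC divff // mul1r.
  by apply: OK_sub; [exact: OK1|exact: OK_mul].
exists u => //.
pose d j := ln (emb_abs j u) - eta j.
have uj j : 0 < emb_abs j u by rewrite emb_abs_gt0.
have d_le j : d j <= ln C2.
  have C2_gt0 : 0 < C2 by exact: lt_le_trans ltr01 _.
  rewrite lerBlDr -[eta j]expRK -lnM ?posrE ?expR_gt0 //.
  rewrite ler_ln ?posrE ?mulr_gt0 ?expR_gt0 //.
  rewrite /u (absM (emb_abs_abs R j)) (absV (emb_abs_abs R j)).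
  rewrite ler_pdivrMr ?emb_abs_gt0 // mulrAC.
  apply: le_trans (xle j) _; apply: ler_wpM2r; first exact: expR_ge0.
  by rewrite -ler_pdivrMr ?emb_abs_gt0.
have d_sum : \sum_j d j = 0.
  rewrite sumrB eta0 subr0.
  by rewrite -ln_prod // unit_norm_prod // ln1.
move=> j; rewrite ler_norml; apply/andP; split; last first.
  by apply: le_trans (d_le j) _; rewrite ler_peMl // ler1n adim_gt0.
have : - d j = \sum_(i | i != j) d i.
  by apply/eqP; rewrite eq_sym -subr_eq0 opprK addrC; have := d_sum; rewrite (bigD1 j) //= => ->.
move=> djE; rewrite -/(d j) lerNl djE.
apply: (@le_trans _ _ (\sum_(i < n) ln C2)); last by rewrite sumr_const card_ord mulr_natl.
rewrite [X in _ <= X](bigD1 j) //= -[X in X <= _]add0r lerD //.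
by apply: ler_sum => i _; exact: d_le.
Qed.

(** A linear form that vanishes on the logarithms of the units of the given
    system is bounded on all multiples of eta, as these are at a bounded distance
    from logarithms of units; so it vanishes at eta. *)
Lemma units_span r (eps : 'I_r -> K) :
  (forall u, int_unit u -> exists m : 'I_r -> int, forall j,
     ln (emb_abs j u) = \sum_k (m k)%:~R * ln (emb_abs j (eps k))) ->
  forall eta : 'I_n -> R, (forall j, eta (emb_bar j) = eta j) -> \sum_j eta j = 0 ->
  exists t : 'I_r -> R, forall j, eta j = \sum_k t k * ln (emb_abs j (eps k)).
Proof.
move=> epsP eta etab eta0; have [B Bnear] := unit_near.
pose L : 'M[R]_(r, n) := \matrix_(k, j) ln (emb_abs j (eps k)).
pose row_eta : 'rV[R]_n := \row_j eta j.
have [/submxP[t tE]|] := boolP (row_eta <= L)%MS.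
  exists (fun k => t 0 k) => j; have /rowP/(_ j) := tE; rewrite !mxE => ->.
  by apply: eq_bigr => k _; rewrite mxE.
rewrite submxE => /eqP nz; exfalso.
have [c cP] : exists c, (row_eta *m cokermx L) 0 c != 0.
  apply: contrapT => /forallNP H; apply: nz; apply/rowP => c.
  by have /negP := H c; rewrite negbK mxE [in RHS]mxE => /eqP.
pose phi j := cokermx L j c.
have phiL k : \sum_j ln (emb_abs j (eps k)) * phi j = 0.
  have /matrixP/(_ k c) := mulmx_coker L; rewrite !mxE => E; apply: etrans E.
  by apply: eq_bigr => j _; rewrite [L k j]mxE.
have phiU u : int_unit u -> \sum_j ln (emb_abs j u) * phi j = 0.
  move=> /epsP[m mE]; under eq_bigr do rewrite mE mulr_suml.
  rewrite exchange_big big1 //= => k _; under eq_bigr do rewrite -mulrA.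
  by rewrite -mulr_sumr phiL mulr0.
pose a := \sum_j eta j * phi j.
have a0 : a != 0.
  move: cP; rewrite mxE; congr (_ != 0); apply: eq_bigr => j _.
  by rewrite [row_eta 0 j]mxE.
pose S := \sum_j B * `|phi j|.
have bound (k : nat) : k%:R * `|a| <= S.
  have [||u uu un] := Bnear (fun j => k%:R * eta j).
  - by move=> j; rewrite etab.
  - by rewrite -mulr_sumr eta0 mulr0.
  have -> : k%:R * `|a| = `|\sum_j (ln (emb_abs j u) - k%:R * eta j) * phi j|.
    under eq_bigr do rewrite mulrBl -mulrA.
    by rewrite sumrB phiU // -mulr_sumr sub0r normrN normrM normr_nat.
  apply: le_trans (ler_norm_sum _ _ _) _; apply: ler_sum => j _.
  by rewrite normrM ler_wpM2r.
have := bound (Num.truncn (S / `|a|)).+1.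
rewrite leNgt => /negP; apply; rewrite -ltr_pdivrMr ?normr_gt0 //.
exact: truncnS_gt.
Qed.

End UnitTheorem.

(** * Heights *)

Section Heights.
Variables (R : realType) (K : fieldExtType rat).
Notation n := (\dim {:K}).
Local Notation OK := (@ring_of_integers K).
Local Notation emb_abs := (@emb_abs R K).
Local Notation fin_place := (@fin_place R K).
Local Notation inf_places := (inf_places R K).

Definition vmax m (v : K -> R) (y : 'rV[K]_m) : R := \big[Num.max/0]_(i < m) v (y 0 i).

Lemma vmax_ge m (v : K -> R) (y : 'rV[K]_m) i : v (y 0 i) <= vmax v y.
Proof. exact: (le_bigmax _ (fun i => v (y 0 i))). Qed.

Lemma vmax_attained m (v : K -> R) (y : 'rV[K]_m.+1) : absolute_value v ->
  exists i, vmax v y = v (y 0 i).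
Proof.
move=> vabs; have [i _ iP] := Order.TotalTheory.arg_maxP (fun i => v (y 0 i))
  (isT : xpredT (@ord0 m)).
exists i; apply/le_anti; rewrite vmax_ge andbT.
by apply: bigmax_le => [|k _]; [exact: abs_ge0|exact: iP].
Qed.

Lemma vmax_nabs m (v : K -> R) (y : 'rV[K]_m.+1) : absolute_value v ->
  \big[Num.max/0]_(i < m.+1) nabs v (y 0 i) = vmax v y ^+ local_degree v.
Proof.
move=> vabs; apply/le_anti/andP; split; last first.
  have [i ->] := vmax_attained y vabs.
  exact: (le_bigmax _ (fun i => nabs v (y 0 i))).
have v0 i : 0 <= v (y 0 i) by exact: abs_ge0.
have m0 : 0 <= vmax v y by have [i ->] := vmax_attained y vabs.
apply: bigmax_le => [|k _]; first exact: exprn_ge0.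
by rewrite lerXn2r ?nnegrE // vmax_ge.
Qed.

Lemma vmaxZ m (v : K -> R) c (y : 'rV[K]_m.+1) : absolute_value v ->
  vmax v (c *: y) = v c * vmax v y.
Proof.
move=> vabs; have [i iE] := vmax_attained y vabs; have [k kE] := vmax_attained (c *: y) vabs.
apply/le_anti/andP; split.
  by rewrite kE mxE (absM vabs) ler_wpM2l ?vmax_ge // abs_ge0.
by rewrite iE -(absM vabs); have := vmax_ge v (c *: y) i; rewrite mxE.
Qed.

Lemma vmax_gt0 m (v : K -> R) (y : 'rV[K]_m) : absolute_value v -> y != 0 -> 0 < vmax v y.
Proof.
move=> vabs y0; have [i yi] : exists i, y 0 i != 0.
  apply: contrapT => /forallNP H; case/eqP: y0; apply/rowP => i.
  by have /negP := H i; rewrite negbK mxE => /eqP.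
by apply: lt_le_trans (vmax_ge _ _ i); rewrite (abs_gt0 vabs).
Qed.

(** The finite places contribute the inverse of the norm of the ideal that x
    generates, the infinite ones the absolute value of the norm of x. *)
Lemma product_formula x s : OK x -> x != 0 -> uniq s ->
  (forall v, v \in s -> fin_place v) ->
  (forall v, fin_place v -> v x < 1 -> v \in s) ->
  \prod_(v <- inf_places ++ s) nabs v x = 1.
Proof.
move=> xO x0 us sf sP.
have xmax v : fin_place v -> principal x x /\ forall y, principal x y -> v y <= v x.
  move=> [vabs vp]; split; first exact: mem_principal.
  move=> _ [y yO <-]; rewrite (absM vabs) ler_piMr ?abs_ge0 //.
  exact: fin_OK_le1.
have nE := @ideal_norm_prod R K (principal x) (fun=> x) (nonzero_principal xO x0)
    xmax s us sf sP.
rewrite big_cat /= nE (prod_inf_places (fun v => v x)) -field_norm_emb_abs.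
have := ideal_norm_principal R xO x0 => /(congr1 (ratr : rat -> R)).
rewrite ratr_nat ratr_norm => <-.
by rewrite divff // pnatr_eq0 -lt0n (ideal_norm_gt0 R) //; exact: nonzero_principal.
Qed.

(** At a finite place the maximum over the generators is the maximum over the
    ideal. *)
Lemma prod_vmax_ideal m (y : 'rV[K]_m.+1) s : nonzero_ideal (span_ideal y) ->
  (forall i, span_ideal y (y 0 i)) -> uniq s ->
  (forall v, v \in s -> fin_place v) ->
  (forall v, fin_place v -> vmax v y < 1 -> v \in s) ->
  \prod_(v <- inf_places ++ s) vmax v y ^+ local_degree v =
  (\prod_j vmax (emb_abs j) y) / (ideal_norm (span_ideal y))%:R.
Proof.
move=> an ya us sf sP.
have /choice[k kP] (v : K -> R) : exists k, absolute_value v -> vmax v y = v (y 0 k).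
  have [vabs|nv] := pselect (absolute_value v); last by exists ord0.
  by have [i iE] := vmax_attained y vabs; exists i.
have kmax v : fin_place v -> span_ideal y (y 0 (k v)) /\
    forall x, span_ideal y x -> v x <= v (y 0 (k v)).
  move=> [vabs vp]; split=> // x [c cO ->]; rewrite -kP //.
  apply: (ultrametric_sum vabs vp) => [|i _]; first by rewrite kP // abs_ge0.
  rewrite (absM vabs) (le_trans _ (vmax_ge v y i)) // ler_piMl ?abs_ge0 //.
  exact: fin_OK_le1.
have nE := @ideal_norm_prod R K _ (fun v => y 0 (k v)) an kmax s us sf.
rewrite -nE => [|v vf]; last by rewrite -kP; [exact: sP|case: vf].
rewrite big_cat /= (prod_inf_places (fun v => vmax v y)); congr (_ * _).
rewrite big_seq [RHS]big_seq; apply: eq_bigr => v /sf[vabs _].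
by rewrite kP.
Qed.

(** By the product formula the height does not change when the coordinates are
    multiplied by c; with coordinates that generate an integral ideal its finite
    part is the inverse of the norm of that ideal. The product formula is applied
    to the integral elements d and d * c, where d is a denominator of c. *)
Lemma height_ideal m (x y : 'rV[K]_m.+1) c : c != 0 -> y = c *: x ->
  nonzero_ideal (span_ideal y) -> (forall i, span_ideal y (y 0 i)) ->
  coords_height R x = (\prod_j vmax (emb_abs j) y) / (ideal_norm (span_ideal y))%:R.
Proof.
move=> c0 yE an ya; have [d d0 dcO] := integral_multiple c.
have [[aO _ _ _] [z za z0]] := an.
have dO : OK (d%:~R) by exact: OK_int.
have zO : OK z by exact: aO.
have dK0 : d%:~R != 0 :> K by rewrite intK_eq0.
have dc0 : d%:~R * c != 0 by rewrite mulf_neq0.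
(* outside s the elements d, d * c and z are units, and z forces vmax v y to be 1 *)
have [||s us sP] := @finite_places_dividing R K (d%:~R * (d%:~R * c) * z).
- by do 2!apply: OK_mul => //.
- by rewrite !mulf_neq0.
have sf v : v \in s -> fin_place v by move=> /sP[].
have small v b b' : fin_place v -> OK b -> OK b' -> v b < 1 -> v (b * b') < 1.
  move=> [vabs vp] bO b'O b1; rewrite (absM vabs).
  apply: le_lt_trans b1; rewrite ler_piMr ?abs_ge0 //; exact: fin_OK_le1.
have s_d v : fin_place v -> v d%:~R < 1 -> v \in s.
  by move=> vf vd; apply/sP; split=> //; rewrite -mulrA; apply: small => //; exact: OK_mul.
have s_dc v : fin_place v -> v (d%:~R * c) < 1 -> v \in s.
  move=> vf vd; apply/sP; split=> //; rewrite mulrAC mulrC.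
  by apply: small => //; exact: OK_mul.
have s_z v : fin_place v -> v z < 1 -> v \in s.
  by move=> vf vd; apply/sP; split=> //; rewrite mulrC; apply: small => //; exact: OK_mul.
have s_y v : fin_place v -> vmax v y < 1 -> v \in s.
  move=> vf vy; apply: s_z => //; apply: le_lt_trans vy.
  have [vabs vp] := vf; have [b bO ->] := za.
  apply: (ultrametric_sum vabs vp) => [|i _].
    exact: le_trans (abs_ge0 vabs _) (vmax_ge v y 0).
  rewrite (absM vabs) (le_trans _ (vmax_ge v y i)) // ler_piMl ?abs_ge0 //.
  exact: fin_OK_le1.
(* 2 has absolute value 2 at an archimedean place and at most 1 at a finite one *)
have disj v : v \in inf_places -> v \in s -> False.
  move=> /inf_placesP[_ va] /sf[vabs vp].
  have := fin_nat_le1 vp 2.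
  have := va 2%:R; rewrite scaler_nat ratr_nat => ->.
  by rewrite normr_nat lern1.
have ur : uniq (inf_places ++ s).
  rewrite cat_uniq undup_uniq us andbT /=; apply/hasPn => v vs; apply/negP => vi.
  exact: disj vi vs.
have abs_of v : v \in inf_places ++ s -> absolute_value v.
  by rewrite mem_cat => /orP[/inf_placesP[]//|/sf[]].
have yd : (d%:~R) *: y = (d%:~R * c) *: x by rewrite yE scalerA.
rewrite -(@prod_vmax_ideal m y s) // /coords_height.
rewrite (@fsbigE _ _ _ _ _ (inf_places ++ s)) //; first last.
- move=> v [vabs vt]; rewrite mem_cat negb_or => /andP[vi vs].
  have vf : fin_place v.
    by split=> //; case: vt => // va; case/negP: vi; apply/inf_placesP.
  have eq1 b : OK b -> (v b < 1 -> v \in s) -> v b = 1.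
    move=> bO bs; apply/eqP; rewrite eq_le fin_OK_le1 //=; last by case: vf.
    by rewrite leNgt; apply/negP => /bs; exact/negP.
  rewrite vmax_nabs //; suff -> : vmax v x = 1 by rewrite expr1n.
  have : vmax v ((d%:~R) *: y) = vmax v ((d%:~R * c) *: x) by rewrite yd.
  rewrite !vmaxZ // (eq1 _ dO (s_d v vf)) (eq1 _ dcO (s_dc v vf)) !mul1r => <-.
  have [i iE] := vmax_attained y vabs; rewrite iE; apply: eq1; last by rewrite -iE; exact: s_y.
  exact: aO.
- move=> v /= vr; split; first exact: abs_of.
  by move: vr; rewrite mem_cat => /orP[/inf_placesP[]|/sf[]]; [left|right].
have -> : \big[*%R/1]_(v <- inf_places ++ s | v \in @places R K)
    \big[Num.max/0]_(i < m.+1) nabs v (x 0 i) =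
  \prod_(v <- inf_places ++ s) vmax v x ^+ local_degree v.
  rewrite big_mkcond big_seq [RHS]big_seq; apply: eq_bigr => v vr.
  rewrite ifT ?vmax_nabs //; try exact: abs_of.
  apply/mem_set; split; first exact: abs_of.
  by move: vr; rewrite mem_cat => /orP[/inf_placesP[]|/sf[]]; [left|right].
transitivity (\prod_(v <- inf_places ++ s) nabs v (d%:~R * c) *
              \prod_(v <- inf_places ++ s) vmax v x ^+ local_degree v).
  by rewrite product_formula ?mul1r.
transitivity (\prod_(v <- inf_places ++ s) nabs v d%:~R *
              \prod_(v <- inf_places ++ s) vmax v y ^+ local_degree v); last first.
  by rewrite product_formula ?mul1r.
rewrite -[LHS]big_split -[RHS]big_split /=.
rewrite big_seq [RHS]big_seq; apply: eq_bigr => v /abs_of vabs.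
by rewrite -!exprMn -!vmaxZ // yd.
Qed.

End Heights.

(** * Balancing the archimedean absolute values *)

Section Balance.
Variables (R : realType) (K : fieldExtType rat).
Notation n := (\dim {:K}).
Local Notation OK := (@ring_of_integers K).
Local Notation emb_abs := (@emb_abs R K).
Local Notation emb_bar := (@emb_bar R K).

Definition inf_place_of (j : 'I_n) : inf_place R K :=
  exist _ (emb_abs j) (conj (emb_abs_abs R j) (emb_abs_arch R j)).

Lemma LambdaE j (x : K) :
  Lambda x (inf_place_of j) = (local_degree (emb_abs j))%:R * ln (emb_abs j x).
Proof.
have d0 := local_degree_emb_gt0 R j; rewrite /Lambda /nabs /=.
have [->|x0] := eqVneq x 0; last by rewrite lnXn ?emb_abs_gt0 // mulr_natl.
by rewrite (abs0 (emb_abs_abs R j)) expr0n eqn0Ngt d0 !ln0 // mulr0.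
Qed.

Lemma ln_units_span r (eps : 'I_r -> K) u : fundamental_units R eps -> int_unit u ->
  exists m : 'I_r -> int, forall j,
    ln (emb_abs j u) = \sum_k (m k)%:~R * ln (emb_abs j (eps k)).
Proof.
move=> [_ span _] /span[m mE]; exists m => j.
have nz : (local_degree (emb_abs j))%:R != 0 :> R.
  by rewrite pnatr_eq0 -lt0n local_degree_emb_gt0.
apply: (mulfI nz); have := mE (inf_place_of j); rewrite LambdaE => ->.
by rewrite mulr_sumr; apply: eq_bigr => k _; rewrite LambdaE mulrCA.
Qed.

Lemma round_half (t : R) : exists m : int, `|t - m%:~R| <= 1 / 2%:R.
Proof.
exists (Num.floor (t + 1 / 2)); have := floor_itv (t + 1 / 2); rewrite intrD.
move: (_%:~R) => f /andP[h1 h2]; rewrite ler_norml; clear -h1 h2.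
by apply/andP; split; lra.
Qed.

Lemma ln_expz (x : R) (m : int) : 0 < x -> ln (x ^ m) = m%:~R * ln x.
Proof.
move=> x0; case: m => m; first by rewrite -exprnP lnXn // mulr_natl.
by rewrite NegzE -exprnN lnV ?posrE ?exprn_gt0 // lnXn // rmorphN mulNr mulr_natl.
Qed.

Lemma int_unitM (u w : K) : int_unit u -> int_unit w -> int_unit (u * w).
Proof.
by move=> [u0 uO uV] [w0 wO wV]; split; rewrite ?mulf_neq0 // ?invfM; exact: OK_mul.
Qed.

Lemma int_unitXz (u : K) (m : int) : int_unit u -> int_unit (u ^ m).
Proof.
move=> [u0 uO uV]; split; first exact: expfz_neq0.
- by case: m => m; rewrite ?NegzE -?exprnN -?exprVn; exact: OK_exp.
- by case: m => m; rewrite ?NegzE -?exprnN ?invrK -?exprVn; exact: OK_exp.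
Qed.

Lemma int_unit_prod r (u : 'I_r -> K) : (forall k, int_unit (u k)) ->
  int_unit (\prod_k u k).
Proof.
move=> uu; apply: big_ind => //; last exact: int_unitM.
by split; rewrite ?invr1 ?oner_neq0 //; exact: OK1.
Qed.

Lemma Dmax_ge r (eps : 'I_r -> K) (t : 'I_r -> R) v : (forall k, `|t k| <= 1 / 2%:R) ->
  \sum_k t k * Lambda (eps k) v <= Dmax eps v.
Proof.
move=> t2; apply: ub_le_sup; last first.
  by exists (fun v => \sum_k t k * Lambda (eps k) v) => //; exists t.
(* the supremum in Dmax is meaningful because the fundamental domain is bounded *)
exists (\sum_k 1 / 2%:R * `|Lambda (eps k) v|) => _ [_ [t' t'2 ->] <-].
apply: ler_sum => k _; apply: le_trans (ler_norm _) _.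
by rewrite normrM ler_wpM2r.
Qed.

(** The logarithms of the A j, once their mean is removed, are a real combination
    of those of the fundamental units; rounding its coefficients to integers
    leaves a combination in the fundamental domain. *)
Lemma balancing_unit r (eps : 'I_r -> K) (A : 'I_n -> R) : fundamental_units R eps ->
  (forall j, 0 < A j) -> (forall j, A (emb_bar j) = A j) ->
  exists2 u, int_unit u & forall j,
    emb_abs j u * A j <= (\prod_i A i) `^ n%:R^-1
      * expR (Dmax eps (inf_place_of j) / (local_degree (emb_abs j))%:R).
Proof.
move=> fu A0 Abar; pose mean : R := n%:R^-1 * \sum_i ln (A i).
have n0 : n%:R != 0 :> R by rewrite pnatr_eq0 -lt0n adim_gt0.
have [||t tE] := units_span (fun u => @ln_units_span r eps u fu)
  (eta := fun j => ln (A j) - mean).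
- by move=> j; rewrite Abar.
- by rewrite sumrB sumr_const card_ord -mulr_natl mulrA divff // mul1r subrr.
have /choice[m mt] k := round_half (t k).
have [eu _ _] := fu.
(* the logarithms of u subtract the integral part of the combination *)
pose u := \prod_k eps k ^ (- m k).
exists u; first by apply: int_unit_prod => k; exact: int_unitXz.
move=> j; have jabs := emb_abs_abs R j.
have u0 : 0 < emb_abs j u.
  rewrite emb_abs_gt0; apply/prodf_neq0 => k _; apply: expfz_neq0; by case: (eu k).
have prod_gt0 : 0 < \prod_i A i by apply: prodr_gt0.
have e0 k : 0 < emb_abs j (eps k) by rewrite emb_abs_gt0; case: (eu k).
have lnu : ln (emb_abs j u) = - \sum_k (m k)%:~R * ln (emb_abs j (eps k)).
  rewrite /u (abs_prod jabs) -sumrN ln_prod => [|k]; last first.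
    by rewrite emb_abs_gt0 expfz_neq0 //; case: (eu k).
  apply: eq_bigr => k _.
  by rewrite (absXz jabs) ln_expz // rmorphN mulNr.
have lnA : ln (A j) = mean + \sum_k t k * ln (emb_abs j (eps k)).
  by rewrite -tE addrC subrK.
have -> : emb_abs j u * A j =
    expR mean * expR (\sum_k (t k - (m k)%:~R) * ln (emb_abs j (eps k))).
  rewrite -[LHS]lnK ?posrE ?mulr_gt0 // lnM ?posrE // lnu lnA -expRD; congr expR.
  rewrite addrCA; congr (_ + _); rewrite addrC -sumrB.
  by apply: eq_bigr => k _; rewrite mulrBl.
have -> : (\prod_i A i) `^ n%:R^-1 = expR mean.
  by rewrite /mean mulrC expRM -ln_prod // lnK.
rewrite ler_pM2l ?expR_gt0 // ler_expR ler_pdivlMr ?ltr0n ?local_degree_emb_gt0 //.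
apply: le_trans (Dmax_ge eps (inf_place_of j) mt).
rewrite mulr_suml; apply: ler_sum => k _.
by rewrite LambdaE [_%:R * ln _]mulrC mulrA.
Qed.

End Balance.

(** * Generators of an ideal in a given class *)

Section Generators.
Variables (R : realType) (K : fieldExtType rat).
Local Notation OK := (@ring_of_integers K).

Lemma span_ideal_coord m (y : 'rV[K]_m) i : span_ideal y (y 0 i).
Proof.
exists (fun k => (i == k)%:R) => [k|]; first exact: OK_nat.
rewrite (bigD1 i) //= eqxx mul1r big1 ?addr0 // => k ki.
by rewrite eq_sym (negPf ki) mul0r.
Qed.

Lemma span_idealZ m (y : 'rV[K]_m) c : span_ideal (c *: y) = [set c * x | x in span_ideal y].
Proof.
apply/seteqP; split=> [_ [b bO ->]|_ [_ [b bO ->] <-]].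
  exists (\sum_i b i * y 0 i); first by exists b.
  by rewrite mulr_sumr; apply: eq_bigr => i _; rewrite mxE mulrCA.
by exists b => //; rewrite mulr_sumr; apply: eq_bigr => i _; rewrite mxE mulrCA.
Qed.

Lemma span_ideal_unit m (y : 'rV[K]_m) u : int_unit u ->
  span_ideal (u *: y) = span_ideal y.
Proof.
move=> [u0 uO uVO]; apply/seteqP; split=> _ [b bO ->].
  by exists (fun i => b i * u) => [i|]; [exact: OK_mul|];
    apply: eq_bigr => i _; rewrite mxE mulrA.
exists (fun i => b i * u^-1) => [i|]; first exact: OK_mul.
by apply: eq_bigr => i _; rewrite mxE -mulrA mulKf.
Qed.

Lemma ideal_class_span m (y : 'rV[K]_m) (a : set K) :
  ideal_class (span_ideal y) = ideal_class a ->
  exists2 c : K, c != 0 & a = span_ideal (c *: y).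
Proof.
move=> cl; have : ideal_class a a.
  exists 1; rewrite ?oner_neq0 //.
  by apply/seteqP; split=> [x ax|_ [x ax <-]]; [exists x|]; rewrite ?mul1r.
by rewrite -cl => -[c c0 ->]; exists c => //; rewrite span_idealZ.
Qed.

Lemma proj_point_scale N (P : proj_space K N) (x : hcoords K N) c : c != 0 ->
  val x = c *: coords P -> P = proj_point x.
Proof.
move=> c0 xE; rewrite -[LHS]reprK; apply/eqmodP; apply/asboolP.
by exists c.
Qed.

End Generators.

Theorem theorem3p1 (R : realType) (K : fieldExtType rat) (r N : nat)
    (a : set K) (B : R) (eps : 'I_r -> K)
    (rank_r : unit_rank K r) (r_ge1 : (1 <= r)%N) (N_gt0 : (0 < N)%N)
    (a_ideal : nonzero_ideal a) (B_ge1 : 1 <= B)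
    (eps_fund : fundamental_units R eps) :
  forall P : proj_space K N, Omega a B P ->
  exists x : hcoords K N,
    (forall i, a (val x 0 i)) /\
    [/\ P = proj_point x,
        a = span_ideal (val x),
        forall i, ratr `|field_norm (val x 0 i)| <= B * (ideal_norm a)%:R
      & forall i, Pbox eps a B (Minkowski R (val x 0 i))].
Proof.
move=> P [/ideal_class_span[c c0 aE] hP].
set y := c *: coords P in aE.
have y0 : y != 0 by rewrite scaler_eq0 negb_or c0 (valP (repr P)).
have vmax0 j : 0 < vmax (emb_abs R j) y by apply: vmax_gt0 => //; exact: emb_abs_abs.
have prod_le : \prod_j vmax (emb_abs R j) y <= B * (ideal_norm a)%:R.
  have := hP; rewrite /height (@height_ideal R K N _ y c) // -?aE //; last first.
    by move=> i; rewrite aE; exact: span_ideal_coord.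
  by rewrite ler_pdivrMr // ltr0n (ideal_norm_gt0 R).
have [||u uu uP] := balancing_unit (A := fun j => vmax (emb_abs R j) y) eps_fund.
- by [].
- by move=> j; rewrite emb_abs_bar.
have u0 : u != 0 by case: uu.
have x0 : u *: y != 0 by rewrite scaler_eq0 negb_or u0.
have aEu : a = span_ideal (u *: y) by rewrite span_ideal_unit.
have abs_le j i : emb_abs R j ((u *: y) 0 i) <= emb_abs R j u * vmax (emb_abs R j) y.
  by rewrite -vmaxZ; [exact: vmax_ge|exact: emb_abs_abs].
exists (exist _ (u *: y) x0); split; first by move=> i; rewrite aEu; exact: span_ideal_coord.
split=> //= [|i|i v].
- by apply: (proj_point_scale (c := u * c)); rewrite ?mulf_neq0 //= /y scalerA.
- rewrite ratr_norm field_norm_emb_abs; apply: le_trans prod_le.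
  apply: (@le_trans _ _ (\prod_j (emb_abs R j u * vmax (emb_abs R j) y))).
    by apply: ler_prod => j _; rewrite abs_le normc_ge0.
  by rewrite big_split /= unit_norm_prod // mul1r.
have [j vE sE] := sigmaP v; rewrite /Minkowski sE.
have -> : v = inf_place_of R j by case: v vE {sE} => v vP /= vE; exact: eq_exist.
split=> [/emb_real_of_degree1 //|].
apply: le_trans (abs_le j i) _; apply: le_trans (uP j) _.
rewrite ler_wpM2r ?expR_ge0 // ge0_ler_powR ?invr_ge0 // nnegrE.
  by apply: prodr_ge0 => k _; exact: ltW.
by apply: le_trans prod_le; apply: prodr_ge0 => k _; exact: ltW.
Qed.
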